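(* Let either $a>0$ and $b>0$ be real, or $a\in\mathbb{C}\setminus\{0\}$ with $\mathrm{Re}\,a>0$ and $b=\overline{a}$. Let $m\in\mathbb{N}$ and $\alpha\in\mathbb{C}$. Suppose that at least one of the following two conditions holds: (i) $ab\leq\min\left\{\frac12,\frac{a+b}{3}\right\}$ and $|\alpha|\,(B(a,b)-1)\leq 1$; (ii) $ab\geq\max\left\{\frac12,\frac{a+b}{3}\right\}$ and $|\alpha|\leq B(a,b)-1$. Then the harmonic function $$f(z)=zF(a,b;a+b;z^2)+\overline{\frac{\alpha z^{m+1}}{m+1}\Big\{F(a,b;a+b;z^2)\ast F(2,m+1;m+2;z)\Big\}},\qquad z\in\mathbb{D},$$ belongs to $\mathcal{F}_2$ (and hence $f$ is convex in the vertical direction). Moreover, the dilatation of $f$ is $\alpha z^m$.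
   Context: $\mathbb{D}=\{z\in\mathbb{C}:|z|<1\}$, $\mathbb{N}=\{1,2,\dots\}$. $F(a,b;c;z)=\sum_{n=0}^{\infty}\frac{(a,n)(b,n)}{(c,n)(1,n)}z^n$ is the Gaussian hypergeometric function, where $(a,0)=1$ and $(a,n)=a(a+1)\cdots(a+n-1)$ for $n\ge1$. $B(a,b)=\Gamma(a)\Gamma(b)/\Gamma(a+b)$ is the beta function. $\ast$ is the Hadamard product of power series in $z$: $(\sum c_nz^n)\ast(\sum d_nz^n)=\sum c_nd_nz^n$ (with $F(a,b;a+b;z^2)$ regarded as a power series in $z$). $\mathcal{H}$ is the class of complex-valued harmonic functions $f$ in $\mathbb{D}$ with $f(0)=0=f_z(0)-1$, written $f=h+\overline{g}$ with $h,g$ analytic in $\mathbb{D}$, $h(z)=z+\sum_{n\ge2}a_nz^n$, $g(z)=\sum_{n\ge1}b_nz^n$. The dilatation of $f$ is $\omega=g'/h'$. $\mathcal{F}_2=\{f\in\mathcal{H}: \mathrm{Re}\{(1-z^2)f_z(z)\}>|(1-z^2)f_{\overline z}(z)| \text{ for all } z\in\mathbb{D}\}$. A harmonic function $f$ in $\mathbb{D}$ is convex in the vertical direction if it is univalent in $\mathbb{D}$ and every line parallel to the imaginary axis has a connected (possibly empty) intersection with $f(\mathbb{D})$. *)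

(* Defs.v *)
(* Standard-library reals with Coquelicot's complex numbers. *)
From Stdlib Require Import Reals.
From Coquelicot Require Import Coquelicot.
Open Scope C_scope.

Definition unit_disc (z : C) : Prop := (Cmod z < 1)%R.

(** * Power series and the hypergeometric function *)

Definition CSeries (c : nat -> C) : C :=
  (Series (fun n => Re (c n)), Series (fun n => Im (c n))).

Definition power_sum (c : nat -> C) (z : C) : C :=
  CSeries (fun n => c n * z ^ n).

Definition hadamard (c d : nat -> C) (n : nat) : C := c n * d n.

(* [power_sum (coef_sq c) z] is [power_sum c (z ^ 2)], as a series in [z]. *)
Definition coef_sq (c : nat -> C) (n : nat) : C :=
  if Nat.even n then c (Nat.div2 n) else 0.

(* The shifted factorial (a, n). *)
Fixpoint pochhammer (a : C) (n : nat) : C :=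
  match n with
  | O => 1
  | S k => pochhammer a k * (a + INR k)
  end.

Definition hyp_coef (a b c : C) (n : nat) : C :=
  pochhammer a n * pochhammer b n / (pochhammer c n * pochhammer 1 n).

Definition hypF (a b c z : C) : C := power_sum (hyp_coef a b c) z.

(** * Gamma and beta functions *)

(* t ^ s = exp (s ln t), for t > 0. *)
Definition Rpower_C (t : R) (s : C) : C :=
  RtoC (exp (Re s * ln t)) * (cos (Im s * ln t), sin (Im s * ln t)).

(* Euler's integral; it converges exactly when Re s > 0. *)
Definition Gamma (s : C) : C :=
  RInt_gen (V := C_R_CompleteNormedModule)
    (fun t : R => Rpower_C t (s - 1) * RtoC (exp (- t)))
    (at_right 0%R) (Rbar_locally p_infty).

Definition Beta (a b : C) : C := Gamma a * Gamma b / Gamma (a + b).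

(** * Harmonic functions in the unit disc *)

Definition pd_x (u : C -> R) (z : C) : R :=
  Derive (fun t : R => u (t, Im z)) (Re z).

Definition pd_y (u : C -> R) (z : C) : R :=
  Derive (fun t : R => u (Re z, t)) (Im z).

Definition C1_disc (u : C -> R) : Prop :=
  forall z : C, unit_disc z ->
    ex_derive (fun t : R => u (t, Im z)) (Re z) /\
    ex_derive (fun t : R => u (Re z, t)) (Im z) /\
    continuous (pd_x u) z /\ continuous (pd_y u) z.

Definition real_harmonic (u : C -> R) : Prop :=
  C1_disc u /\ C1_disc (pd_x u) /\ C1_disc (pd_y u) /\
  forall z : C, unit_disc z -> (pd_x (pd_x u) z + pd_y (pd_y u) z = 0)%R.

Definition harmonic (f : C -> C) : Prop :=
  real_harmonic (fun z => Re (f z)) /\ real_harmonic (fun z => Im (f z)).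

Definition d_x (f : C -> C) (z : C) : C :=
  (pd_x (fun w => Re (f w)) z, pd_x (fun w => Im (f w)) z).

Definition d_y (f : C -> C) (z : C) : C :=
  (pd_y (fun w => Re (f w)) z, pd_y (fun w => Im (f w)) z).

(* The Wirtinger derivatives f_z and f_{\bar z}. *)
Definition d_z (f : C -> C) (z : C) : C := (d_x f z - Ci * d_y f z) / 2.

Definition d_zbar (f : C -> C) (z : C) : C := (d_x f z + Ci * d_y f z) / 2.

(* f = h + \bar g with h = z + a_2 z^2 + ... and g = b_1 z + b_2 z^2 + ...
   analytic in the disc; this determines h and g there. *)
Definition canonical_parts (f h g : C -> C) : Prop :=
  (exists p q : nat -> C,
     p 0%nat = 0 /\ p 1%nat = 1 /\ q 0%nat = 0 /\
     forall z : C, unit_disc z ->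
       is_pseries (K := C_AbsRing) (V := C_NormedModule) p z (h z) /\
       is_pseries (K := C_AbsRing) (V := C_NormedModule) q z (g z)) /\
  forall z : C, unit_disc z -> f z = h z + Cconj (g z).

Definition class_H (f : C -> C) : Prop :=
  harmonic f /\ f 0 = 0 /\ d_z f 0 = 1 /\
  exists h g : C -> C, canonical_parts f h g.

Definition has_dilatation (f w : C -> C) : Prop :=
  exists h g : C -> C, canonical_parts f h g /\
    forall z : C, unit_disc z ->
      exists h' g' : C,
        is_derive (K := C_AbsRing) (V := C_NormedModule) h z h' /\
        is_derive (K := C_AbsRing) (V := C_NormedModule) g z g' /\
        h' <> 0 /\ w z = g' / h'.

Definition class_F2 (f : C -> C) : Prop :=
  class_H f /\
  forall z : C, unit_disc z ->
    (Re ((1 - z ^ 2) * d_z f z) > Cmod ((1 - z ^ 2) * d_zbar f z))%R.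

(** * Convexity in the vertical direction *)

Definition univalent (f : C -> C) : Prop :=
  forall z w : C, unit_disc z -> unit_disc w -> f z = f w -> z = w.

(* No two open sets that are disjoint on [A] separate [A]; the empty set counts
   as connected. *)
Definition connected_set (A : C -> Prop) : Prop :=
  forall U V : C -> Prop,
    open U -> open V ->
    (forall z, A z -> U z \/ V z) ->
    (forall z, A z -> U z -> V z -> False) ->
    (exists z, A z /\ U z) -> (exists z, A z /\ V z) -> False.

Definition convex_vertical (f : C -> C) : Prop :=
  harmonic f /\ univalent f /\
  forall x : R,
    connected_set (fun w => Re w = x /\ exists z : C, unit_disc z /\ f z = w).

(* Main.v *)
Require Import Defs.
From Stdlib Require Import Reals Lra Lia Psatz Factorial ClassicalEpsilon.
From Coquelicot Require Import Coquelicot.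
Open Scope C_scope.

(** Write [h(z) = z F(a, b; a+b; z^2)] with coefficients [A_n] on [z^(2n+1)], and
    [g] for the co-analytic part.  The kernel in the Hadamard product is chosen so
    that [g' = alpha z^m h'], which is the statement on the dilatation.  With
    [t_n = (2n+1) A_n] one has [h'(z) = sum t_n z^(2n)], and
    [T(z) = (1 - z^2) h'(z) = 1 + sum (t_(n+1) - t_n) z^(2n+2)].

    The sign of [t_(n+1) - t_n] is that of [(2ab - 1) n + (3ab - (a+b))], so the
    conditions on [ab] say that [t] is decreasing, respectively increasing
    ([odd_coef_monotone]).  Its limit is [L = 2 / B(a,b)] ([odd_coef_limit],
    [Beta_limit]).  Hence the coefficients of [T - 1] have one sign and add up to
    [L - 1], so that [T] stays in the disc of radius [r = |L - 1|] about 1; the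
    two conditions on [alpha] both read [|alpha| (1 + r) <= 1 - r], and this gives
    [|alpha z^m T| < Re T] ([sheared_disc]).

    The value of [L] rests on Euler's limit
    [Gamma s = lim n^s n! / (s (s+1) ... (s+n))], proved for [Re s > 0] from the
    integral by comparing [exp (-t)] with [(1 - t/n)^n]
    ([gamma_partial_integral]).  Multiplying these limits for [a], [b] and [a+b]
    leaves exactly [(n+1) A_(n+1) -> 1 / B(a,b)] ([Gamma_product]).

    For the convexity, the map [z = (w-1)/(w+1)] with [w = exp t (1 + i s)]
    identifies the plane of pairs [(t, s)] with the disc, in such a way that
    [dz/dt = (1 - z^2)/2].  Along [t] the real part of [f] is that of the analytic
    function [h + g], and its derivative is [Re ((1 - z^2)(h' + g'))/2 > 0].  At
    the ends [z -> 1] and [z -> -1] of these curves [(1 - z^2)(h' + g')] tends to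
    [L (1 + alpha)] and [L (1 + alpha (-1)^m)], numbers which have positive real
    part or vanish because [|alpha| <= 1].  In the first case [Re f] is unbounded
    towards that end, in the second its limits on different curves agree
    ([ray_reach]).  So every level set of [Re f] which is not empty is the graph
    of a function of [s] on the whole line, and on it [Im f] is strictly
    increasing because the Jacobian is positive ([level_curve]).  Injectivity and
    connectedness of the vertical slices follow
    ([convex_vertical_of_boundary_limits]). *)

(** * Real and imaginary parts *)

Lemma Im_le_Cmod (z : C) : (Rabs (Im z) <= Cmod z)%R.
Proof.
  eapply Rle_trans; [apply Rmax_r | apply (Rmax_Cmod z)].
Qed.

Lemma Cmod_le_Re_Im (z : C) : (Cmod z <= Rabs (Re z) + Rabs (Im z))%R.
Proof.
  assert (H := Cmod2_alt z).
  assert (H0 := Cmod_ge_0 z).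
  assert (H1 := Rabs_pos (Re z)). assert (H2 := Rabs_pos (Im z)).
  rewrite <- (pow2_abs (Re z)), <- (pow2_abs (Im z)) in H.
  apply Rnot_lt_le; intro; nra.
Qed.

Lemma Cmod_minus_triangle (z w : C) : (Cmod (z - w) <= Cmod z + Cmod w)%R.
Proof.
  unfold Cminus. rewrite <- (Cmod_opp w). apply Cmod_triangle.
Qed.

Lemma Cmod_triangle_rev (z w : C) : (Cmod z - Cmod w <= Cmod (z - w))%R.
Proof.
  assert (H := Cmod_triangle (z - w) w).
  replace (z - w + w) with z in H by ring. lra.
Qed.

Lemma Re_minus (z w : C) : Re (z - w) = (Re z - Re w)%R.
Proof. reflexivity. Qed.

Lemma Im_minus (z w : C) : Im (z - w) = (Im z - Im w)%R.
Proof. reflexivity. Qed.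

Lemma C_ext (z w : C) : Re z = Re w -> Im z = Im w -> z = w.
Proof. destruct z, w; simpl; intros -> ->; reflexivity. Qed.

Lemma C_neq_0_Re (z : C) : (0 < Re z)%R -> z <> 0.
Proof. intros H E. rewrite E in H. simpl in H. lra. Qed.

(** * Absolutely convergent complex series *)

Definition summable (c : nat -> C) : Prop := ex_series (fun n => Cmod (c n)).

Lemma summable_le (c : nat -> C) (u : nat -> R) :
  (forall n, Cmod (c n) <= u n)%R -> ex_series u -> summable c.
Proof.
  intros H Hu. apply (ex_series_le (K := R_AbsRing) (V := R_CompleteNormedModule) _ u); [|exact Hu].
  intro n. simpl. unfold norm; simpl. unfold abs; simpl.
  rewrite Rabs_pos_eq by apply Cmod_ge_0. apply H.
Qed.

Lemma ex_series_le_abs (u v : nat -> R) :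
  (forall n, Rabs (u n) <= v n)%R -> ex_series v -> ex_series u.
Proof.
  intros H Hv.
  exact (ex_series_le (K := R_AbsRing) (V := R_CompleteNormedModule) u v H Hv).
Qed.

Lemma summable_Re (c : nat -> C) : summable c -> ex_series (fun n => Re (c n)).
Proof. intro H. apply (ex_series_le_abs _ _ (fun n => re_le_Cmod (c n)) H). Qed.

Lemma summable_Im (c : nat -> C) : summable c -> ex_series (fun n => Im (c n)).
Proof. intro H. apply (ex_series_le_abs _ _ (fun n => Im_le_Cmod (c n)) H). Qed.

Lemma summable_plus (c d : nat -> C) :
  summable c -> summable d -> summable (fun n => c n + d n).
Proof.
  intros Hc Hd. apply (summable_le _ (fun n => Cmod (c n) + Cmod (d n))%R).
  - intro n. apply Cmod_triangle.
  - exact (ex_series_plus (V := R_NormedModule) _ _ Hc Hd).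
Qed.

Lemma summable_scal (k : C) (c : nat -> C) :
  summable c -> summable (fun n => k * c n).
Proof.
  intros Hc. apply (summable_le _ (fun n => Cmod k * Cmod (c n))%R).
  - intro n. rewrite Cmod_mult. lra.
  - exact (ex_series_scal (V := R_NormedModule) (Cmod k) _ Hc).
Qed.

Lemma summable_minus (c d : nat -> C) :
  summable c -> summable d -> summable (fun n => c n - d n).
Proof.
  intros Hc Hd. apply (summable_plus _ (fun n => - d n) Hc).
  unfold summable. eapply ex_series_ext; [|exact Hd]. intro n. simpl. now rewrite Cmod_opp.
Qed.

Lemma summable_shift (c : nat -> C) :
  summable c <-> summable (fun n => c (S n)).
Proof. unfold summable. apply (ex_series_incr_1 (V := R_NormedModule) (fun n => Cmod (c n))). Qed.

Lemma CSeries_ext (c d : nat -> C) :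
  (forall n, c n = d n) -> CSeries c = CSeries d.
Proof.
  intro H. unfold CSeries. f_equal; apply Series_ext; intro n; now rewrite H.
Qed.

Lemma CSeries_plus (c d : nat -> C) :
  summable c -> summable d ->
  CSeries (fun n => c n + d n) = CSeries c + CSeries d.
Proof.
  intros Hc Hd. apply C_ext; simpl.
  - apply (Series_plus (fun n => Re (c n)) (fun n => Re (d n))); now apply summable_Re.
  - apply (Series_plus (fun n => Im (c n)) (fun n => Im (d n))); now apply summable_Im.
Qed.

Lemma CSeries_scal (k : C) (c : nat -> C) :
  summable c -> CSeries (fun n => k * c n) = k * CSeries c.
Proof.
  intro Hc.
  assert (Hr := summable_Re c Hc). assert (Hi := summable_Im c Hc).
  apply C_ext; simpl.
  - rewrite <- !Series_scal_l, <- Series_minus.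
    + reflexivity.
    + exact (ex_series_scal (V := R_NormedModule) (fst k) _ Hr).
    + exact (ex_series_scal (V := R_NormedModule) (snd k) _ Hi).
  - rewrite <- !Series_scal_l, <- Series_plus.
    + reflexivity.
    + exact (ex_series_scal (V := R_NormedModule) (fst k) _ Hi).
    + exact (ex_series_scal (V := R_NormedModule) (snd k) _ Hr).
Qed.

Lemma CSeries_minus (c d : nat -> C) :
  summable c -> summable d ->
  CSeries (fun n => c n - d n) = CSeries c - CSeries d.
Proof.
  intros Hc Hd.
  rewrite (CSeries_ext _ (fun n => c n + (-(1)) * d n)) by (intro; ring).
  rewrite CSeries_plus, CSeries_scal; auto using summable_scal. ring.
Qed.

Lemma CSeries_shift (c : nat -> C) :
  summable c -> CSeries c = c 0%nat + CSeries (fun n => c (S n)).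
Proof.
  intro Hc. apply C_ext; simpl.
  - apply (Series_incr_1 (fun n => Re (c n))). now apply summable_Re.
  - apply (Series_incr_1 (fun n => Im (c n))). now apply summable_Im.
Qed.

Lemma Series_zero : Series (fun _ => 0%R) = 0%R.
Proof.
  rewrite (Series_ext _ (fun _ => (0 * 0)%R)) by (intro; ring).
  rewrite Series_scal_l. ring.
Qed.

Lemma Series_nonneg (u : nat -> R) : (forall n, 0 <= u n)%R -> ex_series u -> (0 <= Series u)%R.
Proof.
  intros H Hu. rewrite <- Series_zero. apply Series_le; [|exact Hu].
  intro n. split; [lra|apply H].
Qed.

(** Rotating the sum to the positive axis reduces the bound to real parts. *)
Lemma Cmod_CSeries_le (c : nat -> C) (u : nat -> R) :
  (forall n, Cmod (c n) <= u n)%R -> ex_series u ->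
  (Cmod (CSeries c) <= Series u)%R.
Proof.
  intros H Hu.
  assert (Hc : summable c) by now apply (summable_le c u).
  set (s := CSeries c).
  assert (Hpos : (0 <= Series u)%R).
  { apply Series_nonneg; [|exact Hu]. intro n.
    eapply Rle_trans; [apply Cmod_ge_0|apply H]. }
  destruct (Ceq_dec s 0) as [E|E]; [rewrite E, Cmod_0; exact Hpos|].
  assert (Hs : (0 < Cmod s)%R) by now apply Cmod_gt_0.
  set (k := Cconj s / Cmod s).
  assert (Hsn : RtoC (Cmod s) <> 0) by (intro A; apply RtoC_inj in A; lra).
  assert (Hk : Cmod k = 1%R).
  { unfold k. rewrite Cmod_div, Cmod_conj, Cmod_R, Rabs_pos_eq by (auto; lra).
    field; lra. }
  assert (E1 : CSeries (fun n => k * c n) = Cmod s).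
  { rewrite CSeries_scal by exact Hc. fold s. unfold k.
    assert (E2 := Cmod2_conj s). rewrite RtoC_pow in E2. simpl in E2.
    replace (Cconj s / Cmod s * s) with (s * Cconj s / Cmod s) by (field; auto).
    rewrite <- E2. field; auto. }
  apply (f_equal Re) in E1. simpl in E1. rewrite <- E1.
  eapply Rle_trans; [apply Rle_abs|].
  assert (HA : forall n, (Rabs (Re (k * c n)) <= u n)%R).
  { intro n. eapply Rle_trans; [apply re_le_Cmod|]. rewrite Cmod_mult, Hk, Rmult_1_l. apply H. }
  eapply Rle_trans; [apply (Series_Rabs (fun n => Re (k * c n)))|].
  - apply (ex_series_le_abs _ u); [|exact Hu]. intro n. rewrite Rabs_Rabsolu. apply HA.
  - apply Series_le; [|exact Hu]. intro n. split; [apply Rabs_pos|apply HA].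
Qed.

Lemma sum_n_Re_Im (c : nat -> C) (n : nat) :
  sum_n (G := C_NormedModule) c n
  = (sum_n (fun k => Re (c k)) n, sum_n (fun k => Im (c k)) n).
Proof.
  induction n as [|n IH].
  - rewrite !sum_O. now destruct (c 0%nat).
  - rewrite !sum_Sn, IH. now destruct (c (S n)).
Qed.

Lemma CSeries_correct (c : nat -> C) :
  summable c -> is_series (K := C_AbsRing) (V := C_NormedModule) c (CSeries c).
Proof.
  intro Hc. unfold is_series.
  apply filterlim_ext with
    (fun n => (sum_n (fun k => Re (c k)) n, sum_n (fun k => Im (c k)) n)).
  { intro n. symmetry. apply sum_n_Re_Im. }
  assert (Hr := Series_correct _ (summable_Re c Hc)).
  assert (Hi := Series_correct _ (summable_Im c Hc)).
  intros P [eps HP].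
  assert (H1 := proj1 (filterlim_locally _ _) Hr eps).
  assert (H2 := proj1 (filterlim_locally _ _) Hi eps).
  assert (H := filter_and _ _ H1 H2). destruct H as [N H].
  exists N. intros n Hn. destruct (H n Hn) as [A B]. apply HP. split; assumption.
Qed.

(** * Complex power series on the unit disc *)

Definition converges_on_disc (p : nat -> C) : Prop :=
  Rbar_le 1%R (CV_radius (fun n => Cmod (p n))).

Definition derive_coef (p : nat -> C) (n : nat) : C := INR (S n) * p (S n).

Lemma Cmod_INR (n : nat) : Cmod (INR n) = INR n.
Proof. rewrite Cmod_R, Rabs_pos_eq; [reflexivity|apply pos_INR]. Qed.

Lemma converges_on_disc_derive (p : nat -> C) :
  converges_on_disc p -> converges_on_disc (derive_coef p).
Proof.
  unfold converges_on_disc. intro H.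
  rewrite (CV_radius_ext _ (PS_derive (fun n => Cmod (p n)))).
  - now rewrite CV_radius_derive.
  - intro n. unfold derive_coef, PS_derive. now rewrite Cmod_mult, Cmod_INR.
Qed.

Lemma converges_on_disc_ex_series (p : nat -> C) (r : R) :
  converges_on_disc p -> (0 <= r < 1)%R ->
  ex_series (fun n => Cmod (p n) * r ^ n)%R.
Proof.
  intros H Hr.
  assert (L : Rbar_lt (Rabs r) (CV_radius (fun n => Cmod (p n)))).
  { eapply Rbar_lt_le_trans; [|exact H]. simpl. rewrite Rabs_pos_eq; lra. }
  apply CV_disk_inside in L. revert L. apply ex_series_ext. intro n.
  apply Rabs_pos_eq. apply Rmult_le_pos; [apply Cmod_ge_0|apply pow_le; lra].
Qed.

Lemma converges_on_disc_bounded (p : nat -> C) (M : R) :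
  (forall n, Cmod (p n) <= M)%R -> converges_on_disc p.
Proof.
  intro H. unfold converges_on_disc.
  apply (CV_radius_bounded (fun n => Cmod (p n))).
  exists M. intro n. rewrite pow1, Rmult_1_r, Rabs_pos_eq by apply Cmod_ge_0. apply H.
Qed.

Lemma summable_power (p : nat -> C) (z : C) :
  converges_on_disc p -> unit_disc z -> summable (fun n => p n * z ^ n).
Proof.
  intros Hp Hz. apply (summable_le _ (fun n => Cmod (p n) * Cmod z ^ n)%R).
  - intro n. rewrite Cmod_mult, Cmod_pow. lra.
  - apply converges_on_disc_ex_series; auto. split; [apply Cmod_ge_0|exact Hz].
Qed.

Lemma pow_n_Cpow (z : C) (n : nat) : pow_n (K := C_Ring) z n = z ^ n.
Proof. induction n; simpl; [reflexivity|now rewrite IHn]. Qed.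

Lemma power_sum_is_pseries (p : nat -> C) (z : C) :
  converges_on_disc p -> unit_disc z ->
  is_pseries (K := C_AbsRing) (V := C_NormedModule) p z (power_sum p z).
Proof.
  intros Hp Hz. unfold is_pseries.
  apply is_series_ext with (fun n => p n * z ^ n).
  - intro n. transitivity (pow_n (K := C_Ring) z n * p n); [|reflexivity].
    transitivity (z ^ n * p n); [apply Cmult_comm|]. now rewrite <- (pow_n_Cpow z n).
  - apply CSeries_correct. now apply summable_power.
Qed.

(** By induction: the remainder of exponent [n+3] is [w] times that of exponent
    [n+2], plus [(n+2) z^(n+1) (w - z)^2]. *)
Lemma Cpow_taylor (r : R) (z w : C) (n : nat) :
  (Cmod z <= r)%R -> (Cmod w <= r)%R ->
  (Cmod (w ^ (S (S n)) - z ^ (S (S n)) - INR (S (S n)) * z ^ (S n) * (w - z))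
   <= INR (S (S n)) * INR (S n) * r ^ n * Cmod (w - z) ^ 2)%R.
Proof.
  intros Hz Hw. assert (Hr : (0 <= r)%R) by (assert (H := Cmod_ge_0 z); lra).
  assert (Hd := Cmod_ge_0 (w - z)).
  induction n as [|n IH].
  - replace (w ^ 2 - z ^ 2 - INR 2 * z ^ 1 * (w - z)) with ((w - z) ^ 2).
    + rewrite Cmod_pow. simpl. nra.
    + simpl. rewrite RtoC_plus. ring.
  - set (e := w ^ (S (S n)) - z ^ (S (S n)) - INR (S (S n)) * z ^ (S n) * (w - z)) in *.
    replace (w ^ (S (S (S n))) - z ^ (S (S (S n))) - INR (S (S (S n))) * z ^ (S (S n)) * (w - z))
      with (w * e + INR (S (S n)) * z ^ (S n) * (w - z) ^ 2).
    2:{ unfold e. rewrite (S_INR (S (S n))), RtoC_plus. simpl Cpow. ring. }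
    eapply Rle_trans; [apply Cmod_triangle|].
    rewrite !Cmod_mult, Cmod_INR, !Cmod_pow.
    assert (A : (Cmod w * Cmod e <= r * (INR (S (S n)) * INR (S n) * r ^ n * Cmod (w - z) ^ 2))%R).
    { apply Rmult_le_compat; auto using Cmod_ge_0. }
    assert (B : (Cmod z ^ S n <= r ^ S n)%R) by (apply pow_incr; split; auto using Cmod_ge_0).
    assert (B' : (INR (S (S n)) * Cmod z ^ S n * Cmod (w - z) ^ 2
                 <= INR (S (S n)) * r ^ S n * Cmod (w - z) ^ 2)%R).
    { apply Rmult_le_compat_r; [apply pow_le; auto|].
      apply Rmult_le_compat_l; [apply pos_INR|auto]. }
    assert (Qr : (0 <= r ^ n)%R) by (apply pow_le; auto).
    assert (Qd : (0 <= Cmod (w - z) ^ 2)%R) by (apply pow_le; auto).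
    eapply Rle_trans; [apply Rplus_le_compat; [exact A|exact B']|].
    assert (Q' : (0 <= INR (S (S n)) * (r * (r ^ n * Cmod (w - z) ^ 2)))%R).
    { apply Rmult_le_pos; [apply pos_INR|]. apply Rmult_le_pos; [auto|].
      apply Rmult_le_pos; auto. }
    rewrite (S_INR (S (S n))). rewrite (S_INR (S n)) in *. simpl pow in *. nra.
Qed.

(** On a smaller disc the difference quotients converge uniformly to the
    differentiated series, at the rate of the second-order Taylor bound. *)
Lemma power_sum_taylor (p : nat -> C) (r : R) :
  converges_on_disc p -> (0 <= r < 1)%R ->
  exists K : R, (0 <= K)%R /\ forall z w : C, (Cmod z <= r)%R -> (Cmod w <= r)%R ->
  (Cmod (power_sum p w - power_sum p z - power_sum (derive_coef p) z * (w - z))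
   <= K * Cmod (w - z) ^ 2)%R.
Proof.
  intros Hp Hr.
  assert (Hp1 := converges_on_disc_derive p Hp).
  assert (Hp2 := converges_on_disc_derive _ Hp1).
  assert (HS := converges_on_disc_ex_series _ r Hp2 Hr).
  exists (Series (fun n => Cmod (derive_coef (derive_coef p) n) * r ^ n)%R).
  split.
  { apply Series_nonneg; [|exact HS]. intro n.
    apply Rmult_le_pos; [apply Cmod_ge_0|apply pow_le; lra]. }
  intros z w Hz Hw.
  assert (Dz : unit_disc z) by (unfold unit_disc; lra).
  assert (Dw : unit_disc w) by (unfold unit_disc; lra).
  assert (Sz := summable_power p z Hp Dz). assert (Sw := summable_power p w Hp Dw).
  assert (S1 := summable_power _ z Hp1 Dz).
  set (t := fun n => match n return C with O => RtoC 0 | S k => (w - z) * (derive_coef p k * z ^ k) end).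
  assert (St : summable t).
  { apply summable_shift. unfold t. now apply summable_scal. }
  assert (Et : CSeries t = power_sum (derive_coef p) z * (w - z)).
  { rewrite CSeries_shift by exact St. unfold t at 1.
    unfold t. rewrite CSeries_scal by exact S1. unfold power_sum. ring. }
  rewrite <- Et. unfold power_sum at 1 2.
  rewrite <- CSeries_minus by assumption.
  assert (Sd : summable (fun n => p n * w ^ n - p n * z ^ n)).
  { now apply summable_minus. }
  rewrite <- CSeries_minus by assumption.
  assert (Se : summable (fun n => p n * w ^ n - p n * z ^ n - t n)).
  { now apply summable_minus. }
  rewrite (CSeries_shift _ Se), (CSeries_shift _ (proj1 (summable_shift _) Se)).
  replace (p 0%nat * w ^ 0 - p 0%nat * z ^ 0 - t 0%nat) with (RtoC 0) by (unfold t; simpl; ring).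
  replace (p 1%nat * w ^ 1 - p 1%nat * z ^ 1 - t 1%nat) with (RtoC 0)
    by (unfold t, derive_coef; simpl; ring).
  rewrite !Cplus_0_l.
  rewrite Rmult_comm, <- Series_scal_l.
  apply Cmod_CSeries_le.
  - intro n.
    replace (p (S (S n)) * w ^ (S (S n)) - p (S (S n)) * z ^ (S (S n)) - t (S (S n))) with
      (p (S (S n)) * (w ^ (S (S n)) - z ^ (S (S n)) - INR (S (S n)) * z ^ (S n) * (w - z))).
    2:{ unfold t, derive_coef. ring. }
    rewrite Cmod_mult.
    eapply Rle_trans.
    { apply Rmult_le_compat_l; [apply Cmod_ge_0|]. apply Cpow_taylor; eassumption. }
    unfold derive_coef. rewrite !Cmod_mult, !Cmod_INR. right. ring.
  - apply (ex_series_scal (V := R_NormedModule)). exact HS.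
Qed.

(** * Complex differentiability *)

Notation is_C_derive := (is_derive (K := C_AbsRing) (V := C_NormedModule)).

Lemma is_C_derive_eps (phi : C -> C) (z l : C) :
  is_C_derive phi z l <->
  forall eps : R, (0 < eps)%R -> exists delta : R, (0 < delta)%R /\
    forall w : C, (Cmod (w - z) < delta)%R ->
      (Cmod (phi w - phi z - l * (w - z)) <= eps * Cmod (w - z))%R.
Proof.
  split.
  - intros [_ H] eps He.
    specialize (H z (fun P HP => HP) (mkposreal eps He)).
    destruct H as [d Hd]. exists d. split; [apply cond_pos|].
    intros w Hw. specialize (Hd w Hw). simpl in Hd.
    rewrite (Cmult_comm l). exact Hd.
  - intro H. split; [apply (is_linear_scal_l (K := C_AbsRing) (V := C_NormedModule))|].
    intros x Hx.
    apply (is_filter_lim_locally_unique (K := C_AbsRing) (V := AbsRing_NormedModule C_AbsRing)) in Hx.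
    subst x. intros [eps He]. destruct (H eps He) as [d [Hd0 Hd]].
    exists (mkposreal d Hd0). intros w Hw. specialize (Hd w Hw). simpl.
    rewrite (Cmult_comm l) in Hd. exact Hd.
Qed.

Lemma is_C_derive_quadratic (phi : C -> C) (z l : C) (K delta : R) :
  (0 < delta)%R ->
  (forall w : C, (Cmod (w - z) < delta)%R ->
      (Cmod (phi w - phi z - l * (w - z)) <= K * Cmod (w - z) ^ 2)%R) ->
  is_C_derive phi z l.
Proof.
  intros Hd H. apply is_C_derive_eps. intros eps He.
  exists (Rmin delta (eps / (Rabs K + 1))).
  assert (HK := Rabs_pos K). assert (HK' := Rle_abs K).
  split.
  { apply Rmin_glb_lt; [exact Hd|]. apply Rdiv_lt_0_compat; lra. }
  intros w Hw. assert (H0 := Cmod_ge_0 (w - z)).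
  assert (H1 := Rmin_l delta (eps / (Rabs K + 1))).
  assert (H2 := Rmin_r delta (eps / (Rabs K + 1))).
  eapply Rle_trans; [apply H; lra|].
  assert (H3 : ((Rabs K + 1) * Cmod (w - z) <= eps)%R).
  { apply Rle_trans with ((Rabs K + 1) * (eps / (Rabs K + 1)))%R.
    - apply Rmult_le_compat_l; lra.
    - right. field. lra. }
  nra.
Qed.

Lemma is_C_derive_scal (phi : C -> C) (z l k : C) :
  is_C_derive phi z l -> is_C_derive (fun w => k * phi w) z (k * l).
Proof.
  rewrite !is_C_derive_eps. intros H eps He. assert (Hk := Cmod_ge_0 k).
  destruct (H (eps / (Cmod k + 1))%R) as [d [Hd HH]]; [apply Rdiv_lt_0_compat; lra|].
  exists d. split; [exact Hd|]. intros w Hw.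
  replace (k * phi w - k * phi z - k * l * (w - z)) with (k * (phi w - phi z - l * (w - z))) by ring.
  rewrite Cmod_mult.
  eapply Rle_trans; [apply Rmult_le_compat_l; [exact Hk|apply HH, Hw]|].
  assert (E : (eps = (Cmod k + 1) * (eps / (Cmod k + 1)))%R) by (field; lra).
  assert (P : (0 < eps / (Cmod k + 1))%R) by (apply Rdiv_lt_0_compat; lra).
  assert (Q := Cmod_ge_0 (w - z)). nra.
Qed.

Lemma is_C_derive_plus (phi psi : C -> C) (z l m : C) :
  is_C_derive phi z l -> is_C_derive psi z m ->
  is_C_derive (fun w => phi w + psi w) z (l + m).
Proof. apply (is_derive_plus (K := C_AbsRing) (V := C_NormedModule)). Qed.

Lemma unit_disc_nbhd (z : C) : unit_disc z ->
  (0 < 1 - Cmod z)%R /\ forall w : C, (Cmod (w - z) < 1 - Cmod z)%R -> unit_disc w.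
Proof.
  unfold unit_disc. intro H. split; [lra|]. intros w Hw.
  assert (A := Cmod_triangle_rev w z). lra.
Qed.

Lemma power_sum_derive (p : nat -> C) (z : C) :
  converges_on_disc p -> unit_disc z ->
  is_C_derive (power_sum p) z (power_sum (derive_coef p) z).
Proof.
  intros Hp Hz. unfold unit_disc in Hz. assert (Hz0 := Cmod_ge_0 z).
  destruct (power_sum_taylor p ((1 + Cmod z) / 2) Hp) as [K [_ HK]]; [lra|].
  apply is_C_derive_quadratic with K ((1 - Cmod z) / 2)%R; [lra|].
  intros w Hw. apply HK; [lra|]. assert (A := Cmod_triangle_rev w z). lra.
Qed.

(** The real differential of a complex-differentiable function satisfies the
    Cauchy-Riemann equations. *)
Lemma is_C_derive_differentiable (phi : C -> C) (x y : R) (l : C) :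
  is_C_derive phi (x, y) l ->
  differentiable_pt_lim (fun u v => Re (phi (u, v))) x y (Re l) (- Im l) /\
  differentiable_pt_lim (fun u v => Im (phi (u, v))) x y (Im l) (Re l).
Proof.
  intro H. rewrite is_C_derive_eps in H.
  assert (G : forall eps : posreal, exists delta : posreal, forall u v : R,
     (Rabs (u - x) < delta)%R -> (Rabs (v - y) < delta)%R ->
     (Cmod (phi (u, v) - phi (x, y) - l * ((u, v) - (x, y)))
      <= eps * Rmax (Rabs (u - x)) (Rabs (v - y)))%R).
  { intros eps. assert (He := cond_pos eps).
    assert (He2 : (0 < eps / 2)%R) by lra.
    destruct (H _ He2) as [d [Hd HH]].
    assert (Hd2 : (0 < d / 2)%R) by lra. exists (mkposreal _ Hd2). simpl.
    intros u v Hu Hv.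
    assert (A := Cmod_le_Re_Im ((u, v) - (x, y))). simpl in A.
    change (u + - x)%R with (u - x)%R in A. change (v + - y)%R with (v - y)%R in A.
    eapply Rle_trans; [apply HH; lra|].
    assert (M1 := Rmax_l (Rabs (u - x)) (Rabs (v - y))).
    assert (M2 := Rmax_r (Rabs (u - x)) (Rabs (v - y))). nra. }
  split; intro eps; destruct (G eps) as [d Hd]; exists d; intros u v Hu Hv;
    (eapply Rle_trans; [|apply (Hd u v Hu Hv)]).
  - eapply Rle_trans; [|apply re_le_Cmod]. right. f_equal. simpl. unfold Re, Im. ring.
  - eapply Rle_trans; [|apply Im_le_Cmod]. right. f_equal. simpl. unfold Re, Im. ring.
Qed.

Lemma differentiable_pt_lim_partials (F : R -> R -> R) (x y lx ly : R) :
  differentiable_pt_lim F x y lx ly ->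
  is_derive (fun t => F t y) x lx /\ is_derive (fun t => F x t) y ly.
Proof.
  intro H. split; apply is_derive_Reals.
  - replace lx with (lx * 1 + ly * 0)%R by ring.
    apply (derivable_pt_lim_comp_2d F (fun t => t) (fun _ => y)); [exact H| |].
    + apply derivable_pt_lim_id.
    + apply derivable_pt_lim_const.
  - replace ly with (lx * 0 + ly * 1)%R by ring.
    apply (derivable_pt_lim_comp_2d F (fun _ => x) (fun t => t)); [exact H| |].
    + apply derivable_pt_lim_const.
    + apply derivable_pt_lim_id.
Qed.

Lemma is_C_derive_continuous_Re (phi : C -> C) (z l : C) :
  is_C_derive phi z l ->
  continuous (U := R_UniformSpace) (fun w : C => Re (phi w)) z.
Proof.
  intro H. destruct z as [x y].
  apply is_C_derive_differentiable in H. destruct H as [H _].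
  assert (Hc := differentiable_continuity_pt (fun u v => Re (phi (u, v))) x y
                 (ex_intro _ _ (ex_intro _ _ H))).
  intros P [eps HP]. destruct (Hc eps) as [d Hd].
  exists d. intros [u v] [Hu Hv]. apply HP. apply (Hd u v); assumption.
Qed.

(** * Harmonic functions from analytic ones *)

Lemma unit_disc_locally (z : C) : unit_disc z ->
  locally (Re z) (fun t => unit_disc (t, Im z)) /\
  locally (Im z) (fun t => unit_disc (Re z, t)) /\
  locally (T := C_UniformSpace) z unit_disc.
Proof.
  intro Hz. destruct (unit_disc_nbhd z Hz) as [Hd H].
  assert (Hd2 : (0 < (1 - Cmod z) / 2)%R) by lra.
  assert (G : forall u v, (Rabs (u - Re z) < (1 - Cmod z) / 2)%R ->
     (Rabs (v - Im z) < (1 - Cmod z) / 2)%R -> unit_disc (u, v)).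
  { intros u v Hu Hv. apply H.
    assert (A := Cmod_le_Re_Im ((u, v) - z)).
    rewrite Re_minus, Im_minus in A. simpl in A. lra. }
  repeat split; exists (mkposreal _ Hd2).
  - intros t Ht. apply G; [exact Ht|]. rewrite Rminus_diag, Rabs_R0; lra.
  - intros t Ht. apply G; [|exact Ht]. rewrite Rminus_diag, Rabs_R0; lra.
  - intros [u v] [Hu Hv]. apply G; assumption.
Qed.

Lemma real_part_partials (u : C -> R) (phi phi1 : C -> C) :
  (forall z, unit_disc z -> u z = Re (phi z)) ->
  (forall z, unit_disc z -> is_C_derive phi z (phi1 z)) ->
  forall z, unit_disc z ->
  is_derive (fun t => u (t, Im z)) (Re z) (Re (phi1 z)) /\
  is_derive (fun t => u (Re z, t)) (Im z) (Re (Ci * phi1 z)).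
Proof.
  intros Hu H1 z Hz. assert (H := H1 z Hz).
  destruct (unit_disc_locally z Hz) as [Lx [Ly _]].
  assert (H' : is_C_derive phi (Re z, Im z) (phi1 z)) by (destruct z; exact H).
  clear H; rename H' into H.
  apply is_C_derive_differentiable in H. destruct H as [H _].
  apply differentiable_pt_lim_partials in H. destruct H as [A B].
  split.
  - eapply is_derive_ext_loc; [|exact (A)].
    revert Lx. apply filter_imp. intros t Ht. symmetry. apply (Hu _ Ht).
  - replace (Re (Ci * phi1 z)) with (- Im (phi1 z))%R by (simpl; unfold Im; ring).
    eapply is_derive_ext_loc; [|exact (B)].
    revert Ly. apply filter_imp. intros t Ht. symmetry. apply (Hu _ Ht).
Qed.

Lemma real_part_C1 (u : C -> R) (phi phi1 phi2 : C -> C) :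
  (forall z, unit_disc z -> u z = Re (phi z)) ->
  (forall z, unit_disc z -> is_C_derive phi z (phi1 z)) ->
  (forall z, unit_disc z -> is_C_derive phi1 z (phi2 z)) ->
  C1_disc u /\
  (forall z, unit_disc z -> pd_x u z = Re (phi1 z)) /\
  (forall z, unit_disc z -> pd_y u z = Re (Ci * phi1 z)).
Proof.
  intros Hu H1 H2.
  assert (P := real_part_partials u phi phi1 Hu H1).
  assert (Px : forall z, unit_disc z -> pd_x u z = Re (phi1 z)).
  { intros z Hz. apply is_derive_unique. apply (P z Hz). }
  assert (Py : forall z, unit_disc z -> pd_y u z = Re (Ci * phi1 z)).
  { intros z Hz. apply is_derive_unique. apply (P z Hz). }
  split; [|split; assumption].
  intros z Hz. destruct (P z Hz) as [A B].
  destruct (unit_disc_locally z Hz) as [_ [_ L]].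
  split; [eexists; exact A|split; [eexists; exact B|split]].
  - apply (continuous_ext_loc (T := C_UniformSpace) (U := R_UniformSpace) (pd_x u) (fun w => Re (phi1 w)) z).
    + destruct L as [d HL]. exists d. intros w Hw. symmetry. exact (Px w (HL w Hw)).
    + apply (is_C_derive_continuous_Re phi1 z (phi2 z)); auto.
  - apply (continuous_ext_loc (T := C_UniformSpace) (U := R_UniformSpace) (pd_y u) (fun w => Re (Ci * phi1 w)) z).
    + destruct L as [d HL]. exists d. intros w Hw. symmetry. exact (Py w (HL w Hw)).
    + apply (is_C_derive_continuous_Re (fun w => Ci * phi1 w) z (Ci * phi2 z)).
      apply is_C_derive_scal. auto.
Qed.

Lemma real_part_harmonic (u : C -> R) (p : nat -> C) :
  converges_on_disc p ->
  (forall z, unit_disc z -> u z = Re (power_sum p z)) ->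
  real_harmonic u.
Proof.
  intros Hp Hu.
  assert (Hp1 := converges_on_disc_derive p Hp).
  assert (Hp2 := converges_on_disc_derive _ Hp1).
  assert (D0 := fun z => power_sum_derive p z Hp).
  assert (D1 := fun z => power_sum_derive _ z Hp1).
  assert (D2 := fun z => power_sum_derive _ z Hp2).
  destruct (real_part_C1 u _ _ _ Hu D0 D1) as [C0 [X Y]].
  destruct (real_part_C1 (pd_x u) _ _ _ X D1 D2) as [CX [XX _]].
  assert (E : forall k q z, is_C_derive (power_sum q) z (power_sum (derive_coef q) z) ->
     is_C_derive (fun w => k * power_sum q w) z (k * power_sum (derive_coef q) z)).
  { intros k q z H. apply (is_C_derive_scal _ z _ k H). }
  destruct (real_part_C1 (pd_y u) _ _ _ Y
     (fun z Hz => E Ci _ z (D1 z Hz)) (fun z Hz => E Ci _ z (D2 z Hz))) as [CY [_ YY]].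
  split; [exact C0|split; [exact CX|split; [exact CY|]]].
  intros z Hz. rewrite XX, YY by exact Hz. simpl. unfold Re, Im. ring.
Qed.

(** * Level curves of plane maps *)

Open Scope R_scope.

Lemma increasing_of_positive_derivative (f df : R -> R) :
  (forall x, is_derive f x (df x)) -> (forall x, 0 < df x) ->
  forall x y, x < y -> f x < f y.
Proof.
  intros Hf Hpos x y Hxy.
  destruct (MVT_gen f x y df) as [c [_ Hc]].
  - intros. apply Hf.
  - intros z _. apply continuity_pt_filterlim. apply (ex_derive_continuous (V := R_NormedModule)).
    exists (df z). apply Hf.
  - specialize (Hpos c). nra.
Qed.

Lemma is_derive_continuity (f df : R -> R) :
  (forall x, is_derive f x (df x)) -> continuity f.
Proof.
  intros Hf z. apply continuity_pt_filterlim. apply (ex_derive_continuous (V := R_NormedModule)).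
  exists (df z). apply Hf.
Qed.

(** The image of the line under a continuous curve is connected: a separation
    by two open sets would give a continuous function with values [1] and [-1]
    only. *)
Lemma curve_connected (gx gy : R -> R) :
  continuity gx -> continuity gy ->
  connected_set (fun w => exists s, w = (gx s, gy s)).
Proof.
  intros Hx Hy U V HU HV Hcov Hdis [z1 [[s1 E1] U1]] [z2 [[s2 E2] V2]]. subst.
  set (sgn := fun s => if excluded_middle_informative (U (gx s, gy s)) then 1 else -1).
  assert (Hcont : forall (X : C -> Prop) s, open (T := C_UniformSpace) X -> X (gx s, gy s) ->
     exists d : posreal, forall y, Rabs (y - s) < d -> X (gx y, gy y)).
  { intros X s HX Xs. destruct (HX _ Xs) as [e He].
    assert (Cx := proj1 (continuity_pt_filterlim gx s) (Hx s)).
    assert (Cy := proj1 (continuity_pt_filterlim gy s) (Hy s)).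
    destruct (Cx (ball (gx s) e)) as [d1 H1]; [exists e; auto|].
    destruct (Cy (ball (gy s) e)) as [d2 H2]; [exists e; auto|].
    assert (Hm : 0 < Rmin d1 d2) by (apply Rmin_glb_lt; apply cond_pos).
    exists (mkposreal _ Hm). simpl. intros y Hyy. apply He. split.
    - apply H1. eapply Rlt_le_trans; [exact Hyy|apply Rmin_l].
    - apply H2. eapply Rlt_le_trans; [exact Hyy|apply Rmin_r]. }
  assert (Hs : continuity sgn).
  { intros s. apply continuity_pt_filterlim.
    assert (L : locally s (fun y => sgn y = sgn s)).
    { destruct (classic (U (gx s, gy s))) as [Us|Us].
      - destruct (Hcont U s HU Us) as [d Hd]. exists d. intros y Hyd.
        specialize (Hd y Hyd). unfold sgn.
        do 2 destruct excluded_middle_informative; tauto.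
      - assert (Vs : V (gx s, gy s)) by (destruct (Hcov (gx s, gy s)); [eauto|tauto|assumption]).
        destruct (Hcont V s HV Vs) as [d Hd]. exists d. intros y Hyd.
        specialize (Hd y Hyd).
        assert (NU : ~ U (gx y, gy y)) by (intro A; eapply Hdis; eauto).
        unfold sgn. do 2 destruct excluded_middle_informative; tauto. }
    intros P HP. apply locally_singleton in HP. unfold filtermap.
    revert L. apply filter_imp. intros y ->. exact HP. }
  assert (N2 : ~ U (gx s2, gy s2)) by (intro A; eapply Hdis; eauto).
  assert (F1 : sgn s1 = 1) by (unfold sgn; destruct excluded_middle_informative; tauto).
  assert (F2 : sgn s2 = -1) by (unfold sgn; destruct excluded_middle_informative; tauto).
  destruct (IVT_gen sgn s1 s2 0 Hs) as [x [_ Hx0]].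
  - rewrite F1, F2. rewrite Rmin_right, Rmax_left; lra.
  - unfold sgn in Hx0. destruct excluded_middle_informative; lra.
Qed.

(** The error in the differential of [U] is of smaller order than the increments of
    [r] and [s] together, and [Ut > 0] lets the part due to [r] be absorbed. *)
Lemma level_curve_derive (U : R -> R -> R) (r : R -> R) (s0 Ut Us : R) :
  differentiable_pt_lim U (r s0) s0 Ut Us -> 0 < Ut ->
  continuity_pt r s0 -> (forall s, U (r s) s = U (r s0) s0) ->
  derivable_pt_lim r s0 (- Us / Ut).
Proof.
  intros HU Hpos Hcont Hlev eps Heps.
  (* If the error in the differential is at most Ut/2 times the largest
     increment, the increment of r is at most M times that of s. *)
  set (M := 2 * Rabs Us / Ut + 1).
  assert (HM : 0 <= 2 * Rabs Us / Ut).
  { apply Rdiv_le_0_compat; [assert (A := Rabs_pos Us); lra|exact Hpos]. }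
  assert (He : 0 < Rmin (Ut / 2) (eps * Ut / (2 * M))).
  { apply Rmin_glb_lt; [lra|]. apply Rdiv_lt_0_compat; unfold M; nra. }
  destruct (HU (mkposreal _ He)) as [d Hd]. simpl in Hd.
  set (e := Rmin (Ut / 2) (eps * Ut / (2 * M))) in *.
  assert (E1 : e <= Ut / 2) by apply Rmin_l.
  assert (E2 : e * (2 * M) <= eps * Ut).
  { apply Rle_trans with (eps * Ut / (2 * M) * (2 * M)).
    - apply Rmult_le_compat_r; [unfold M; lra|apply Rmin_r].
    - right. field. unfold M; lra. }
  apply continuity_pt_filterlim in Hcont.
  destruct (Hcont (ball (r s0) d)) as [d2 Hd2]; [exists d; auto|].
  assert (Hm : 0 < Rmin d d2) by (apply Rmin_glb_lt; apply cond_pos).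
  exists (mkposreal _ Hm). intros k Hk0 Hk. simpl in Hk.
  set (D := r (s0 + k) - r s0).
  assert (HD : Rabs D < d).
  { apply (Hd2 (s0 + k)). change (Rabs (s0 + k - s0) < d2).
    replace (s0 + k - s0) with k by ring.
    eapply Rlt_le_trans; [exact Hk|apply Rmin_r]. }
  assert (Hk' : Rabs (s0 + k - s0) < d).
  { replace (s0 + k - s0) with k by ring. eapply Rlt_le_trans; [exact Hk|apply Rmin_l]. }
  specialize (Hd (r (s0 + k)) (s0 + k) HD Hk').
  rewrite Hlev in Hd. fold D in Hd.
  replace (U (r s0) s0 - U (r s0) s0 - (Ut * D + Us * (s0 + k - s0)))
    with (- (Ut * D + Us * k)) in Hd by ring.
  rewrite Rabs_Ropp in Hd. replace (s0 + k - s0) with k in Hd by ring.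
  assert (K0 : 0 < Rabs k) by now apply Rabs_pos_lt.
  assert (D0 := Rabs_pos D).
  assert (B : Rmax (Rabs D) (Rabs k) <= Rabs D + Rabs k) by (apply Rmax_lub; lra).
  assert (T : Ut * Rabs D <= Rabs (Ut * D + Us * k) + Rabs Us * Rabs k).
  { replace (Ut * Rabs D) with (Rabs ((Ut * D + Us * k) - Us * k)).
    - unfold Rminus. eapply Rle_trans; [apply Rabs_triang|].
      rewrite Rabs_Ropp, (Rabs_mult Us k). lra.
    - replace (Ut * D + Us * k - Us * k) with (Ut * D) by ring.
      rewrite Rabs_mult, (Rabs_pos_eq Ut); lra. }
  assert (DM : Rabs D <= M * Rabs k).
  { apply Rmult_le_reg_l with (Ut / 2); [lra|].
    replace (Ut / 2 * (M * Rabs k)) with (Rabs Us * Rabs k + Ut / 2 * Rabs k)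
      by (unfold M; field; lra).
    assert (G : Rabs (Ut * D + Us * k) <= Ut / 2 * (Rabs D + Rabs k)).
    { eapply Rle_trans; [exact Hd|]. apply Rmult_le_compat; lra || (eapply Rle_trans; [|apply Rmax_l]; lra). }
    lra. }
  assert (MM : Rmax (Rabs D) (Rabs k) <= M * Rabs k).
  { apply Rmax_lub; [exact DM|]. unfold M. nra. }
  replace (D / k - - Us / Ut) with ((Ut * D + Us * k) / (Ut * k)).
  2:{ field. split; [lra|exact Hk0]. }
  rewrite Rabs_div, (Rabs_mult Ut k), (Rabs_pos_eq Ut) by (nra || (apply Rmult_integral_contrapositive_currified; [lra|exact Hk0])).
  unfold Rdiv.
  apply Rmult_lt_reg_r with (Ut * Rabs k); [nra|].
  rewrite Rmult_assoc, Rinv_l, Rmult_1_r by nra.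
  eapply Rle_lt_trans; [exact Hd|].
  apply Rle_lt_trans with (e * (M * Rabs k)).
  - apply Rmult_le_compat_l; lra.
  - assert (0 < eps * Ut * Rabs k) by (repeat apply Rmult_lt_0_compat; lra). nra.
Qed.

(** A map [(U, W)] of the plane with positive Jacobian, [U] increasing in its first
    variable, and such that the values of [U] on the line of parameter [s] do not
    depend on [s]; the last two hypotheses express this. *)
Section LevelCurves.

Variables U W Ut Us Wt Ws : R -> R -> R.
Hypothesis HU : forall t s, differentiable_pt_lim U t s (Ut t s) (Us t s).
Hypothesis HW : forall t s, differentiable_pt_lim W t s (Wt t s) (Ws t s).
Hypothesis Upos : forall t s, 0 < Ut t s.
Hypothesis Jpos : forall t s, 0 < Ut t s * Ws t s - Us t s * Wt t s.
Hypothesis reach_up : forall t1 s1 s, exists t, U t1 s1 < U t s.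
Hypothesis reach_down : forall t1 s1 s, exists t, U t s < U t1 s1.

Lemma level_partials t s :
  is_derive (fun x => U x s) t (Ut t s) /\ is_derive (fun y => U t y) s (Us t s).
Proof. exact (differentiable_pt_lim_partials _ _ _ _ _ (HU t s)). Qed.

Lemma U_increasing s t t' : t < t' -> U t s < U t' s.
Proof.
  apply (increasing_of_positive_derivative (fun x => U x s) (fun x => Ut x s)).
  - intro x. apply level_partials.
  - intro x. apply Upos.
Qed.

Lemma level_attained t1 s1 s : exists t, U t s = U t1 s1.
Proof.
  destruct (reach_up t1 s1 s) as [b Hb]. destruct (reach_down t1 s1 s) as [a Ha].
  destruct (IVT_gen (fun x => U x s) a b (U t1 s1)) as [t [_ Ht]].
  - apply (is_derive_continuity _ (fun x => Ut x s)). intro x. apply level_partials.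
  - rewrite Rmin_left, Rmax_right; lra.
  - now exists t.
Qed.

(** The equation [U t s = U t0 s0] has one solution [t] for every [s]; it depends
    continuously on [s] by monotonicity, then differentiably, and the derivative of
    [W] along the curve is the Jacobian divided by [Ut]. *)
Lemma level_curve t0 s0 : exists r : R -> R,
  (forall s, U (r s) s = U t0 s0) /\
  (exists dW, (forall s, is_derive (fun y => W (r y) y) s (dW s)) /\ forall s, 0 < dW s).
Proof.
  set (r := fun s => proj1_sig (constructive_indefinite_description _ (level_attained t0 s0 s))).
  assert (Hr : forall s, U (r s) s = U t0 s0).
  { intro s. unfold r. destruct constructive_indefinite_description; assumption. }
  exists r. split; [exact Hr|].
  assert (Hc : forall s, continuity_pt r s).
  { intro s. apply continuity_pt_filterlim. intros P [e HP].
    assert (He := cond_pos e).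
    assert (L1 : U (r s - e / 2) s < U t0 s0) by (rewrite <- (Hr s); apply U_increasing; lra).
    assert (L2 : U t0 s0 < U (r s + e / 2) s) by (rewrite <- (Hr s); apply U_increasing; lra).
    assert (K : forall t, exists d : posreal, forall y, Rabs (y - s) < d ->
       Rabs (U t y - U t s) < Rmin (U t0 s0 - U (r s - e / 2) s) (U (r s + e / 2) s - U t0 s0)).
    { intro t.
      assert (Hm : 0 < Rmin (U t0 s0 - U (r s - e / 2) s) (U (r s + e / 2) s - U t0 s0))
        by (apply Rmin_glb_lt; lra).
      assert (Cu : continuity_pt (fun y => U t y) s).
      { apply (is_derive_continuity _ (fun y => Us t y)). intro x. apply level_partials. }
      apply continuity_pt_filterlim in Cu.
      destruct (Cu (ball (U t s) (mkposreal _ Hm))) as [d Hd]; [eexists; intros y Hy; exact Hy|].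
      exists d. intros y Hy. apply (Hd y Hy). }
    destruct (K (r s - e / 2)) as [d1 H1]. destruct (K (r s + e / 2)) as [d2 H2].
    assert (Hm : 0 < Rmin d1 d2) by (apply Rmin_glb_lt; apply cond_pos).
    exists (mkposreal _ Hm). intros y Hy. change (Rabs (y - s) < Rmin d1 d2) in Hy.
    assert (M1 := Rmin_l d1 d2). assert (M2 := Rmin_r d1 d2).
    specialize (H1 y ltac:(lra)). specialize (H2 y ltac:(lra)).
    assert (N1 := Rmin_l (U t0 s0 - U (r s - e / 2) s) (U (r s + e / 2) s - U t0 s0)).
    assert (N2 := Rmin_r (U t0 s0 - U (r s - e / 2) s) (U (r s + e / 2) s - U t0 s0)).
    apply Rabs_def2 in H1. apply Rabs_def2 in H2.
    apply HP. change (Rabs (r y - r s) < e).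
    assert (Q1 : r s - e / 2 < r y).
    { apply Rnot_le_lt. intro A. destruct A as [A|A].
      - apply (U_increasing y) in A. rewrite Hr in A. lra.
      - assert (Z := Hr y). rewrite A in Z. lra. }
    assert (Q2 : r y < r s + e / 2).
    { apply Rnot_le_lt. intro A. destruct A as [A|A].
      - apply (U_increasing y) in A. rewrite Hr in A. lra.
      - assert (Z := Hr y). rewrite <- A in Z. lra. }
    apply Rabs_def1; lra. }
  assert (Hd : forall s, derivable_pt_lim r s (- Us (r s) s / Ut (r s) s)).
  { intro s. apply (level_curve_derive U); auto. intro y. now rewrite !Hr. }
  exists (fun s => Wt (r s) s * (- Us (r s) s / Ut (r s) s) + Ws (r s) s * 1).
  split.
  - intro s. apply is_derive_Reals.
    apply (derivable_pt_lim_comp_2d W r (fun x => x)); [apply HW|apply Hd|apply derivable_pt_lim_id].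
  - intro s. assert (P := Upos (r s) s). assert (J := Jpos (r s) s).
    replace (Wt (r s) s * (- Us (r s) s / Ut (r s) s) + Ws (r s) s * 1)
      with ((Ut (r s) s * Ws (r s) s - Us (r s) s * Wt (r s) s) / Ut (r s) s) by (field; lra).
    apply Rdiv_lt_0_compat; assumption.
Qed.

Lemma level_unique s t t' : U t s = U t' s -> t = t'.
Proof.
  intro E. destruct (Rtotal_order t t') as [A|[A|A]]; [|exact A|];
    apply (U_increasing s) in A; lra.
Qed.

Lemma level_injective t1 s1 t2 s2 :
  U t1 s1 = U t2 s2 -> W t1 s1 = W t2 s2 -> t1 = t2 /\ s1 = s2.
Proof.
  intros EU EW. destruct (level_curve t1 s1) as [r [Hr [dW [HdW HdWp]]]].
  assert (I := increasing_of_positive_derivative _ dW HdW HdWp).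
  assert (R1 : r s1 = t1) by (apply (level_unique s1); apply Hr).
  assert (R2 : r s2 = t2) by (apply (level_unique s2); rewrite Hr; exact EU).
  assert (Es : s1 = s2).
  { destruct (Rtotal_order s1 s2) as [A|[A|A]]; [|exact A|];
      apply I in A; rewrite R1, R2 in A; lra. }
  split; [|exact Es]. rewrite <- R1, <- R2. now rewrite Es.
Qed.

Lemma level_connected x :
  connected_set (fun w => Re w = x /\ exists t s, w = (U t s, W t s)).
Proof.
  intros A B HA HB Hcov Hdis [z1 [[E1 [t1 [s1 F1]]] A1]] [z2 [[E2 [t2 [s2 F2]]] B2]].
  destruct (level_curve t1 s1) as [r [Hr [dW [HdW _]]]].
  assert (X : U t1 s1 = x) by (now rewrite F1 in E1).
  assert (G : forall w, (exists s, w = (x, W (r s) s)) ->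
     Re w = x /\ exists t s, w = (U t s, W t s)).
  { intros w [s ->]. split; [reflexivity|]. exists (r s), s. now rewrite Hr, X. }
  assert (G' : forall t s, U t s = x -> exists s', (U t s, W t s) = (x, W (r s') s')).
  { intros t s E. exists s.
    replace (r s) with t; [now rewrite E|]. apply (level_unique s). now rewrite Hr, E, X. }
  apply (curve_connected (fun _ => x) (fun s => W (r s) s)) with (U := A) (V := B); auto.
  - apply continuity_const. intros ? ?; reflexivity.
  - now apply (is_derive_continuity _ dW).
  - intros z Hz. apply Hdis. now apply G.
  - exists z1. split; [|exact A1]. rewrite F1. now apply G'.
  - exists z2. split; [|exact B2]. rewrite F2. apply G'. now rewrite F2 in E2.
Qed.

End LevelCurves.

Open Scope C_scope.

(** * Coordinates on the disc adapted to [1 - z^2] *)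

(** The half-plane is swept by the rays of slope [s], run through by [exp t]; the
    Cayley transform turns them into circular arcs of the disc from -1 to 1. *)
Definition ray_point (t s : R) : C := (exp t, (exp t * s)%R).

Definition cayley (w : C) : C := (w - 1) / (w + 1).

Definition zeta (t s : R) : C := cayley (ray_point t s).

Lemma Cmod_ge_Re (z : C) : (Re z <= Cmod z)%R.
Proof. eapply Rle_trans; [apply Rle_abs|apply re_le_Cmod]. Qed.

Lemma cayley_disc (w : C) : (0 < Re w)%R -> unit_disc (cayley w).
Proof.
  intro H. unfold unit_disc, cayley.
  assert (N : w + 1 <> 0) by (apply C_neq_0_Re; simpl; unfold Re in H; lra).
  rewrite Cmod_div by exact N.
  assert (P : (0 < Cmod (w + 1))%R) by now apply Cmod_gt_0.
  apply Rmult_lt_reg_r with (Cmod (w + 1)); [exact P|].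
  unfold Rdiv. rewrite Rmult_assoc, Rinv_l, Rmult_1_r, Rmult_1_l by lra.
  assert (A := Cmod2_alt (w - 1)). assert (B := Cmod2_alt (w + 1)).
  assert (Q := Cmod_ge_0 (w - 1)).
  rewrite Re_minus, Im_minus in A. rewrite re_plus, im_plus in B. simpl in A, B, H.
  apply Rnot_le_lt. intro C. nra.
Qed.

Lemma ray_point_Re t s : (0 < Re (ray_point t s))%R.
Proof. apply exp_pos. Qed.

Lemma zeta_disc t s : unit_disc (zeta t s).
Proof. apply cayley_disc, ray_point_Re. Qed.

Lemma disc_1_minus_neq_0 (z : C) : unit_disc z -> 1 - z <> 0.
Proof.
  intros H. apply C_neq_0_Re. rewrite Re_minus. simpl.
  assert (A := Cmod_ge_Re z). unfold unit_disc, Re in *. lra.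
Qed.

Lemma zeta_surj (z : C) : unit_disc z -> exists t s, z = zeta t s.
Proof.
  intro Hz. assert (N := disc_1_minus_neq_0 z Hz).
  set (w := (1 + z) / (1 - z)).
  assert (E : cayley w = z).
  { unfold cayley, w. field. split; [exact N|].
    replace (1 + z + (1 - z)) with (RtoC 2) by ring. intro A. apply RtoC_inj in A. lra. }
  assert (P : (0 < Re w)%R).
  { assert (A := Cmod2_alt z). unfold unit_disc in Hz. assert (B := Cmod_ge_0 z).
    assert (D := Cmod2_alt (1 - z)). rewrite Re_minus, Im_minus in D. simpl in D.
    assert (D0 : (0 < Cmod (1 - z))%R) by now apply Cmod_gt_0.
    assert (E1 : Re w = ((1 - Cmod z ^ 2) / Cmod (1 - z) ^ 2)%R).
    { rewrite A. unfold w. rewrite Cmod2_alt, Re_minus, Im_minus. simpl. unfold Re, Im in *.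
      field. nra. }
    rewrite E1. apply Rdiv_lt_0_compat; nra. }
  exists (ln (Re w)), (Im w / Re w)%R. unfold zeta, ray_point.
  rewrite exp_ln by exact P.
  replace (Re w * (Im w / Re w))%R with (Im w) by (field; lra).
  rewrite <- E at 1. now destruct w.
Qed.

Lemma cayley_derive (w : C) : (0 < Re w)%R ->
  is_C_derive cayley w (2 / (w + 1) ^ 2).
Proof.
  intro H. apply is_C_derive_quadratic with 2%R (Re w); [exact H|].
  intros v Hv.
  assert (Hv' : (0 < Re v)%R).
  { assert (A := re_le_Cmod (v - w)). rewrite Re_minus in A.
    assert (B := Rle_trans _ _ _ (Rle_abs _) (Req_le _ _ (Rabs_Ropp (Re v - Re w)))). lra. }
  assert (G : forall u, (0 < Re u)%R -> u + 1 <> 0 /\ (1 <= Cmod (u + 1))%R).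
  { intros u Hu. split; [apply C_neq_0_Re; simpl; unfold Re in Hu; lra|].
    assert (A := Cmod_ge_Re (u + 1)). simpl in A. unfold Re in *. simpl in A. lra. }
  destruct (G w H) as [N1 M1]. destruct (G v Hv') as [N2 M2].
  replace (cayley v - cayley w - 2 / (w + 1) ^ 2 * (v - w))
    with (- (2) * (v - w) ^ 2 / ((v + 1) * (w + 1) ^ 2)) by (unfold cayley; field; auto).
  assert (N3 : (v + 1) * (w + 1) ^ 2 <> 0) by (apply Cmult_neq_0; [|apply Cpow_nz]; auto).
  rewrite Cmod_div, !Cmod_mult, !Cmod_pow, Cmod_opp, Cmod_R, Rabs_pos_eq by (auto; lra).
  assert (Q := pow2_ge_0 (Cmod (v - w))).
  assert (K : (1 <= Cmod (v + 1) * Cmod (w + 1) ^ 2)%R).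
  { assert (1 <= Cmod (w + 1) ^ 2)%R by (simpl; nra). nra. }
  apply Rmult_le_reg_r with (Cmod (v + 1) * Cmod (w + 1) ^ 2)%R; [lra|].
  unfold Rdiv. rewrite Rmult_assoc, Rinv_l, Rmult_1_r by lra. nra.
Qed.

(** The partial derivatives of [zeta]; both are multiples of [1 - zeta^2], which is
    why this factor appears in the class of functions. *)
Definition zeta_t (t s : R) : C := (1 - zeta t s ^ 2) / 2.
Definition zeta_s (t s : R) : C := (1 - zeta t s ^ 2) * (Ci / (2 * (1, s))).

Lemma ray_point_factor t s : ray_point t s = exp t * (1, s).
Proof. unfold ray_point, RtoC, Cmult. simpl. f_equal; ring. Qed.

Lemma differentiable_pt_lim_Rmult (x y : R) : differentiable_pt_lim Rmult x y y x.
Proof.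
  intro eps. exists eps. intros u v Hu Hv.
  replace (u * v - x * y - (y * (u - x) + x * (v - y)))%R with ((u - x) * (v - y))%R by ring.
  rewrite Rabs_mult. apply Rmult_le_compat; try apply Rabs_pos; [lra|apply Rmax_r].
Qed.

Lemma zeta_differentiable t s :
  differentiable_pt_lim (fun t s => Re (zeta t s)) t s (Re (zeta_t t s)) (Re (zeta_s t s)) /\
  differentiable_pt_lim (fun t s => Im (zeta t s)) t s (Im (zeta_t t s)) (Im (zeta_s t s)).
Proof.
  set (w := ray_point t s). set (l := 2 / (w + 1) ^ 2).
  assert (P := ray_point_Re t s). fold w in P.
  assert (D := cayley_derive w P). fold l in D.
  assert (N : w + 1 <> 0) by (apply C_neq_0_Re; rewrite re_plus, re_RtoC; lra).
  assert (Ns : ((1%R, s) : C) <> RtoC 0) by (apply C_neq_0_Re; simpl; lra).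
  assert (N2 : RtoC 2 <> 0) by (apply C_neq_0_Re; simpl; lra).
  assert (Ne : RtoC (exp t) <> 0) by (apply C_neq_0_Re; simpl; apply exp_pos).
  assert (Et : zeta_t t s = l * w).
  { unfold zeta_t, zeta, cayley, l. fold w. field. auto. }
  assert (Es : zeta_s t s = l * (Ci * exp t)).
  { unfold zeta_s, zeta, cayley, l. fold w. unfold w in *. rewrite ray_point_factor in *. field. auto. }
  rewrite Et, Es.
  assert (F2 : differentiable_pt_lim (fun t s => exp t) t s (exp t) 0).
  { apply differentiable_pt_lim_proj1_0. apply derivable_pt_lim_exp. }
  assert (F3 : differentiable_pt_lim (fun t s => exp t * s)%R t s (exp t * s) (exp t)).
  { replace (exp t * s)%R with (s * exp t + exp t * 0)%R by ring.
    replace (exp t) with (s * 0 + exp t * 1)%R at 3 by ring.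
    apply (differentiable_pt_lim_comp Rmult (fun t s => exp t) (fun t s => s));
      [apply differentiable_pt_lim_Rmult|exact F2|].
    intros eps. exists eps. intros u v _ _.
    replace (v - s - (0 * (u - t) + 1 * (v - s)))%R with 0%R by ring.
    rewrite Rabs_R0. apply Rmult_le_pos; [apply Rlt_le, cond_pos|].
    eapply Rle_trans; [apply Rabs_pos|apply Rmax_l]. }
  apply is_C_derive_differentiable in D. destruct D as [DR DI].
  split.
  - replace (Re (l * w)) with (Re l * exp t + - Im l * (exp t * s))%R by (unfold w, ray_point; simpl; unfold Re, Im; ring).
    replace (Re (l * (Ci * exp t))) with (Re l * 0 + - Im l * exp t)%R by (simpl; unfold Re, Im; ring).
    apply (differentiable_pt_lim_comp (fun u v => Re (cayley (u, v))) (fun t s => exp t) (fun t s => exp t * s)%R); assumption.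
  - replace (Im (l * w)) with (Im l * exp t + Re l * (exp t * s))%R by (unfold w, ray_point; simpl; unfold Re, Im; ring).
    replace (Im (l * (Ci * exp t))) with (Im l * 0 + Re l * exp t)%R by (simpl; unfold Re, Im; ring).
    apply (differentiable_pt_lim_comp (fun u v => Im (cayley (u, v))) (fun t s => exp t) (fun t s => exp t * s)%R); assumption.
Qed.

Lemma analytic_zeta_differentiable (phi : C -> C) (l : C) t s :
  is_C_derive phi (zeta t s) l ->
  differentiable_pt_lim (fun t s => Re (phi (zeta t s))) t s
    (Re (l * zeta_t t s)) (Re (l * zeta_s t s)) /\
  differentiable_pt_lim (fun t s => Im (phi (zeta t s))) t s
    (Im (l * zeta_t t s)) (Im (l * zeta_s t s)).
Proof.
  intro D. destruct (zeta_differentiable t s) as [FR FI].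
  assert (D' : is_C_derive phi (Re (zeta t s), Im (zeta t s)) l) by (now destruct (zeta t s)).
  apply is_C_derive_differentiable in D'. destruct D' as [DR DI].
  assert (E : forall t s, (Re (zeta t s), Im (zeta t s)) = zeta t s) by (intros; now destruct (zeta t0 s0)).
  split.
  - replace (Re (l * zeta_t t s)) with (Re l * Re (zeta_t t s) + - Im l * Im (zeta_t t s))%R by (rewrite re_mult; ring).
    replace (Re (l * zeta_s t s)) with (Re l * Re (zeta_s t s) + - Im l * Im (zeta_s t s))%R by (rewrite re_mult; ring).
    eapply differentiable_pt_lim_ext;
      [|apply (differentiable_pt_lim_comp (fun u v => Re (phi (u, v))) (fun t s => Re (zeta t s)) (fun t s => Im (zeta t s))); eassumption].
    exists (mkposreal 1 Rlt_0_1). intros u v _ _. now rewrite E.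
  - replace (Im (l * zeta_t t s)) with (Im l * Re (zeta_t t s) + Re l * Im (zeta_t t s))%R by (rewrite im_mult; ring).
    replace (Im (l * zeta_s t s)) with (Im l * Re (zeta_s t s) + Re l * Im (zeta_s t s))%R by (rewrite im_mult; ring).
    eapply differentiable_pt_lim_ext;
      [|apply (differentiable_pt_lim_comp (fun u v => Im (phi (u, v))) (fun t s => Re (zeta t s)) (fun t s => Im (zeta t s))); eassumption].
    exists (mkposreal 1 Rlt_0_1). intros u v _ _. now rewrite E.
Qed.

(** * Behaviour along the arcs ending at 1 *)

Definition tends_to (P : C -> C) (z0 k : C) : Prop :=
  forall eps : R, (0 < eps)%R -> exists delta : R, (0 < delta)%R /\
    forall z, unit_disc z -> (Cmod (z - z0) < delta)%R -> (Cmod (P z - k) < eps)%R.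

Lemma zeta_near_1 (delta : R) : (0 < delta)%R ->
  exists T : R, forall t s, (T <= t)%R -> (Cmod (zeta t s - 1) < delta)%R.
Proof.
  intro Hd. exists (2 / delta)%R. intros t s Ht.
  assert (P := ray_point_Re t s).
  assert (N : ray_point t s + 1 <> 0) by (apply C_neq_0_Re; rewrite re_plus, re_RtoC; lra).
  replace (zeta t s - 1) with (- (2) / (ray_point t s + 1)) by (unfold zeta, cayley; field; exact N).
  rewrite Cmod_div, Cmod_opp, Cmod_R, Rabs_pos_eq by (auto; lra).
  assert (M := Cmod_ge_Re (ray_point t s + 1)). rewrite re_plus, re_RtoC in M. simpl in M.
  assert (D0 : (0 < 2 / delta)%R) by (apply Rdiv_lt_0_compat; lra).
  assert (X := exp_ineq1 t ltac:(lra)).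
  assert (Q : (2 / delta < Cmod (ray_point t s + 1))%R) by lra.
  apply Rmult_lt_reg_r with (Cmod (ray_point t s + 1)); [lra|].
  unfold Rdiv. rewrite Rmult_assoc, Rinv_l, Rmult_1_r by lra.
  replace 2%R with (delta * (2 / delta))%R by (field; lra).
  apply Rmult_lt_compat_l; assumption.
Qed.

Section AnalyticRays.

Variables (phi phi1 : C -> C) (k : C).
Hypothesis Hphi : forall z, unit_disc z -> is_C_derive phi z (phi1 z).
Hypothesis Hpos : forall z, unit_disc z -> (0 < Re ((1 - z ^ 2) * phi1 z))%R.
Hypothesis Hlim : tends_to (fun z => (1 - z ^ 2) * phi1 z) 1 k.
Hypothesis Hk : (0 < Re k)%R \/ k = 0.

Lemma ray_derive_t t s :
  is_derive (fun t => Re (phi (zeta t s))) t (Re ((1 - zeta t s ^ 2) * phi1 (zeta t s)) / 2)%R.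
Proof.
  destruct (analytic_zeta_differentiable phi (phi1 (zeta t s)) t s) as [D _].
  { apply Hphi, zeta_disc. }
  apply differentiable_pt_lim_partials in D. destruct D as [D _].
  replace (Re ((1 - zeta t s ^ 2) * phi1 (zeta t s)) / 2)%R with (Re (phi1 (zeta t s) * zeta_t t s)).
  - exact D.
  - unfold zeta_t. replace (phi1 (zeta t s) * ((1 - zeta t s ^ 2) / 2))
      with (RtoC (/ 2) * ((1 - zeta t s ^ 2) * phi1 (zeta t s))).
    + rewrite re_scal_l. field.
    + rewrite RtoC_inv by lra. field.
Qed.

Lemma ray_derive_s t s : exists d,
  is_derive (fun s => Re (phi (zeta t s))) s d /\
  (Rabs d <= Cmod ((1 - zeta t s ^ 2) * phi1 (zeta t s)))%R.
Proof.
  destruct (analytic_zeta_differentiable phi (phi1 (zeta t s)) t s) as [D _].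
  { apply Hphi, zeta_disc. }
  apply differentiable_pt_lim_partials in D. destruct D as [_ D].
  eexists. split; [exact D|].
  eapply Rle_trans; [apply re_le_Cmod|]. unfold zeta_s.
  assert (N : 2 * ((1%R, s) : C) <> 0).
  { apply Cmult_neq_0; apply C_neq_0_Re; simpl; lra. }
  rewrite !Cmod_mult, Cmod_div, Cmod_Ci, Cmod_mult, Cmod_R, Rabs_pos_eq by (auto; lra).
  assert (M : (1 <= Cmod ((1%R, s) : C))%R) by exact (Cmod_ge_Re ((1%R, s) : C)).
  assert (X : (1 / (2 * Cmod ((1%R, s) : C)) <= 1)%R).
  { apply Rmult_le_reg_r with (2 * Cmod ((1%R, s) : C))%R; [lra|].
    unfold Rdiv. rewrite Rmult_assoc, Rinv_l by lra. lra. }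
  assert (A := Cmod_ge_0 (phi1 (zeta t s))). assert (B := Cmod_ge_0 (1 - zeta t s ^ 2)).
  rewrite <- Rmult_assoc, (Rmult_comm (Cmod (phi1 (zeta t s)))).
  rewrite <- (Rmult_1_r (Cmod (1 - zeta t s ^ 2) * Cmod (phi1 (zeta t s)))) at 2.
  apply Rmult_le_compat_l; [apply Rmult_le_pos; assumption|exact X].
Qed.

Lemma ray_increasing s t t' : (t < t')%R -> (Re (phi (zeta t s)) < Re (phi (zeta t' s)))%R.
Proof.
  apply (increasing_of_positive_derivative (fun t => Re (phi (zeta t s))) _ (fun t => ray_derive_t t s)).
  intro x. assert (A := Hpos _ (zeta_disc x s)). lra.
Qed.

(** If [k] has positive real part the function grows linearly along the ray; if
    [k = 0] its values on two rays differ by a quantity tending to 0, and the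
    strict growth along the first ray absorbs the difference. *)
Lemma ray_reach t1 s1 s : exists t, (Re (phi (zeta t1 s1)) < Re (phi (zeta t s)))%R.
Proof.
  destruct Hk as [Hk1|Hk0].
  - destruct (Hlim (Re k / 2)%R ltac:(lra)) as [d [Hd HH]].
    destruct (zeta_near_1 d Hd) as [T HT].
    set (u := fun t => Re (phi (zeta t s))).
    (* From T on the derivative is at least Re k / 4. *)
    set (t := (T + (Rabs (Re (phi (zeta t1 s1)) - u T) + 1) * (4 / Re k))%R).
    assert (P4 : (0 < 4 / Re k)%R) by (apply Rdiv_lt_0_compat; lra).
    assert (PA := Rabs_pos (Re (phi (zeta t1 s1)) - u T)).
    exists t. assert (Ht : (T < t)%R) by (unfold t; nra).
    destruct (MVT_gen u T t (fun t => Re ((1 - zeta t s ^ 2) * phi1 (zeta t s)) / 2)%R) as [c [Hc Ec]].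
    { intros x _. apply ray_derive_t. }
    { intros x _. apply (is_derive_continuity _ _ (fun t => ray_derive_t t s)). }
    rewrite Rmin_left in Hc by lra.
    specialize (HH _ (zeta_disc c s) (HT c s (proj1 Hc))).
    assert (B := re_le_Cmod ((1 - zeta c s ^ 2) * phi1 (zeta c s) - k)).
    rewrite Re_minus in B.
    set (D := Re ((1 - zeta c s ^ 2) * phi1 (zeta c s))) in *.
    assert (G : (Re k / 2 < D)%R).
    { assert (Z := Rle_abs (- (D - Re k))). rewrite Rabs_Ropp in Z. lra. }
    fold (u t).
    assert (E : (Re k / 4 * (t - T) = Rabs (Re (phi (zeta t1 s1)) - u T) + 1)%R).
    { unfold t. field. lra. }
    assert (F := Rle_abs (Re (phi (zeta t1 s1)) - u T)). simpl in Ec. nra.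
  - assert (I := ray_increasing s1 t1 (t1 + 1)%R ltac:(lra)).
    (* The growth e on the first ray from t1 to t1 + 1 is the margin to be kept. *)
    set (e := (Re (phi (zeta (t1 + 1) s1)) - Re (phi (zeta t1 s1)))%R).
    assert (Q : (0 < Rabs (s - s1) + 1)%R) by (assert (A := Rabs_pos (s - s1)); lra).
    assert (He : (0 < e / (Rabs (s - s1) + 1))%R) by (apply Rdiv_lt_0_compat; unfold e; lra).
    destruct (Hlim _ He) as [d [Hd HH]].
    destruct (zeta_near_1 d Hd) as [T HT].
    set (t := Rmax T (t1 + 1)). exists t.
    assert (Ht1 : (T <= t)%R) by apply Rmax_l. assert (Ht2 : (t1 + 1 <= t)%R) by apply Rmax_r.
    assert (I' : (Re (phi (zeta (t1 + 1) s1)) <= Re (phi (zeta t s1)))%R).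
    { destruct Ht2 as [L|L]; [left; now apply ray_increasing|rewrite <- L; lra]. }
    assert (DS := ray_derive_s t).
    set (df := fun s => proj1_sig (constructive_indefinite_description _ (DS s))).
    assert (Hdf : forall s, is_derive (fun s => Re (phi (zeta t s))) s (df s) /\
       (Rabs (df s) <= Cmod ((1 - zeta t s ^ 2) * phi1 (zeta t s)))%R).
    { intro y. unfold df. destruct constructive_indefinite_description; assumption. }
    destruct (MVT_gen (fun s => Re (phi (zeta t s))) s1 s df) as [c [_ Ec]].
    { intros x _. apply Hdf. }
    { intros x _. apply (is_derive_continuity _ _ (fun s => proj1 (Hdf s))). }
    specialize (HH _ (zeta_disc t c) (HT t c Ht1)).
    rewrite Hk0 in HH.
    replace ((1 - zeta t c ^ 2) * phi1 (zeta t c) - 0)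
      with ((1 - zeta t c ^ 2) * phi1 (zeta t c)) in HH by ring.
    assert (B := proj2 (Hdf c)).
    assert (Y : (Rabs (df c * (s - s1)) < e)%R).
    { rewrite Rabs_mult. assert (A := Rabs_pos (s - s1)). assert (A' := Rabs_pos (df c)).
      assert (E : (e = e / (Rabs (s - s1) + 1) * (Rabs (s - s1) + 1))%R) by (field; lra).
      nra. }
    assert (Z := Rle_abs (- (df c * (s - s1)))). rewrite Rabs_Ropp in Z.
    unfold e in *. simpl in Ec. lra.
Qed.

End AnalyticRays.

(** In the half-plane [z -> - z] is inversion, so it exchanges the two ends of the
    rays and carries what holds near 1 to -1. *)
Lemma zeta_opp u v : - zeta u v = zeta (- u - ln (1 + v ^ 2))%R (- v)%R.
Proof.
  assert (Q := pow2_ge_0 v).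
  assert (E : exp (- u - ln (1 + v ^ 2)) = (/ (exp u * (1 + v ^ 2)))%R).
  { unfold Rminus. rewrite exp_plus, !exp_Ropp, exp_ln by lra. field.
    split; [lra|]. apply Rgt_not_eq, exp_pos. }
  assert (W : ray_point (- u - ln (1 + v ^ 2)) (- v) = / ray_point u v).
  { rewrite !ray_point_factor, E. unfold Cinv, Cmult, RtoC; simpl.
    assert (X := exp_pos u). f_equal; field; nra. }
  unfold zeta, cayley. rewrite W.
  assert (P := ray_point_Re u v).
  assert (N1 : ray_point u v <> 0) by now apply C_neq_0_Re.
  assert (N2 : ray_point u v + 1 <> 0) by (apply C_neq_0_Re; rewrite re_plus, re_RtoC; lra).
  field. repeat split; auto. rewrite Cplus_comm. exact N2.
Qed.

(** * Convexity in the vertical direction *)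

Lemma is_C_derive_reflect (phi : C -> C) (z l : C) :
  is_C_derive phi (- z) l -> is_C_derive (fun w => - phi (- w)) z l.
Proof.
  rewrite !is_C_derive_eps. intros H eps He. destruct (H eps He) as [d [Hd HH]].
  exists d. split; [exact Hd|]. intros w Hw. specialize (HH (- w)).
  replace (- w - - z) with (- (w - z)) in HH by ring. rewrite Cmod_opp in HH.
  replace (- phi (- w) - - phi (- z) - l * (w - z))
    with (- (phi (- w) - phi (- z) - l * - (w - z))) by ring.
  rewrite Cmod_opp. auto.
Qed.

Lemma unit_disc_opp z : unit_disc z -> unit_disc (- z).
Proof. unfold unit_disc. now rewrite Cmod_opp. Qed.

Lemma connected_set_iff (A B : C -> Prop) :
  (forall w, A w <-> B w) -> connected_set A -> connected_set B.
Proof.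
  intros E H U V HU HV H1 H2 [z [Bz Uz]] [y [By Vy]].
  apply (H U V HU HV).
  - intros w Hw. apply H1, E, Hw.
  - intros w Hw. apply H2, E, Hw.
  - exists z. split; [apply E|]; assumption.
  - exists y. split; [apply E|]; assumption.
Qed.

Lemma Cmod_lt_sqr (a b : C) : (Cmod b < Cmod a)%R ->
  (0 < (Re a ^ 2 + Im a ^ 2) - (Re b ^ 2 + Im b ^ 2))%R.
Proof.
  intro H. rewrite <- !Cmod2_alt. assert (A := Cmod_ge_0 b). nra.
Qed.

(** [Re f] and [Im f] are the real part of [h + g] and the imaginary part of
    [h - g], so in the coordinates [(t, s)] the derivatives of [f] are those of
    analytic functions.  The limits [k] and [k'] replace a discussion of positive
    harmonic functions: when one of them vanishes, [Re f] has the same limit on all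
    arcs, when its real part is positive the limit is infinite. *)
Lemma convex_vertical_of_boundary_limits (f h g h1 g1 : C -> C) (k k' : C) :
  harmonic f ->
  (forall z, unit_disc z -> f z = h z + Cconj (g z)) ->
  (forall z, unit_disc z -> is_C_derive h z (h1 z)) ->
  (forall z, unit_disc z -> is_C_derive g z (g1 z)) ->
  (forall z, unit_disc z -> Cmod ((1 - z ^ 2) * g1 z) < Re ((1 - z ^ 2) * h1 z))%R ->
  tends_to (fun z => (1 - z ^ 2) * (h1 z + g1 z)) 1 k -> (0 < Re k)%R \/ k = 0 ->
  tends_to (fun z => (1 - z ^ 2) * (h1 z + g1 z)) (-(1)) k' -> (0 < Re k')%R \/ k' = 0 ->
  convex_vertical f.
Proof.
  intros Hf Ef Dh Dg Hlt L1 K1 L2 K2. split; [exact Hf|].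
  set (phi := fun z => h z + g z).
  set (psi := fun z => h z + (-(1)) * g z).
  set (phi1 := fun z => h1 z + g1 z). set (psi1 := fun z => h1 z + (-(1)) * g1 z).
  assert (Dphi : forall z, unit_disc z -> is_C_derive phi z (phi1 z)).
  { intros z Hz. apply is_C_derive_plus; auto. }
  assert (Dpsi : forall z, unit_disc z -> is_C_derive psi z (psi1 z)).
  { intros z Hz. apply is_C_derive_plus; [|apply is_C_derive_scal]; auto. }
  assert (Ppos : forall z, unit_disc z -> (0 < Re ((1 - z ^ 2) * phi1 z))%R).
  { intros z Hz. unfold phi1.
    replace ((1 - z ^ 2) * (h1 z + g1 z)) with ((1 - z ^ 2) * h1 z + (1 - z ^ 2) * g1 z) by ring.
    rewrite re_plus. assert (A := Hlt z Hz). assert (B := re_le_Cmod ((1 - z ^ 2) * g1 z)).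
    assert (Z := Rle_abs (- Re ((1 - z ^ 2) * g1 z))). rewrite Rabs_Ropp in Z. lra. }
  set (U := fun t s => Re (phi (zeta t s))). set (W := fun t s => Im (psi (zeta t s))).
  set (Ut := fun t s => Re (phi1 (zeta t s) * zeta_t t s)).
  set (Us := fun t s => Re (phi1 (zeta t s) * zeta_s t s)).
  set (Wt := fun t s => Im (psi1 (zeta t s) * zeta_t t s)).
  set (Ws := fun t s => Im (psi1 (zeta t s) * zeta_s t s)).
  assert (HU : forall t s, differentiable_pt_lim U t s (Ut t s) (Us t s)).
  { intros t s. apply analytic_zeta_differentiable. apply Dphi, zeta_disc. }
  assert (HW : forall t s, differentiable_pt_lim W t s (Wt t s) (Ws t s)).
  { intros t s. apply analytic_zeta_differentiable. apply Dpsi, zeta_disc. }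
  assert (Upos : forall t s, (0 < Ut t s)%R).
  { intros t s. assert (A := Ppos _ (zeta_disc t s)). unfold Ut, zeta_t.
    replace (phi1 (zeta t s) * ((1 - zeta t s ^ 2) / 2))
      with (RtoC (/ 2) * ((1 - zeta t s ^ 2) * phi1 (zeta t s))).
    - rewrite re_scal_l. lra.
    - rewrite RtoC_inv by lra. field. }
  (* With a = (1 - z^2) h' and b = (1 - z^2) g' the Jacobian is |a|^2 - |b|^2 up to
     the positive factor q / 2, where q is the imaginary part of i / (2 (1 + i s)). *)
  assert (Jpos : forall t s, (0 < Ut t s * Ws t s - Us t s * Wt t s)%R).
  { intros t s. unfold Ut, Us, Wt, Ws, phi1, psi1, zeta_t, zeta_s.
    set (z := zeta t s). assert (Hz : unit_disc z) by apply zeta_disc.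
    assert (A := Hlt z Hz). set (a := (1 - z ^ 2) * h1 z) in *. set (b := (1 - z ^ 2) * g1 z) in *.
    assert (A' := Cmod_lt_sqr a b ltac:(assert (Q := Cmod_ge_Re a); lra)).
    assert (Q := pow2_ge_0 s).
    assert (Hq0 : (0 < / (2 * (1 + s ^ 2)))%R) by (apply Rinv_0_lt_compat; lra).
    assert (Es0 : exists q, (0 < q)%R /\ Ci / (2 * ((1%R, s) : C)) = (s * q, q)%R).
    { exists (/ (2 * (1 + s ^ 2)))%R. split; [exact Hq0|]. apply C_ext; simpl; field; nra. }
    destruct Es0 as [q [Hq Es]].
    replace ((h1 z + g1 z) * ((1 - z ^ 2) / 2)) with ((a + b) * RtoC (/ 2))
      by (unfold a, b; rewrite RtoC_inv by lra; field).
    replace ((h1 z + - (1) * g1 z) * ((1 - z ^ 2) / 2)) with ((a - b) * RtoC (/ 2))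
      by (unfold a, b; rewrite RtoC_inv by lra; field).
    replace ((h1 z + g1 z) * ((1 - z ^ 2) * (Ci / (2 * ((1%R, s) : C)))))
      with ((a + b) * (Ci / (2 * ((1%R, s) : C)))) by (unfold a, b; ring).
    replace ((h1 z + - (1) * g1 z) * ((1 - z ^ 2) * (Ci / (2 * ((1%R, s) : C)))))
      with ((a - b) * (Ci / (2 * ((1%R, s) : C)))) by (unfold a, b; ring).
    rewrite Es. rewrite re_scal_r, im_scal_r, re_mult, im_mult, re_plus, im_plus, Re_minus, Im_minus.
    simpl (Re (_, _)). simpl (Im (_, _)).
    set (x := Re a) in *. set (y := Im a) in *. set (x' := Re b) in *. set (y' := Im b) in *.
    match goal with |- (0 < ?e)%R =>
      replace e with ((x ^ 2 + y ^ 2 - (x' ^ 2 + y' ^ 2)) * q / 2)%R by field end.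
    apply Rmult_lt_0_compat; [apply Rmult_lt_0_compat; assumption|lra]. }
  assert (Rup : forall t1 s1 s, exists t, (U t1 s1 < U t s)%R).
  { exact (ray_reach phi phi1 k Dphi Ppos L1 K1). }
  (* The values below U t1 s1 are found near -1, that is, near 1 for the function
     - phi (- z). *)
  assert (Rdown : forall t1 s1 s, exists t, (U t s < U t1 s1)%R).
  { intros t1 s1 s.
    assert (Pr : forall z, unit_disc z -> (0 < Re ((1 - z ^ 2) * phi1 (- z)%C))%R).
    { intros z Hz. replace (z ^ 2)%C with ((- z) ^ 2)%C by ring. apply Ppos. now apply unit_disc_opp. }
    destruct (ray_reach (fun z => - phi (- z)) (fun z => phi1 (- z)) k') with
      (t1 := (- t1 - ln (1 + s1 ^ 2))%R) (s1 := (- s1)%R) (s := (- s)%R) as [r Hr].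
    - intros z Hz. apply is_C_derive_reflect, Dphi. now apply unit_disc_opp.
    - exact Pr.
    - intros eps He. destruct (L2 eps He) as [d [Hd HH]]. exists d. split; [exact Hd|].
      intros z Hz Hzd. replace (z ^ 2)%C with ((- z) ^ 2)%C by ring.
      apply HH; [now apply unit_disc_opp|].
      replace (- z - - (1)) with (- (z - 1)) by ring. now rewrite Cmod_opp.
    - exact K2.
    - rewrite <- zeta_opp in Hr. replace (- - zeta t1 s1) with (zeta t1 s1) in Hr by ring.
      rewrite (zeta_opp r), Ropp_involutive, !re_opp in Hr.
      exists (- r - ln (1 + (- s) ^ 2))%R. unfold U. lra. }
  assert (Ff : forall t s, f (zeta t s) = (U t s, W t s)).
  { intros t s. rewrite Ef by apply zeta_disc. unfold U, W, phi, psi.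
    apply C_ext; simpl; unfold Re, Im; ring. }
  split.
  - intros z w Hz Hw E. destruct (zeta_surj z Hz) as [t1 [s1 ->]].
    destruct (zeta_surj w Hw) as [t2 [s2 ->]]. rewrite !Ff in E. injection E as EU EW.
    destruct (level_injective U W Ut Us Wt Ws HU HW Upos Jpos Rup Rdown t1 s1 t2 s2 EU EW) as [-> ->].
    reflexivity.
  - intro x. eapply connected_set_iff;
      [|exact (level_connected U W Ut Us Wt Ws HU HW Upos Jpos Rup Rdown x)].
    intro w. split; intros [E H]; (split; [exact E|]).
    + destruct H as [t [s ->]]. exists (zeta t s). split; [apply zeta_disc|apply Ff].
    + destruct H as [z [Hz <-]]. destruct (zeta_surj z Hz) as [t [s ->]]. exists t, s. apply Ff.
Qed.

(** * Complex powers of a positive real *)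

Lemma Cmod_Rpower_C (t : R) (s : C) : Cmod (Rpower_C t s) = exp (Re s * ln t).
Proof.
  unfold Rpower_C. rewrite Cmod_mult, Cmod_R, Rabs_pos_eq by apply Rlt_le, exp_pos.
  set (y := (Im s * ln t)%R).
  assert (A := Cmod2_alt (cos y, sin y)). simpl in A.
  assert (B := sin2_cos2 y). unfold Rsqr in B.
  assert (D := Cmod_ge_0 (cos y, sin y)).
  assert (E : Cmod (cos y, sin y) = 1%R) by nra.
  rewrite E. ring.
Qed.

Lemma Rpower_C_plus (t : R) (s u : C) : Rpower_C t (s + u) = Rpower_C t s * Rpower_C t u.
Proof.
  unfold Rpower_C. rewrite re_plus, im_plus, !Rmult_plus_distr_r, exp_plus, cos_plus, sin_plus.
  apply C_ext; simpl; ring.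
Qed.

Lemma Rpower_C_1 (t : R) : (0 < t)%R -> Rpower_C t 1 = t.
Proof.
  intro H. unfold Rpower_C. simpl. rewrite Rmult_1_l, Rmult_0_l, cos_0, sin_0, exp_ln by exact H.
  apply C_ext; simpl; ring.
Qed.

(* Equations in a normed module over [C] are seen by [ring] and [field] only once
   their type is displayed as [C]. *)
Ltac as_C_equation := match goal with |- @eq _ ?u ?v => change (@eq C u v) end.

Notation is_R_derive := (is_derive (K := R_AbsRing) (V := C_R_NormedModule)).

Lemma is_R_derive_pair (f g : R -> R) (t df dg : R) :
  is_derive f t df -> is_derive g t dg -> is_R_derive (fun x => (f x, g x)) t (df, dg).
Proof.
  intros Hf Hg. split; [apply (is_linear_scal_l (K := R_AbsRing) (V := C_R_NormedModule))|].
  intros x Hx [e He].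
  destruct Hf as [_ Hf]. destruct Hg as [_ Hg].
  assert (He2 : (0 < e / 2)%R) by lra.
  specialize (Hf x Hx (mkposreal _ He2)). specialize (Hg x Hx (mkposreal _ He2)).
  generalize (filter_and _ _ Hf Hg). apply filter_imp. intros y [A B]. simpl in A, B |- *.
  rewrite <- Cmod_norm.
  eapply Rle_trans; [apply Cmod_le_Re_Im|].
  eapply Rle_trans; [apply Rplus_le_compat; [exact A|exact B]|]. lra.
Qed.

Lemma Rpower_C_derive (s : C) (t : R) : (0 < t)%R ->
  is_R_derive (fun x => Rpower_C x s) t (s * Rpower_C t (s - 1)).
Proof.
  intro H.
  assert (E : s * Rpower_C t (s - 1) =
    ((exp (Re s * ln t) * (Re s / t)) * cos (Im s * ln t) + exp (Re s * ln t) * (- sin (Im s * ln t) * (Im s / t)),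
     (exp (Re s * ln t) * (Re s / t)) * sin (Im s * ln t) + exp (Re s * ln t) * (cos (Im s * ln t) * (Im s / t)))%R).
  { replace (Rpower_C t (s - 1)) with (Rpower_C t s * RtoC (/ t)).
    - unfold Rpower_C. apply C_ext; simpl; unfold Re, Im; field; lra.
    - assert (A := Rpower_C_plus t (s - 1) 1). rewrite Rpower_C_1 in A by exact H.
      replace (s - 1 + 1) with s in A by ring. rewrite A, RtoC_inv by lra. field.
      intro B. apply RtoC_inj in B. lra. }
  rewrite E.
  eapply (is_derive_ext (K := R_AbsRing) (V := C_R_NormedModule)
    (fun x => (exp (Re s * ln x) * cos (Im s * ln x), exp (Re s * ln x) * sin (Im s * ln x))%R)).
  - intro x. unfold Rpower_C. apply C_ext; simpl; ring.
  - apply is_R_derive_pair; auto_derive; try (field; lra); repeat split; exact H.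
Qed.

Lemma is_linear_Cmult (k : C) :
  is_linear (K := R_AbsRing) (U := C_R_NormedModule) (V := C_R_NormedModule) (fun z => k * z).
Proof.
  split.
  - intros x y. apply Cmult_plus_distr_l.
  - intros r x. rewrite !scal_R_Cmult. as_C_equation. ring.
  - exists (Cmod k + 1)%R. assert (A := Cmod_ge_0 k). split; [lra|].
    intro x. rewrite <- !Cmod_norm, Cmod_mult. assert (B := Cmod_ge_0 x). nra.
Qed.

Lemma is_R_derive_scal (k : C) (f : R -> C) (t : R) (l : C) :
  is_R_derive f t l -> is_R_derive (fun x => k * f x) t (k * l).
Proof.
  intro H.
  assert (D := filterdiff_comp f (fun z => k * z) _ _ H
    (filterdiff_linear (K := R_AbsRing) (U := C_R_NormedModule) (V := C_R_NormedModule) _ (is_linear_Cmult k))).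
  unfold is_derive. eapply filterdiff_ext_lin; [exact D|].
  intro y. simpl. rewrite !scal_R_Cmult. as_C_equation. ring.
Qed.

Lemma is_R_derive_continuous (f : R -> C) (t : R) (l : C) :
  is_R_derive f t l -> continuous (U := C_R_NormedModule) f t.
Proof.
  intro H. apply (ex_derive_continuous (K := R_AbsRing) (V := C_R_NormedModule)). now exists l.
Qed.

Lemma Rpower_C_continuous (s : C) (t : R) : (0 < t)%R ->
  continuous (U := C_R_NormedModule) (fun x => Rpower_C x s) t.
Proof. intro H. eapply is_R_derive_continuous. now apply Rpower_C_derive. Qed.

(** * Euler's limit for the Gamma integral *)

Notation is_C_RInt := (is_RInt (V := C_R_NormedModule)).

Lemma is_C_RInt_scal (k : C) (f : R -> C) (a b : R) (I : C) :
  is_C_RInt f a b I -> is_C_RInt (fun t => k * f t) a b (k * I).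
Proof.
  intro H.
  assert (HR := is_RInt_fct_extend_fst (U := R_NormedModule) (V := R_NormedModule) f a b I H).
  assert (HI := is_RInt_fct_extend_snd (U := R_NormedModule) (V := R_NormedModule) f a b I H).
  apply (is_RInt_fct_extend_pair (U := R_NormedModule) (V := R_NormedModule) (fun t => k * f t)).
  - apply (is_RInt_minus (V := R_NormedModule));
      apply (is_RInt_scal (V := R_NormedModule)); assumption.
  - apply (is_RInt_plus (V := R_NormedModule));
      apply (is_RInt_scal (V := R_NormedModule)); assumption.
Qed.

(** Euler's product [n^s n! / (s (s+1) ... (s+n))]. *)
Definition gamma_approx (n : nat) (s : C) : C :=
  Rpower_C (INR n) s * INR (fact n) / pochhammer s (S n).

Lemma pochhammer_shift (s : C) (k : nat) :
  pochhammer s (S k) = s * pochhammer (s + 1) k.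
Proof.
  induction k as [|k IH].
  - simpl. ring.
  - change (pochhammer s (S (S k))) with (pochhammer s (S k) * (s + INR (S k))).
    rewrite IH. change (pochhammer (s + 1) (S k)) with (pochhammer (s + 1) k * (s + 1 + INR k)).
    rewrite S_INR, RtoC_plus. ring.
Qed.

Lemma pochhammer_neq_0 (s : C) (k : nat) : (0 < Re s)%R -> pochhammer s k <> 0.
Proof.
  intro H. induction k as [|k IH]; [exact C1_nz|].
  apply Cmult_neq_0; [exact IH|]. apply C_neq_0_Re.
  rewrite re_plus, re_RtoC. assert (A := pos_INR k). lra.
Qed.

Definition truncated (n : R) (k : nat) (s : C) (t : R) : C :=
  Rpower_C t (s - 1) * RtoC ((1 - t / n) ^ k).

Lemma Rpower_C_small (s : C) (eps : R) : (0 < Re s)%R -> (0 < eps)%R ->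
  exists d : R, (0 < d)%R /\ forall x, (0 < x < d)%R -> (Cmod (Rpower_C x s) < eps)%R.
Proof.
  intros Hs He. exists (exp (ln eps / Re s)). split; [apply exp_pos|].
  intros x [Hx0 Hx]. rewrite Cmod_Rpower_C. rewrite <- (exp_ln eps He) at 1.
  apply exp_increasing. apply ln_increasing in Hx; [|exact Hx0]. rewrite ln_exp in Hx.
  apply Rmult_lt_compat_l with (r := Re s) in Hx; [|exact Hs].
  replace (Re s * (ln eps / Re s))%R with (ln eps) in Hx by (field; lra). exact Hx.
Qed.

(** Integrating by parts lowers [k] and raises [s] by one; the boundary term at [n]
    contains the factor [1 - n/n], and the one at [x] vanishes with [x] because
    [Re s > 0]. *)
Lemma truncated_integral (n : R) (Hn : (0 < n)%R) (k : nat) :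
  forall s : C, (0 < Re s)%R -> forall eps : R, (0 < eps)%R ->
  exists d : R, (0 < d)%R /\ forall x, (0 < x < d)%R -> (x <= n)%R ->
    exists I : C, is_C_RInt (truncated n k s) x n I /\
      (Cmod (I - Rpower_C n s * INR (fact k) / pochhammer s (S k)) < eps)%R.
Proof.
  induction k as [|k IH]; intros s Hs eps He.
  - assert (Ns : s <> 0) by now apply C_neq_0_Re.
    assert (Ps : (0 < Cmod s)%R) by now apply Cmod_gt_0.
    destruct (Rpower_C_small s (eps * Cmod s) Hs) as [d [Hd HH]]; [nra|].
    exists d. split; [exact Hd|]. intros x Hx Hxn.
    exists (/ s * Rpower_C n s - / s * Rpower_C x s). split.
    + apply (is_RInt_ext (V := C_R_NormedModule) (fun t => / s * (s * Rpower_C t (s - 1)))).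
      { intros t _. unfold truncated. simpl. field. exact Ns. }
      apply (is_RInt_derive (V := C_R_CompleteNormedModule) (fun t => / s * Rpower_C t s));
        intros t Ht; rewrite Rmin_left in Ht by exact Hxn.
      * apply is_R_derive_scal, Rpower_C_derive. lra.
      * eapply is_R_derive_continuous.
        apply is_R_derive_scal, is_R_derive_scal, Rpower_C_derive. lra.
    + replace (/ s * Rpower_C n s - / s * Rpower_C x s - Rpower_C n s * INR (fact 0) / pochhammer s 1)
        with (- (Rpower_C x s / s)) by (simpl; field; exact Ns).
      rewrite Cmod_opp, Cmod_div by exact Ns.
      apply Rmult_lt_reg_r with (Cmod s); [exact Ps|]. unfold Rdiv.
      rewrite Rmult_assoc, Rinv_l, Rmult_1_r by lra. now apply HH.
  - assert (Ns : s <> 0) by now apply C_neq_0_Re.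
    assert (Ps : (0 < Cmod s)%R) by now apply Cmod_gt_0.
    assert (Hs1 : (0 < Re (s + 1))%R) by (rewrite re_plus, re_RtoC; lra).
    set (c := RtoC (INR (S k) / n) / s).
    assert (Hc := Cmod_ge_0 c).
    destruct (IH (s + 1) Hs1 (eps / 2 / (Cmod c + 1))%R) as [d1 [Hd1 H1]].
    { apply Rdiv_lt_0_compat; lra. }
    destruct (Rpower_C_small s (eps / 2 * Cmod s) Hs) as [d2 [Hd2 H2]]; [nra|].
    exists (Rmin d1 d2). split; [now apply Rmin_glb_lt|]. intros x Hx Hxn.
    assert (M1 := Rmin_l d1 d2). assert (M2 := Rmin_r d1 d2).
    destruct (H1 x ltac:(lra) Hxn) as [J [HJ EJ]]. specialize (H2 x ltac:(lra)).
    exists (c * J - RtoC ((1 - x / n) ^ S k) * (/ s * Rpower_C x s)). split.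
    + assert (B : is_C_RInt (fun t => scal ((1 - t / n) ^ S k)%R (/ s * (s * Rpower_C t (s - 1)))) x n
        (minus (minus (scal ((1 - n / n) ^ S k)%R (/ s * Rpower_C n s))
                      (scal ((1 - x / n) ^ S k)%R (/ s * Rpower_C x s))) (- c * J))).
      { apply (is_RInt_scal_derive_r (V := C_R_CompleteNormedModule)
          (fun t => (1 - t / n) ^ S k)%R (fun t => / s * Rpower_C t s)
          (fun t => - (INR (S k) / n) * (1 - t / n) ^ k)%R).
        - intros t _. auto_derive; [exact I|]. change (match k with O => 1 | S _ => INR k + 1 end)%R with (INR (S k)). simpl pred.
          unfold Rdiv, Rminus. ring.
        - intros t Ht. rewrite Rmin_left in Ht by exact Hxn.
          apply is_R_derive_scal, Rpower_C_derive. lra.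
        - intros t _. apply (ex_derive_continuous (V := R_NormedModule)). auto_derive. exact I.
        - intros t Ht. rewrite Rmin_left in Ht by exact Hxn. eapply is_R_derive_continuous.
          apply is_R_derive_scal, is_R_derive_scal, Rpower_C_derive. lra.
        - eapply (is_RInt_ext (V := C_R_NormedModule) (fun t => - c * truncated n k (s + 1) t)).
          + intros t _. rewrite scal_R_Cmult. unfold truncated, c.
            replace (s + 1 - 1) with s by ring. rewrite RtoC_mult, RtoC_opp. as_C_equation. field. exact Ns.
          + apply is_C_RInt_scal. exact HJ. }
      replace (c * J - RtoC ((1 - x / n) ^ S k) * (/ s * Rpower_C x s)) with
        (minus (minus (scal ((1 - n / n) ^ S k)%R (/ s * Rpower_C n s))
                      (scal ((1 - x / n) ^ S k)%R (/ s * Rpower_C x s))) (- c * J)).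
      2:{ rewrite !scal_R_Cmult. replace (1 - n / n)%R with 0%R by (field; lra).
          rewrite pow_i by lia. 
          change (RtoC 0 * (/ s * Rpower_C n s) - RtoC ((1 - x / n) ^ S k) * (/ s * Rpower_C x s)
                  - - c * J = c * J - RtoC ((1 - x / n) ^ S k) * (/ s * Rpower_C x s)). ring. }
      apply (is_RInt_ext (V := C_R_NormedModule)
        (fun t => scal ((1 - t / n) ^ S k)%R (/ s * (s * Rpower_C t (s - 1))))); [|exact B].
      intros t _. rewrite scal_R_Cmult. unfold truncated. as_C_equation. field. exact Ns.
    + set (L := Rpower_C n (s + 1) * INR (fact k) / pochhammer (s + 1) (S k)) in *.
      assert (EL : Rpower_C n s * INR (fact (S k)) / pochhammer s (S (S k)) = c * L).
      { unfold L, c. rewrite (pochhammer_shift s (S k)), Rpower_C_plus, Rpower_C_1 by exact Hn.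
        assert (N2 := pochhammer_neq_0 (s + 1) (S k) Hs1).
        rewrite RtoC_div by lra.
        change (fact (S k)) with ((S k) * fact k)%nat. rewrite mult_INR, RtoC_mult.
        field. repeat split; auto. intro A; apply RtoC_inj in A; lra. }
      rewrite EL.
      replace (c * J - RtoC ((1 - x / n) ^ S k) * (/ s * Rpower_C x s) - c * L)
        with (c * (J - L) - RtoC ((1 - x / n) ^ S k) * (/ s * Rpower_C x s)) by ring.
      eapply Rle_lt_trans; [apply Cmod_minus_triangle|].
      rewrite !Cmod_mult, Cmod_R, Cmod_inv by exact Ns.
      assert (X : (0 <= 1 - x / n <= 1)%R).
      { assert (Y : (0 <= x / n)%R) by (apply Rdiv_le_0_compat; lra).
        assert (Z : (x / n <= 1)%R).
        { apply Rmult_le_reg_r with n; [exact Hn|]. unfold Rdiv.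
          rewrite Rmult_assoc, Rinv_l by lra. lra. }
        lra. }
      assert (X1 : (0 <= (1 - x / n) ^ S k <= 1)%R).
      { split; [apply pow_le; lra|]. rewrite <- (pow1 (S k)) at 2. apply pow_incr; lra. }
      rewrite Rabs_pos_eq by lra.
      assert (Q1 : (Cmod c * Cmod (J - L) < eps / 2)%R).
      { assert (E : (eps / 2 = (Cmod c + 1) * (eps / 2 / (Cmod c + 1)))%R) by (field; lra).
        assert (P : (0 < eps / 2 / (Cmod c + 1))%R) by (apply Rdiv_lt_0_compat; lra).
        assert (Q := Cmod_ge_0 (J - L)). nra. }
      assert (Q2 : (/ Cmod s * Cmod (Rpower_C x s) < eps / 2)%R).
      { apply Rmult_lt_reg_l with (Cmod s); [exact Ps|].
        rewrite <- Rmult_assoc, Rinv_r, Rmult_1_l by lra. lra. }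
      assert (Q3 : (0 <= / Cmod s * Cmod (Rpower_C x s))%R).
      { apply Rmult_le_pos; [apply Rlt_le, Rinv_0_lt_compat, Ps|apply Cmod_ge_0]. }
      nra.
Qed.

Lemma bernoulli_sub (u : R) (n : nat) : (0 <= u <= 1)%R -> (1 - INR n * u <= (1 - u) ^ n)%R.
Proof.
  intros Hu. induction n as [|n IH]; [simpl; lra|].
  rewrite S_INR. simpl pow.
  assert (A : (0 <= (1 - u) ^ n)%R) by (apply pow_le; lra).
  assert (B : ((1 - u) ^ n <= 1)%R) by (rewrite <- (pow1 n) at 2; apply pow_incr; lra).
  assert (D := pos_INR n). nra.
Qed.

Lemma exp_pow (x : R) (n : nat) : (exp x ^ n = exp (INR n * x))%R.
Proof.
  induction n as [|n IH]; [simpl; now rewrite Rmult_0_l, exp_0|].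
  rewrite S_INR. simpl pow. rewrite IH, <- exp_plus. f_equal. ring.
Qed.

(** [(1 - t/n) * exp (t/n)] lies between [1 - (t/n)^2] and [1]; raise to the
    power [n]. *)
Lemma exp_truncation (n : nat) (t : R) : (0 < n)%nat -> (0 <= t <= INR n)%R ->
  (0 <= exp (- t) - (1 - t / INR n) ^ n <= t ^ 2 / INR n * exp (- t))%R.
Proof.
  intros Hn Ht. assert (N : (0 < INR n)%R) by now apply lt_0_INR.
  set (u := (t / INR n)%R).
  assert (Hu : (0 <= u <= 1)%R).
  { split; [apply Rdiv_le_0_compat; lra|].
    apply Rmult_le_reg_r with (INR n); [exact N|]. unfold u, Rdiv.
    rewrite Rmult_assoc, Rinv_l; lra. }
  assert (Et : t = (INR n * u)%R) by (unfold u; field; lra).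
  assert (E1 : exp (- t) = (exp (- u) ^ n)%R) by (rewrite exp_pow, Et; f_equal; ring).
  assert (X := exp_pos (- t)).
  split.
  - assert (A := exp_ineq1_le (- u)). rewrite E1.
    assert (B : ((1 - u) ^ n <= exp (- u) ^ n)%R) by (apply pow_incr; lra). lra.
  - assert (A : ((1 - u ^ 2) ^ n <= ((1 - u) * exp u) ^ n)%R).
    { apply pow_incr. assert (B := exp_ineq1_le u). split; nra. }
    assert (B := bernoulli_sub (u ^ 2) n ltac:(nra)).
    rewrite Rpow_mult_distr, exp_pow, <- Et in A.
    assert (D : (exp t * exp (- t) = 1)%R) by (rewrite <- exp_plus, Rplus_opp_r; apply exp_0).
    replace (t ^ 2 / INR n)%R with (INR n * u ^ 2)%R by (rewrite Et; field; lra).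
    assert (F : ((1 - INR n * u ^ 2) * exp (- t) <= (1 - u) ^ n * exp t * exp (- t))%R).
    { apply Rmult_le_compat_r; lra. }
    rewrite Rmult_assoc, D, Rmult_1_r in F. lra.
Qed.

(** [p ln t <= t/2 + p ln (2p)], from [1 + y <= exp y] at [y = ln (t / (2p))]. *)
Lemma power_exp_bound (p : R) : (0 < p)%R -> exists K, (0 < K)%R /\
  forall t, (0 < t)%R -> (exp (p * ln t) * exp (- t) <= K * exp (- t / 2))%R.
Proof.
  intro Hp. exists (exp (p * ln (2 * p))). split; [apply exp_pos|]. intros t Ht.
  rewrite <- !exp_plus.
  assert (A := exp_ineq1_le (ln (t / (2 * p)))).
  assert (P : (0 < t / (2 * p))%R) by (apply Rdiv_lt_0_compat; lra).
  rewrite exp_ln in A by exact P.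
  rewrite ln_div in A by lra.
  assert (B : (p * (ln t - ln (2 * p)) <= t / 2)%R).
  { replace (t / 2)%R with (p * (t / (2 * p)))%R by (field; lra).
    apply Rmult_le_compat_l; lra. }
  destruct (Rle_lt_or_eq_dec (p * ln t + - t) (p * ln (2 * p) + - t / 2)) as [L|L]; [lra| |].
  - left. now apply exp_increasing.
  - rewrite L. lra.
Qed.

Definition gamma_integrand (s : C) (t : R) : C := Rpower_C t (s - 1) * RtoC (exp (- t)).

Lemma is_RInt_exp_half (c x y : R) :
  is_RInt (fun t => c * exp (- t / 2))%R x y (c * (2 * exp (- x / 2) - 2 * exp (- y / 2)))%R.
Proof.
  replace (c * (2 * exp (- x / 2) - 2 * exp (- y / 2)))%R
    with (minus (- 2 * c * exp (- y / 2)) (- 2 * c * exp (- x / 2)))%R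
    by (unfold minus, plus, opp; simpl; ring).
  apply (is_RInt_derive (V := R_CompleteNormedModule) (fun t => - 2 * c * exp (- t / 2))%R).
  - intros t _. auto_derive; [exact I|]. unfold Rdiv. field.
  - intros t _. apply (ex_derive_continuous (V := R_NormedModule)). auto_derive. exact I.
Qed.

Lemma gamma_integrand_continuous s t : (0 < t)%R ->
  continuous (U := C_R_NormedModule) (gamma_integrand s) t.
Proof.
  intro Ht. unfold gamma_integrand.
  apply (continuous_ext (fun t => scal (exp (- t)) (Rpower_C t (s - 1)))).
  { intro x. rewrite scal_R_Cmult. apply Cmult_comm. }
  apply (continuous_scal (K := R_AbsRing) (V := C_R_NormedModule)).
  - apply (ex_derive_continuous (V := R_NormedModule)). auto_derive. exact I.
  - now apply Rpower_C_continuous.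
Qed.

Lemma gamma_integrand_ex s x y : (0 < x)%R -> (0 < y)%R ->
  exists I, is_C_RInt (gamma_integrand s) x y I.
Proof.
  intros Hx Hy.
  apply (ex_RInt_continuous (V := C_R_CompleteNormedModule)). intros t Ht.
  apply gamma_integrand_continuous.
  assert (A : (0 < Rmin x y)%R) by now apply Rmin_glb_lt. lra.
Qed.

(** The distance is [O(1/n)] uniformly in the end points: the replacement of
    [exp (- t)] by [(1 - t/n)^n] up to [n], and by 0 beyond [n], changes the
    integrand by at most [(t^2 / n) t^(Re s - 1) exp (- t)]. *)
Lemma gamma_partial_integral (s : C) : (0 < Re s)%R -> exists K, (0 < K)%R /\
  forall n : nat, (0 < n)%nat -> forall eps, (0 < eps)%R ->
  exists d, (0 < d)%R /\ forall x y, (0 < x < d)%R -> (INR n <= y)%R ->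
    exists I, is_C_RInt (gamma_integrand s) x y I /\
      (Cmod (I - gamma_approx n s) < K / INR n + eps)%R.
Proof.
  intro Hs. destruct (power_exp_bound (Re s + 1)%R) as [K [HK HKt]]; [lra|].
  exists (4 * K)%R. split; [lra|]. intros n Hn eps He.
  assert (N : (0 < INR n)%R) by now apply lt_0_INR.
  assert (N1 : (1 <= INR n)%R) by (apply (le_INR 1); lia).
  destruct (truncated_integral (INR n) N n s Hs eps He) as [d [Hd HH]].
  exists (Rmin d (INR n)). split; [now apply Rmin_glb_lt|]. intros x y Hx Hy.
  assert (M1 := Rmin_l d (INR n)). assert (M2 := Rmin_r d (INR n)).
  destruct (HH x ltac:(lra) ltac:(lra)) as [J [HJ EJ]].
  destruct (gamma_integrand_ex s x (INR n)) as [I1 H1]; [lra|lra|].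
  destruct (gamma_integrand_ex s (INR n) y) as [I2 H2]; [lra|lra|].
  exists (I1 + I2). split; [exact (is_RInt_Chasles (V := C_R_NormedModule) _ _ _ _ _ _ H1 H2)|].
  assert (Pw : forall t, (0 < t)%R ->
     (Cmod (Rpower_C t (s - 1)) * (t ^ 2 / INR n * exp (- t)) <= K / INR n * exp (- t / 2))%R).
  { intros t Ht. rewrite Cmod_Rpower_C, Re_minus, re_RtoC.
    assert (E : (exp ((Re s - 1) * ln t) * (t ^ 2 / INR n * exp (- t)) =
                 / INR n * (exp ((Re s + 1) * ln t) * exp (- t)))%R).
    { replace ((Re s + 1) * ln t)%R with ((Re s - 1) * ln t + (ln t + ln t))%R by ring.
      rewrite !exp_plus, exp_ln by exact Ht. field. lra. }
    rewrite E. replace (K / INR n * exp (- t / 2))%R with (/ INR n * (K * exp (- t / 2)))%R by (field; lra).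
    apply Rmult_le_compat_l; [apply Rlt_le, Rinv_0_lt_compat, N|]. now apply HKt. }
  assert (T : forall u v, (0 < u)%R -> (K / INR n * (2 * exp (- u / 2) - 2 * exp (- v / 2)) <= 2 * K / INR n)%R).
  { intros u v Hu. assert (A := exp_pos (- v / 2)).
    assert (B : (exp (- u / 2) < 1)%R) by (rewrite <- exp_0; apply exp_increasing; lra).
    assert (D : (0 < K / INR n)%R) by now apply Rdiv_lt_0_compat.
    replace (2 * K / INR n)%R with (K / INR n * 2)%R by (field; lra).
    apply Rmult_le_compat_l; lra. }
  assert (B1 : (Cmod (I1 - J) <= 2 * K / INR n)%R).
  { eapply Rle_trans; [|apply (T x (INR n)); lra].
    assert (Hdiff := is_RInt_minus (V := C_R_NormedModule) _ _ _ _ _ _ H1 HJ).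
    rewrite Cmod_norm.
    refine (norm_RInt_le (V := C_R_NormedModule) _ _ x (INR n) _ _ _ _ Hdiff (is_RInt_exp_half (K / INR n) x (INR n))).
    - lra.
    - intros t Ht. rewrite <- Cmod_norm.
      change (Cmod (gamma_integrand s t - truncated (INR n) n s t) <= K / INR n * exp (- t / 2))%R.
      replace (gamma_integrand s t - truncated (INR n) n s t)
        with (Rpower_C t (s - 1) * RtoC (exp (- t) - (1 - t / INR n) ^ n))
        by (unfold gamma_integrand, truncated; rewrite RtoC_minus; ring).
      assert (X := exp_truncation n t Hn ltac:(lra)).
      rewrite Cmod_mult, Cmod_R, Rabs_pos_eq by lra.
      eapply Rle_trans; [|apply Pw; lra].
      apply Rmult_le_compat_l; [apply Cmod_ge_0|lra]. }
  assert (B2 : (Cmod I2 <= 2 * K / INR n)%R).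
  { eapply Rle_trans; [|apply (T (INR n) y); lra].
    rewrite Cmod_norm.
    refine (norm_RInt_le (V := C_R_NormedModule) _ _ (INR n) y _ _ _ _ H2 (is_RInt_exp_half (K / INR n) (INR n) y)).
    - exact Hy.
    - intros t Ht. rewrite <- Cmod_norm. unfold gamma_integrand.
      assert (X := exp_pos (- t)).
      rewrite Cmod_mult, Cmod_R, Rabs_pos_eq by lra.
      eapply Rle_trans; [|apply Pw; lra].
      apply Rmult_le_compat_l; [apply Cmod_ge_0|].
      assert (Y : (1 <= t ^ 2 / INR n)%R).
      { apply Rmult_le_reg_r with (INR n); [exact N|]. unfold Rdiv.
        rewrite Rmult_assoc, Rinv_l by lra. nra. }
      nra. }
  replace (I1 + I2 - gamma_approx n s) with ((I1 - J) + I2 + (J - gamma_approx n s)) by ring.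
  eapply Rle_lt_trans; [apply Cmod_triangle|].
  eapply Rle_lt_trans; [apply Rplus_le_compat_r, Cmod_triangle|].
  unfold gamma_approx in *.
  replace (4 * K / INR n)%R with (2 * K / INR n + 2 * K / INR n)%R by (field; lra). lra.
Qed.

Lemma inv_INR_small (K eps : R) : (0 <= K)%R -> (0 < eps)%R ->
  exists N : nat, (0 < N)%nat /\ forall n, (N <= n)%nat -> (K / INR n < eps)%R.
Proof.
  intros HK He. destruct (nfloor_ex (K / eps)) as [N [_ HN]].
  { apply Rdiv_le_0_compat; lra. }
  exists (S N). split; [lia|]. intros n Hn. apply le_INR in Hn. rewrite S_INR in Hn.
  assert (P := pos_INR N).
  apply Rmult_lt_reg_r with (INR n); [lra|]. unfold Rdiv.
  rewrite Rmult_assoc, Rinv_l, Rmult_1_r by lra.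
  replace K with (eps * (K / eps))%R by (field; lra).
  apply Rmult_lt_compat_l; lra.
Qed.

Lemma gamma_approx_cauchy (s : C) : (0 < Re s)%R -> exists K, (0 < K)%R /\
  forall n m : nat, (0 < n)%nat -> (0 < m)%nat ->
  (Cmod (gamma_approx n s - gamma_approx m s) <= K / INR n + K / INR m)%R.
Proof.
  intro Hs. destruct (gamma_partial_integral s Hs) as [K [HK H]].
  exists K. split; [exact HK|]. intros n m Hn Hm. apply Rle_plus_epsilon. intros eps He.
  destruct (H n Hn (eps / 2)%R ltac:(lra)) as [d1 [Hd1 H1]].
  destruct (H m Hm (eps / 2)%R ltac:(lra)) as [d2 [Hd2 H2]].
  set (x := (Rmin d1 d2 / 2)%R). set (y := Rmax (INR n) (INR m)).
  assert (M := Rmin_glb_lt _ _ _ Hd1 Hd2).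
  assert (M1 := Rmin_l d1 d2). assert (M2 := Rmin_r d1 d2).
  destruct (H1 x y) as [I1 [A1 B1]]; [unfold x; lra|apply Rmax_l|].
  destruct (H2 x y) as [I2 [A2 B2]]; [unfold x; lra|apply Rmax_r|].
  assert (E : I1 = I2).
  { rewrite <- (is_RInt_unique (V := C_R_CompleteNormedModule) _ _ _ _ A1).
    apply (is_RInt_unique (V := C_R_CompleteNormedModule) _ _ _ _ A2). }
  subst I2.
  replace (gamma_approx n s - gamma_approx m s)
    with ((I1 - gamma_approx m s) - (I1 - gamma_approx n s)) by ring.
  eapply Rle_trans; [apply Cmod_minus_triangle|]. lra.
Qed.

Lemma C_cauchy_rate (u : nat -> C) (K : R) : (0 < K)%R ->
  (forall n m : nat, (0 < n)%nat -> (0 < m)%nat -> (Cmod (u n - u m) <= K / INR n + K / INR m)%R) ->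
  exists l : C, forall n, (0 < n)%nat -> (Cmod (u n - l) <= K / INR n)%R.
Proof.
  intros HK H.
  assert (G : forall f : C -> R, (forall z w, Rabs (f z - f w) <= Cmod (z - w))%R ->
     ex_finite_lim_seq (fun n => f (u n))).
  { intros f Hf. apply ex_lim_seq_cauchy_corr. intro eps.
    assert (He := cond_pos eps).
    destruct (inv_INR_small K (eps / 2)%R) as [N [HN HNn]]; [lra|lra|].
    exists N. intros n m Hn Hm.
    eapply Rle_lt_trans; [apply Hf|]. eapply Rle_lt_trans; [apply H; lia|].
    assert (A := HNn n Hn). assert (B := HNn m Hm). lra. }
  destruct (G Re) as [lr Hr].
  { intros z w. rewrite <- Re_minus. apply re_le_Cmod. }
  destruct (G Im) as [li Hi].
  { intros z w. rewrite <- Im_minus. apply Im_le_Cmod. }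
  exists (lr, li). intros n Hn. apply Rle_plus_epsilon. intros eps He.
  destruct (inv_INR_small K (eps / 3)%R) as [N [HN HNn]]; [lra|lra|].
  apply is_lim_seq_spec in Hr. apply is_lim_seq_spec in Hi.
  assert (He3 : (0 < eps / 3)%R) by lra.
  destruct (Hr (mkposreal _ He3)) as [N1 H1]. destruct (Hi (mkposreal _ He3)) as [N2 H2].
  set (m := (N + N1 + N2)%nat).
  specialize (H1 m ltac:(lia)). specialize (H2 m ltac:(lia)). simpl in H1, H2.
  assert (A := HNn m ltac:(lia)). assert (B := H n m Hn ltac:(lia)).
  assert (D := Cmod_le_Re_Im (u m - (lr, li))).
  rewrite Re_minus, Im_minus in D. simpl in D.
  replace (u n - (lr, li)) with ((u n - u m) + (u m - (lr, li))) by ring.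
  eapply Rle_trans; [apply Cmod_triangle|]. lra.
Qed.

(** The approximations form a Cauchy sequence since each is close to the same
    partial integrals; the rate identifies its limit with the improper integral. *)
Lemma gamma_approx_Gamma (s : C) : (0 < Re s)%R -> exists K, (0 < K)%R /\
  forall n : nat, (0 < n)%nat -> (Cmod (gamma_approx n s - Gamma s) <= K / INR n)%R.
Proof.
  intro Hs. destruct (gamma_approx_cauchy s Hs) as [K [HK H]].
  destruct (C_cauchy_rate _ K HK H) as [l Hl].
  exists K. split; [exact HK|]. replace (Gamma s) with l; [exact Hl|].
  symmetry. unfold Gamma. apply (is_RInt_gen_unique (V := C_R_CompleteNormedModule)).
  change (is_RInt_gen (V := C_R_NormedModule) (gamma_integrand s) (at_right 0%R) (Rbar_locally p_infty) l).
  destruct (gamma_partial_integral s Hs) as [K' [HK' H']].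
  intros P [e HP]. assert (He := cond_pos e).
  destruct (inv_INR_small (K + K')%R (e / 2)%R) as [N [HN HNn]]; [lra|lra|].
  destruct (H' N HN (e / 2)%R ltac:(lra)) as [d [Hd HH]].
  apply Filter_prod with (fun x => 0 < x < d)%R (fun y => INR N <= y)%R.
  - exists (mkposreal d Hd). intros x Hx Hx0. split; [exact Hx0|].
    change (Rabs (x - 0) < d)%R in Hx. apply Rabs_def2 in Hx. lra.
  - exists (INR N). intros y Hy. lra.
  - intros x y Hx Hy. destruct (HH x y Hx Hy) as [I [HI EI]].
    exists I. split; [exact HI|]. apply HP.
    assert (A := HNn N (Nat.le_refl N)). assert (B := Hl N HN).
    assert (D : (Cmod (I - l) < e)%R).
    { replace (I - l) with ((I - gamma_approx N s) + (gamma_approx N s - l)) by ring.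
      eapply Rle_lt_trans; [apply Cmod_triangle|].
      unfold Rdiv in *. rewrite Rmult_plus_distr_r in A. lra. }
    split.
    + change (Rabs (Re I - Re l) < e)%R. rewrite <- Re_minus.
      eapply Rle_lt_trans; [apply re_le_Cmod|exact D].
    + change (Rabs (Im I - Im l) < e)%R. rewrite <- Im_minus.
      eapply Rle_lt_trans; [apply Im_le_Cmod|exact D].
Qed.

(** * Limits of complex sequences *)

Definition Clim (u : nat -> C) (l : C) : Prop := is_lim_seq (fun n => Cmod (u n - l)) 0%R.

Lemma Clim_unique u l l' : Clim u l -> Clim u l' -> l = l'.
Proof.
  unfold Clim. intros H H'.
  assert (S := is_lim_seq_plus' _ _ _ _ H H'). rewrite Rplus_0_r in S.
  assert (L : (Cmod (l - l') <= 0)%R).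
  { refine (is_lim_seq_le (fun _ => Cmod (l - l')) _ (Cmod (l - l')) 0%R _
      (is_lim_seq_const _) S).
    intro n.
    replace (l - l') with ((u n - l') - (u n - l)) by ring.
    rewrite Rplus_comm. apply Cmod_minus_triangle. }
  assert (E : Cmod (l - l') = 0%R) by (assert (A := Cmod_ge_0 (l - l')); lra).
  apply Cmod_eq_0 in E. now apply Ceq_minus.
Qed.

Lemma Clim_squeeze u l (v : nat -> R) :
  (forall n, (Cmod (u n - l) <= v n)%R) -> is_lim_seq v 0%R -> Clim u l.
Proof.
  intros H Hv. unfold Clim.
  apply (is_lim_seq_le_le (fun _ => 0%R) _ v 0%R); [|apply is_lim_seq_const|exact Hv].
  intro n. split; [apply Cmod_ge_0|apply H].
Qed.

Lemma Clim_mult u v l m : Clim u l -> Clim v m -> Clim (fun n => u n * v n) (l * m).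
Proof.
  intros Hu Hv.
  apply Clim_squeeze with (fun n => Cmod (u n - l) * (Cmod (v n - m) + Cmod m) + Cmod l * Cmod (v n - m))%R.
  - intro n. replace (u n * v n - l * m) with ((u n - l) * v n + l * (v n - m)) by ring.
    eapply Rle_trans; [apply Cmod_triangle|]. rewrite !Cmod_mult.
    apply Rplus_le_compat_r, Rmult_le_compat_l; [apply Cmod_ge_0|].
    assert (A := Cmod_triangle_rev (v n) m). lra.
  - replace 0%R with (0 * (0 + Cmod m) + Cmod l * 0)%R by ring.
    apply is_lim_seq_plus'.
    + apply is_lim_seq_mult'; [exact Hu|].
      apply is_lim_seq_plus'; [exact Hv|apply is_lim_seq_const].
    + apply is_lim_seq_mult'; [apply is_lim_seq_const|exact Hv].
Qed.

Lemma Clim_RtoC (u : nat -> R) (l : R) : is_lim_seq u l -> Clim (fun n => RtoC (u n)) l.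
Proof.
  intro H. unfold Clim.
  apply is_lim_seq_ext with (fun n => Rabs (u n - l)).
  { intro n. now rewrite <- RtoC_minus, Cmod_R. }
  rewrite <- Rabs_R0. apply (is_lim_seq_abs _ (0%R : Rbar)).
  replace 0%R with (l - l)%R by ring. apply is_lim_seq_minus'; [exact H|apply is_lim_seq_const].
Qed.

Lemma is_lim_seq_div_INR (K : R) : is_lim_seq (fun n => K / INR n)%R 0%R.
Proof.
  replace 0%R with (K * 0)%R by ring. unfold Rdiv.
  apply is_lim_seq_mult'; [apply is_lim_seq_const|].
  apply (is_lim_seq_inv INR p_infty); [apply is_lim_seq_INR|discriminate].
Qed.

Lemma gamma_approx_lim s : (0 < Re s)%R -> Clim (fun n => gamma_approx (S n) s) (Gamma s).
Proof.
  intro Hs. destruct (gamma_approx_Gamma s Hs) as [K [HK H]].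
  apply Clim_squeeze with (fun n => K / INR (S n))%R.
  - intro n. apply H. lia.
  - apply (is_lim_seq_incr_1 (fun n => K / INR n)%R). apply is_lim_seq_div_INR.
Qed.

Lemma pochhammer_1 n : pochhammer 1 n = INR (fact n).
Proof.
  induction n as [|n IH]; [reflexivity|].
  change (pochhammer 1 (S n)) with (pochhammer 1 n * (1 + INR n)).
  rewrite IH. change (fact (S n)) with ((S n) * fact n)%nat.
  rewrite mult_INR, S_INR, RtoC_mult, RtoC_plus. ring.
Qed.

Lemma RtoC_neq_0 (x : R) : x <> 0%R -> RtoC x <> 0.
Proof. intros H E. apply H. now apply RtoC_inj. Qed.

(** The powers of [n] cancel in Euler's products for [a], [b] and [a + b], and the
    shifted factorials that remain form one coefficient of [F (a, b; a + b; z)]. *)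
Lemma gamma_approx_hyp_coef (a b : C) (n : nat) : (0 < Re a)%R -> (0 < Re b)%R ->
  gamma_approx n a * gamma_approx n b * (INR (S n) * hyp_coef a b (a + b) (S n))
  = gamma_approx n (a + b).
Proof.
  intros Ha Hb.
  assert (Hab : (0 < Re (a + b))%R) by (rewrite re_plus; lra).
  assert (Na := pochhammer_neq_0 a (S n) Ha). assert (Nb := pochhammer_neq_0 b (S n) Hb).
  assert (Nab := pochhammer_neq_0 (a + b) (S n) Hab).
  assert (Nf : RtoC (INR (fact n)) <> 0) by (apply RtoC_neq_0, INR_fact_neq_0).
  assert (NS : RtoC (INR (S n)) <> 0) by (apply RtoC_neq_0, not_0_INR; lia).
  unfold gamma_approx, hyp_coef. rewrite Rpower_C_plus, pochhammer_1.
  change (fact (S n)) with ((S n) * fact n)%nat. rewrite mult_INR, RtoC_mult.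
  field. repeat split; assumption.
Qed.

(** * Growth of the hypergeometric coefficients *)

(** In both cases of the theorem [sigma = a + b] and [p = a b] are real, while [a]
    and [b] may be complex; so the coefficients of [F (a, b; a + b; z)] are expressed
    through them by their ratio [(k + a) (k + b) / ((a + b + k) (1 + k))]. *)
Fixpoint real_hyp_coef (sigma p : R) (n : nat) : R :=
  match n with
  | O => 1
  | S k => (real_hyp_coef sigma p k
            * ((INR k ^ 2 + sigma * INR k + p) / ((sigma + INR k) * (1 + INR k))))%R
  end.

Lemma hyp_coef_real (a b : C) (sigma p : R) (n : nat) : (0 < sigma)%R ->
  a + b = sigma -> a * b = p ->
  hyp_coef a b (a + b) n = real_hyp_coef sigma p n.
Proof.
  intros Hs Es Ep.
  assert (N1 : forall k, pochhammer 1 k <> 0) by (intro; apply pochhammer_neq_0; simpl; lra).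
  assert (N2 : forall k, pochhammer (a + b) k <> 0) by (intro; apply pochhammer_neq_0; rewrite Es, re_RtoC; exact Hs).
  induction n as [|n IH].
  - unfold hyp_coef. simpl. field.
  - change (real_hyp_coef sigma p (S n)) with (real_hyp_coef sigma p n
      * ((INR n ^ 2 + sigma * INR n + p) / ((sigma + INR n) * (1 + INR n))))%R.
    assert (P := pos_INR n).
    rewrite RtoC_mult, RtoC_div, <- IH by nra. unfold hyp_coef.
    change (pochhammer a (S n)) with (pochhammer a n * (a + INR n)).
    change (pochhammer b (S n)) with (pochhammer b n * (b + INR n)).
    change (pochhammer (a + b) (S n)) with (pochhammer (a + b) n * (a + b + INR n)).
    change (pochhammer 1 (S n)) with (pochhammer 1 n * (1 + INR n)).
    assert (M1 := N1 n). assert (M2 := N2 n).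
    rewrite !RtoC_plus, !RtoC_mult, !RtoC_plus, <- Es, <- Ep, RtoC_pow.
    field. repeat split; auto.
    + rewrite <- RtoC_plus. apply RtoC_neq_0. lra.
    + rewrite Es, <- RtoC_plus. apply RtoC_neq_0. lra.
Qed.

Section Growth.

Variables sigma p : R.
Hypothesis sigma_pos : (0 < sigma)%R.
Hypothesis p_pos : (0 < p)%R.

Local Notation A := (real_hyp_coef sigma p).

Lemma real_hyp_coef_pos n : (0 < A n)%R.
Proof.
  induction n as [|n IH]; simpl; [lra|].
  apply Rmult_lt_0_compat; [exact IH|]. assert (P := pos_INR n).
  apply Rdiv_lt_0_compat; nra.
Qed.

Lemma scaled_coef_step n :
  (INR (S (S n)) * A (S (S n)) = INR (S n) * A (S n) * (1 + p / (INR (S n) * (INR (S n) + sigma))))%R.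
Proof.
  change (A (S (S n))) with (A (S n) * ((INR (S n) ^ 2 + sigma * INR (S n) + p) / ((sigma + INR (S n)) * (1 + INR (S n)))))%R.
  rewrite (S_INR (S n)). assert (P : (0 < INR (S n))%R) by (apply lt_0_INR; lia).
  generalize dependent (INR (S n)). intros x P. field. lra.
Qed.

Lemma scaled_coef_increasing n : (INR (S n) * A (S n) <= INR (S (S n)) * A (S (S n)))%R.
Proof.
  rewrite scaled_coef_step. assert (P : (0 < INR (S n))%R) by (apply lt_0_INR; lia).
  assert (Q := real_hyp_coef_pos (S n)).
  assert (D : (0 < p / (INR (S n) * (INR (S n) + sigma)))%R) by (apply Rdiv_lt_0_compat; nra).
  assert (X : (0 < INR (S n) * A (S n))%R) by now apply Rmult_lt_0_compat.
  nra.
Qed.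

Lemma scaled_coef_bound n :
  (INR (S (S n)) * A (S (S n)) <= A 1 * exp (p * (2 - / INR (S n))))%R.
Proof.
  assert (Step : forall m, (INR (S (S m)) * A (S (S m)) <= INR (S m) * A (S m) * exp (p * / INR (S m) ^ 2))%R).
  { intro m. rewrite scaled_coef_step. assert (P : (0 < INR (S m))%R) by (apply lt_0_INR; lia).
    assert (Q := real_hyp_coef_pos (S m)).
    apply Rmult_le_compat_l; [apply Rmult_le_pos; lra|].
    eapply Rle_trans; [|apply exp_ineq1_le]. apply Rplus_le_compat_l. unfold Rdiv.
    apply Rmult_le_compat_l; [lra|]. apply Rinv_le_contravar; nra. }
  induction n as [|n IH].
  - eapply Rle_trans; [apply Step|]. simpl INR. rewrite Rmult_1_l. right. f_equal. f_equal. field.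
  - eapply Rle_trans; [apply Step|].
    assert (Q := exp_pos (p * / INR (S (S n)) ^ 2)).
    eapply Rle_trans; [apply Rmult_le_compat_r; [lra|exact IH]|].
    rewrite Rmult_assoc, <- exp_plus.
    apply Rmult_le_compat_l; [apply Rlt_le, real_hyp_coef_pos|].
    (* 1/(x+1)^2 <= 1/x - 1/(x+1), so that the exponents telescope. *)
    assert (M : (p * (2 - / INR (S n)) + p * / INR (S (S n)) ^ 2 <= p * (2 - / INR (S (S n))))%R).
    { rewrite <- Rmult_plus_distr_l. apply Rmult_le_compat_l; [lra|].
      rewrite (S_INR (S n)). assert (P : (0 < INR (S n))%R) by (apply lt_0_INR; lia).
      generalize dependent (INR (S n)). intros x _ P.
      assert (E : (/ x - / (x + 1) - / (x + 1) ^ 2 = / (x * (x + 1) ^ 2))%R) by (field; lra).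
      assert (F : (0 < / (x * (x + 1) ^ 2))%R) by (apply Rinv_0_lt_compat; nra). lra. }
    destruct M as [M|M]; [left; now apply exp_increasing|rewrite M; lra].
Qed.

(** By [scaled_coef_step] the sequence [n A_n] is an infinite product with
    factors [1 + O(1/n^2)], all greater than 1. *)
Lemma scaled_coef_limit : exists c : R, (0 < c)%R /\
    is_lim_seq (fun n => INR (S n) * A (S n))%R c.
Proof.
  destruct (ex_finite_lim_seq_incr (fun n => INR (S n) * A (S n))%R (A 1 * exp (p * 2))%R) as [c Hc].
  - intro n. apply scaled_coef_increasing.
  - assert (G : forall n, (INR (S (S n)) * A (S (S n)) <= A 1 * exp (p * 2))%R).
    { intro n. eapply Rle_trans; [apply scaled_coef_bound|].
      apply Rmult_le_compat_l; [apply Rlt_le, real_hyp_coef_pos|].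
      left. apply exp_increasing. apply Rmult_lt_compat_l; [exact p_pos|].
      assert (P : (0 < / INR (S n))%R) by (apply Rinv_0_lt_compat, lt_0_INR; lia). lra. }
    intro n. eapply Rle_trans; [apply scaled_coef_increasing|apply G].
  - exists c. split; [|exact Hc].
    assert (L : (A 1 <= c)%R).
    { refine (is_lim_seq_le (fun _ => A 1) _ (A 1) c _ (is_lim_seq_const _) Hc).
      intro n. induction n as [|n IH]; [simpl INR; lra|].
      eapply Rle_trans; [exact IH|apply scaled_coef_increasing]. }
    assert (Q := real_hyp_coef_pos 1). lra.
Qed.

End Growth.

Lemma Gamma_product (a b : C) (sigma p : R) : (0 < Re a)%R -> (0 < Re b)%R ->
  a + b = sigma -> a * b = p -> (0 < p)%R ->
  exists c : R, (0 < c)%R /\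
    is_lim_seq (fun n => INR (S n) * real_hyp_coef sigma p (S n))%R c /\
    Gamma a * Gamma b * c = Gamma (a + b).
Proof.
  intros Ha Hb Es Ep Hp.
  assert (Hs : (0 < sigma)%R) by (rewrite <- (re_RtoC sigma), <- Es, re_plus; lra).
  destruct (scaled_coef_limit sigma p Hs Hp) as [c [Hc Lc]].
  exists c. split; [exact Hc|]. split; [exact Lc|].
  apply (Clim_unique (fun n => gamma_approx (S n) (a + b))).
  - assert (L := Clim_mult _ _ _ _ (Clim_mult _ _ _ _ (gamma_approx_lim a Ha) (gamma_approx_lim b Hb))
      (Clim_RtoC _ _ (proj1 (is_lim_seq_incr_1 _ _) Lc))).
    unfold Clim in *. eapply is_lim_seq_ext; [|exact L]. intro n. cbv beta.
    rewrite <- gamma_approx_hyp_coef by assumption.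
    rewrite (hyp_coef_real a b sigma p _ Hs Es Ep), <- RtoC_mult. reflexivity.
  - apply gamma_approx_lim. rewrite re_plus. lra.
Qed.

(** [Gamma 1 = 1] is the limit of [n / (n + 1)]; the product formula with
    [b = 1] propagates non-vanishing along the integers, and any positive [x] is
    a summand of an integer. *)
Lemma Gamma_neq_0 (x : R) : (0 < x)%R -> Gamma x <> 0.
Proof.
  assert (P : forall u v : R, (0 < u)%R -> (0 < v)%R -> exists c : R, (0 < c)%R /\
     Gamma u * Gamma v * c = Gamma (u + v)%R).
  { intros u v Hu Hv.
    destruct (Gamma_product u v (u + v) (u * v)) as [c [Hc [_ E]]];
      rewrite ?re_RtoC; auto; [now rewrite RtoC_plus|now rewrite RtoC_mult|nra|].
    exists c. split; [exact Hc|]. now rewrite RtoC_plus. }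
  assert (G1 : Gamma 1 = 1).
  { apply (Clim_unique (fun n => gamma_approx (S n) 1)).
    - apply gamma_approx_lim. simpl. lra.
    - apply Clim_squeeze with (fun n => 1 / INR (S n))%R.
      + intro n. unfold gamma_approx. rewrite pochhammer_1, Rpower_C_1 by (apply lt_0_INR; lia).
        change (fact (S (S n))) with ((S (S n)) * fact (S n))%nat.
        rewrite mult_INR, (S_INR (S n)).
        assert (Q := INR_fact_lt_0 (S n)).
        assert (R0 : (0 < INR (S n))%R) by (apply lt_0_INR; lia).
        rewrite <- RtoC_mult, <- RtoC_div by nra. rewrite <- RtoC_minus, Cmod_R.
        set (q := INR (fact (S n))) in *. set (r := INR (S n)) in *.
        replace (r * q / ((r + 1) * q) - 1)%R with (- (1 / (r + 1)))%R by (field; nra).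
        rewrite Rabs_Ropp, Rabs_pos_eq by (apply Rdiv_le_0_compat; lra).
        unfold Rdiv. apply Rmult_le_compat_l; [lra|]. apply Rinv_le_contravar; lra.
      + apply (is_lim_seq_incr_1 (fun n => 1 / INR n)%R). apply is_lim_seq_div_INR. }
  assert (GN : forall n, Gamma (INR (S n)) <> 0).
  { induction n as [|n IH].
    - simpl INR. rewrite G1. exact C1_nz.
    - destruct (P (INR (S n)) 1%R) as [c [Hc E]]; [apply lt_0_INR; lia|lra|].
      rewrite (S_INR (S n)), <- E, G1.
      apply Cmult_neq_0; [apply Cmult_neq_0; [exact IH|exact C1_nz]|apply RtoC_neq_0; lra]. }
  intros Hx E0. destruct (nfloor_ex x) as [N [_ HN]]; [lra|].
  destruct (P x (INR (S N) - x)%R Hx) as [c [_ E]]; [rewrite S_INR; lra|].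
  replace (x + (INR (S N) - x))%R with (INR (S N)) in E by ring.
  apply (GN N). rewrite <- E, E0. ring.
Qed.

Lemma Beta_limit (a b : C) (sigma p : R) : (0 < Re a)%R -> (0 < Re b)%R ->
  a + b = sigma -> a * b = p -> (0 < p)%R ->
  exists c : R, (0 < c)%R /\ Beta a b = (/ c)%R /\
    is_lim_seq (fun n => INR (S n) * real_hyp_coef sigma p (S n))%R c.
Proof.
  intros Ha Hb Es Ep Hp.
  destruct (Gamma_product a b sigma p Ha Hb Es Ep Hp) as [c [Hc [L E]]].
  exists c. split; [exact Hc|]. split; [|exact L].
  assert (N : Gamma (a + b) <> 0).
  { rewrite Es. apply Gamma_neq_0. rewrite <- (re_RtoC sigma), <- Es, re_plus. lra. }
  assert (Nc : RtoC c <> 0) by (apply RtoC_neq_0; lra).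
  unfold Beta. rewrite RtoC_inv by lra.
  assert (N' : Gamma a * Gamma b <> 0).
  { intro A. apply N. rewrite <- E, A. ring. }
  rewrite <- E. assert (Na : Gamma a <> 0) by (intro A; apply N'; rewrite A; ring).
  assert (Nb : Gamma b <> 0) by (intro A; apply N'; rewrite A; ring).
  field. auto.
Qed.

(** * Power series with monotone coefficients *)

Definition monotone (w : nat -> R) : Prop :=
  (forall n, w n <= w (S n))%R \/ (forall n, w (S n) <= w n)%R.

(** The increments of a monotone sequence have one sign, so their absolute values
    telescope. *)
Lemma monotone_increments (w : nat -> R) (L : R) : monotone w -> is_lim_seq w L ->
  is_series (fun n => Rabs (w (S n) - w n)) (Rabs (L - w 0%nat)).
Proof.
  intros Hm HL.
  assert (E : forall n, sum_n (fun n => Rabs (w (S n) - w n)) n = Rabs (w (S n) - w 0%nat)).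
  { assert (G : (forall n, w 0%nat <= w n /\ w n <= w (S n))%R \/
                (forall n, w n <= w 0%nat /\ w (S n) <= w n)%R).
    { destruct Hm as [Hm|Hm]; [left|right]; intro n; (split; [|apply Hm]);
        (induction n as [|n IH]; [lra|specialize (Hm n); lra]). }
    induction n as [|n IH]; [now rewrite sum_O|].
    rewrite sum_Sn, IH. change (plus ?x ?y) with (x + y)%R.
    destruct G as [G|G]; assert (G1 := G n); assert (G2 := G (S n)).
    - rewrite !Rabs_pos_eq; lra.
    - rewrite !Rabs_left1; lra. }
  unfold is_series. eapply filterlim_ext; [intro n; symmetry; apply E|].
  apply (is_lim_seq_abs (fun n => w (S n) - w 0%nat)%R (L - w 0%nat)%R).
  apply is_lim_seq_minus'; [now apply (is_lim_seq_incr_1 w)|apply is_lim_seq_const].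
Qed.

Lemma Cpow_sub_le (z w : C) (n : nat) : (Cmod z <= 1)%R -> (Cmod w <= 1)%R ->
  (Cmod (z ^ n - w ^ n) <= INR n * Cmod (z - w))%R.
Proof.
  intros Hz Hw. assert (D := Cmod_ge_0 (z - w)).
  induction n as [|n IH].
  - simpl. replace (1 - 1) with (RtoC 0) by ring. rewrite Cmod_0. lra.
  - replace (z ^ S n - w ^ S n) with (z * (z ^ n - w ^ n) + (z - w) * w ^ n) by (simpl; ring).
    eapply Rle_trans; [apply Cmod_triangle|]. rewrite !Cmod_mult, Cmod_pow, S_INR.
    assert (A := Cmod_ge_0 (z ^ n - w ^ n)). assert (B := Cmod_ge_0 z). assert (B' := Cmod_ge_0 w).
    assert (W : (Cmod w ^ n <= 1)%R) by (rewrite <- (pow1 n); apply pow_incr; lra).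
    nra.
Qed.

Section MonotoneSeries.

Variables (t : nat -> R) (L : R).
Hypothesis t0 : t 0%nat = 1%R.
Hypothesis t_mono : monotone t.
Hypothesis t_lim : is_lim_seq t L.

Lemma monotone_bounded : exists M, forall n, (Rabs (t n) <= M)%R.
Proof.
  exists (Rabs L + 1)%R. intro n. assert (A := Rle_abs L).
  assert (B := Rle_abs (- L)). rewrite Rabs_Ropp in B.
  assert (G : forall k, (t 0%nat <= t k <= L \/ L <= t k <= t 0%nat)%R).
  { intro k. destruct t_mono as [Hm|Hm]; [left|right]; split.
    - induction k as [|k IH]; [lra|]. specialize (Hm k). lra.
    - exact (is_lim_seq_incr_compare t L t_lim Hm k).
    - exact (is_lim_seq_decr_compare t L t_lim Hm k).
    - induction k as [|k IH]; [lra|]. specialize (Hm k). lra. }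
  specialize (G n). rewrite t0 in G. apply Rabs_le. lra.
Qed.

Lemma monotone_converges : converges_on_disc (fun n => t n).
Proof.
  destruct monotone_bounded as [M HM]. apply converges_on_disc_bounded with M.
  intro n. rewrite Cmod_R. apply HM.
Qed.

Definition increment (n : nat) : C := (t (S n) - t n)%R.

Lemma increment_ex_series : ex_series (fun n => Cmod (increment n)).
Proof.
  exists (Rabs (L - t 0%nat)). eapply is_series_ext; [|exact (monotone_increments t L t_mono t_lim)].
  intro n. unfold increment. now rewrite Cmod_R.
Qed.

Lemma monotone_power_sum (u : C) : unit_disc u ->
  (1 - u) * power_sum (fun n => t n) u = 1 + CSeries (fun n => increment n * u ^ S n).
Proof.
  intro Hu. assert (S := summable_power _ u monotone_converges Hu).
  assert (S1 := proj1 (summable_shift _) S).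
  assert (Su := summable_scal u _ S).
  assert (E : CSeries (fun n => increment n * u ^ Datatypes.S n) =
     CSeries (fun n => t (Datatypes.S n) * u ^ Datatypes.S n) - u * power_sum (fun n => t n) u).
  { unfold power_sum. rewrite <- (CSeries_scal u _ S), <- CSeries_minus by assumption.
    apply CSeries_ext. intro n. unfold increment. rewrite RtoC_minus. simpl. ring. }
  rewrite E. unfold power_sum at 1. rewrite (CSeries_shift _ S).
  unfold power_sum. rewrite (CSeries_shift _ S), t0. simpl (u ^ 0). ring.
Qed.

Lemma monotone_power_sum_near_1 (u : C) : unit_disc u ->
  (Cmod ((1 - u) * power_sum (fun n => t n) u - 1) <= Rabs (L - 1) * Cmod u)%R.
Proof.
  intro Hu. rewrite monotone_power_sum by exact Hu.
  replace (1 + CSeries (fun n => increment n * u ^ S n) - 1)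
    with (CSeries (fun n => increment n * u ^ S n)) by ring.
  assert (H := monotone_increments t L t_mono t_lim). rewrite t0 in H.
  rewrite <- (is_series_unique _ _ H), Rmult_comm, <- Series_scal_l.
  apply Cmod_CSeries_le.
  - intro n. unfold increment. rewrite Cmod_mult, Cmod_R, Cmod_pow, Rmult_comm.
    apply Rmult_le_compat_r; [apply Rabs_pos|]. simpl.
    assert (A := Cmod_ge_0 u). unfold unit_disc in Hu.
    assert (W : (Cmod u ^ n <= 1)%R) by (rewrite <- (pow1 n); apply pow_incr; lra). nra.
  - apply (ex_series_scal (V := R_NormedModule)). eexists. exact H.
Qed.

(** Unlike in Abel's theorem the approach to 1 is not restricted to a sector,
    because after summation by parts the series converges absolutely up to the
    boundary. *)
Lemma monotone_power_sum_limit (eps : R) : (0 < eps)%R -> exists d, (0 < d)%R /\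
  forall u, unit_disc u -> (Cmod (u - 1) < d)%R ->
  (Cmod ((1 - u) * power_sum (fun n => t n) u - L) < eps)%R.
Proof.
  intro He.
  assert (H := monotone_increments t L t_mono t_lim).
  assert (He4 : (0 < eps / 4)%R) by lra.
  assert (Ht := t_lim). apply is_lim_seq_spec in Ht.
  destruct (Ht (mkposreal _ He4)) as [N HN]. clear Ht.
  specialize (HN N (Nat.le_refl N)). simpl in HN.
  (* The sequence frozen before N is monotone with the same limit, so the
     telescoping sum of its increments is the tail to be made small. *)
  set (w := fun n => t (Nat.max n N)).
  assert (Hw : is_series (fun n => Rabs (w (S n) - w n)) (Rabs (L - t N))).
  { change (t N) with (w 0%nat). apply monotone_increments.
    - destruct t_mono as [Hm|Hm]; [left|right]; intro n; unfold w;
        (destruct (Nat.le_gt_cases N n);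
          [replace (Nat.max (S n) N) with (S (Nat.max n N)) by lia; apply Hm
          |replace (Nat.max (S n) N) with (Nat.max n N) by lia; lra]).
    - apply (is_lim_seq_ext_loc t); [|exact t_lim].
      exists N. intros n Hn. unfold w. now rewrite Nat.max_l by exact Hn. }
  set (r := Rabs (L - 1)). assert (Hr : (0 <= r)%R) by apply Rabs_pos.
  rewrite t0 in H. fold r in H.
  assert (PN := pos_INR N).
  exists (eps / 4 / (INR N * r + 1))%R. split; [apply Rdiv_lt_0_compat; nra|].
  intros u Hu Hd. assert (Hu' := Hu). unfold unit_disc in Hu'.
  rewrite monotone_power_sum by exact Hu.
  assert (Sinc : summable increment) by exact increment_ex_series.
  assert (EL : CSeries increment = L - 1).
  { rewrite <- RtoC_minus. unfold increment.
    assert (Hs : is_series (fun n => t (S n) - t n)%R (L - 1)%R).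
    { unfold is_series. apply filterlim_ext with (fun n => t (S n) - 1)%R.
      - intro n. induction n as [|n IH]; [now rewrite sum_O, t0|].
        rewrite sum_Sn, <- IH. change (plus ?x ?y) with (x + y)%R. ring.
      - apply is_lim_seq_minus'; [now apply (is_lim_seq_incr_1 t)|apply is_lim_seq_const]. }
    unfold CSeries. apply C_ext; simpl.
    - now apply is_series_unique.
    - rewrite Series_zero. ring. }
  assert (Su : summable (fun n => increment n * u ^ S n)).
  { apply (summable_le _ (fun n => Cmod (increment n))); [|exact Sinc].
    intro n. rewrite Cmod_mult, Cmod_pow.
    assert (A := Cmod_ge_0 (increment n)).
    assert (W : (Cmod u ^ S n <= 1)%R) by (rewrite <- (pow1 (S n)); apply pow_incr; split; [apply Cmod_ge_0|lra]).
    nra. }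
  replace (1 + CSeries (fun n => increment n * u ^ S n) - L)
    with (CSeries (fun n => increment n * u ^ S n) - CSeries increment) by (rewrite EL; ring).
  rewrite <- CSeries_minus by assumption.
  set (eta := Cmod (u - 1)) in *. assert (Heta : (0 <= eta)%R) by apply Cmod_ge_0.
  eapply Rle_lt_trans.
  - apply (Cmod_CSeries_le _ (fun n => INR N * eta * Rabs (t (S n) - t n) + 2 * Rabs (w (S n) - w n))%R).
    + intro n. replace (increment n * u ^ S n - increment n) with (increment n * (u ^ S n - 1 ^ S n)).
      2:{ rewrite Cpow_1_l. ring. }
      rewrite Cmod_mult. unfold increment at 1. rewrite Cmod_R.
      assert (A := Rabs_pos (t (S n) - t n)).
      destruct (Nat.lt_ge_cases n N) as [L1|L1].
      * assert (B := Cpow_sub_le u 1 (S n) ltac:(lra) ltac:(rewrite Cmod_1; lra)). fold eta in B.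
        assert (D := le_INR (S n) N L1). assert (F := Rabs_pos (w (S n) - w n)).
        assert (G : (INR (S n) * eta <= INR N * eta)%R) by (apply Rmult_le_compat_r; lra). nra.
      * unfold w. rewrite !Nat.max_l by lia.
        assert (B : (Cmod (u ^ S n - 1 ^ S n) <= 2)%R).
        { eapply Rle_trans; [apply Cmod_minus_triangle|]. rewrite Cpow_1_l, Cmod_1, Cmod_pow.
          assert (W : (Cmod u ^ S n <= 1)%R) by (rewrite <- (pow1 (S n)); apply pow_incr; split; [apply Cmod_ge_0|lra]).
          lra. }
        assert (Q : (0 <= INR N * eta * Rabs (t (S n) - t n))%R) by (repeat apply Rmult_le_pos; lra).
        nra.
    + apply (ex_series_plus (V := R_NormedModule)); apply (ex_series_scal (V := R_NormedModule));
        eexists; eassumption.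
  - rewrite Series_plus, !Series_scal_l, (is_series_unique _ _ H), (is_series_unique _ _ Hw).
    + rewrite Rabs_minus_sym in HN.
      assert (E : (INR N * eta * r <= eps / 4)%R).
      { assert (F : ((INR N * r + 1) * (eps / 4 / (INR N * r + 1)) = eps / 4)%R) by (field; nra).
        assert (K : (0 <= INR N * r)%R) by nra. nra. }
      lra.
    + apply (ex_series_scal (V := R_NormedModule)). eexists; eassumption.
    + apply (ex_series_scal (V := R_NormedModule)). eexists; eassumption.
Qed.

End MonotoneSeries.

(** * Operations on coefficient sequences *)

(** The partial sums of even index on the left are the partial sums on the right. *)
Lemma Series_even (b : nat -> R) : ex_series b -> (forall k, b (S (2 * k)) = 0%R) ->
  Series b = Series (fun k => b (2 * k)%nat).
Proof.
  intros [l Hl] Hodd. rewrite (is_series_unique _ _ Hl). symmetry. apply is_series_unique.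
  assert (E : forall n, sum_n (fun k => b (2 * k)%nat) n = sum_n b (2 * n)).
  { induction n as [|n IH]; [now rewrite !sum_O|].
    replace (2 * S n)%nat with (S (S (2 * n))) by lia.
    rewrite !sum_Sn, IH, Hodd. replace (2 * S n)%nat with (S (S (2 * n))) by lia.
    apply (f_equal2 Rplus); [symmetry; apply Rplus_0_r|reflexivity]. }
  unfold is_series. eapply filterlim_ext; [intro n; symmetry; apply E|].
  apply (is_lim_seq_subseq (sum_n b) l (fun n => 2 * n)%nat); [|exact Hl].
  apply eventually_subseq. intro n. lia.
Qed.

Lemma power_sum_coef_sq (c : nat -> C) (z : C) :
  converges_on_disc (coef_sq c) -> unit_disc z ->
  power_sum (coef_sq c) z = power_sum c (z ^ 2).
Proof.
  intros Hc Hz. assert (S0 := summable_power _ z Hc Hz).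
  assert (Eo : forall k, coef_sq c (S (2 * k)) = 0).
  { intro k. unfold coef_sq. replace (Nat.even (S (2 * k))) with false; [reflexivity|].
    symmetry. rewrite Nat.even_succ. rewrite Nat.odd_mul. reflexivity. }
  assert (Ee : forall k, coef_sq c (2 * k) = c k).
  { intro k. unfold coef_sq. rewrite Nat.even_mul. simpl orb.
    now rewrite Nat.div2_double. }
  unfold power_sum, CSeries. f_equal; rewrite Series_even.
  - apply Series_ext. intro k. now rewrite Ee, Cpow_mult_r.
  - now apply summable_Re.
  - intro k. rewrite Eo. simpl. ring.
  - apply Series_ext. intro k. now rewrite Ee, Cpow_mult_r.
  - now apply summable_Im.
  - intro k. rewrite Eo. simpl. ring.
Qed.

Definition shift_coef (k : nat) (c : nat -> C) (n : nat) : C :=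
  if Nat.ltb n k then 0 else c (n - k)%nat.

Lemma power_sum_shift (k : nat) (c : nat -> C) (z : C) :
  converges_on_disc c -> unit_disc z ->
  summable (fun n => shift_coef k c n * z ^ n) /\
  power_sum (shift_coef k c) z = z ^ k * power_sum c z.
Proof.
  intros Hc Hz. assert (S0 := summable_power _ z Hc Hz).
  assert (E0 : forall n, shift_coef 0 c n = c n).
  { intro n. unfold shift_coef. simpl. now rewrite Nat.sub_0_r. }
  assert (ES : forall j n, shift_coef (S j) c (S n) = shift_coef j c n) by reflexivity.
  induction k as [|k [IH1 IH2]].
  - split.
    + unfold summable. eapply ex_series_ext; [|exact S0]. intro n. now rewrite E0.
    + unfold power_sum. simpl. rewrite Cmult_1_l. apply CSeries_ext. intro n. now rewrite E0.
  - assert (S1 : summable (fun n => shift_coef (S k) c n * z ^ n)).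
    { apply summable_shift. unfold summable.
      eapply ex_series_ext; [|exact (summable_scal z _ IH1)].
      intro n. simpl. f_equal. rewrite ES. simpl. ring. }
    split; [exact S1|]. unfold power_sum at 1. rewrite CSeries_shift by exact S1.
    rewrite (CSeries_ext _ (fun n => z * (shift_coef k c n * z ^ n))).
    + rewrite CSeries_scal by exact IH1. fold (power_sum (shift_coef k c) z). rewrite IH2.
      unfold shift_coef. simpl. ring.
    + intro n. rewrite ES. simpl. ring.
Qed.

Definition bounded_coef (c : nat -> C) : Prop := exists M, forall n, (Cmod (c n) <= M)%R.

Lemma bounded_converges c : bounded_coef c -> converges_on_disc c.
Proof. intros [M H]. now apply converges_on_disc_bounded with M. Qed.

Lemma bounded_coef_sq c : bounded_coef c -> bounded_coef (coef_sq c).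
Proof.
  intros [M H]. exists M. intro n. unfold coef_sq. destruct (Nat.even n); [apply H|].
  rewrite Cmod_0. eapply Rle_trans; [apply Cmod_ge_0|apply (H 0%nat)].
Qed.

Lemma bounded_shift k c : bounded_coef c -> bounded_coef (shift_coef k c).
Proof.
  intros [M H]. exists M. intro n. unfold shift_coef. destruct (Nat.ltb n k); [|apply H].
  rewrite Cmod_0. eapply Rle_trans; [apply Cmod_ge_0|apply (H 0%nat)].
Qed.

Lemma bounded_scal k c : bounded_coef c -> bounded_coef (fun n => k * c n).
Proof.
  intros [M H]. exists (Cmod k * M)%R. intro n. rewrite Cmod_mult.
  apply Rmult_le_compat_l; [apply Cmod_ge_0|apply H].
Qed.

Lemma bounded_plus c d : bounded_coef c -> bounded_coef d -> bounded_coef (fun n => c n + d n).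
Proof.
  intros [M H] [M' H']. exists (M + M')%R. intro n.
  eapply Rle_trans; [apply Cmod_triangle|]. apply Rplus_le_compat; auto.
Qed.

Lemma power_sum_ext (c d : nat -> C) z : (forall n, c n = d n) -> power_sum c z = power_sum d z.
Proof. intro H. apply CSeries_ext. intro n. now rewrite H. Qed.

Lemma power_sum_scal k (c : nat -> C) z : converges_on_disc c -> unit_disc z ->
  power_sum (fun n => k * c n) z = k * power_sum c z.
Proof.
  intros Hc Hz. unfold power_sum. rewrite <- CSeries_scal by now apply summable_power.
  apply CSeries_ext. intro n. ring.
Qed.

Lemma power_sum_plus (c d : nat -> C) z : converges_on_disc c -> converges_on_disc d -> unit_disc z ->
  power_sum (fun n => c n + d n) z = power_sum c z + power_sum d z.
Proof.
  intros Hc Hd Hz. unfold power_sum. rewrite <- CSeries_plus by now apply summable_power.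
  apply CSeries_ext. intro n. ring.
Qed.

Lemma power_sum_0 (c : nat -> C) : power_sum c 0 = c 0%nat.
Proof.
  assert (E : forall n, c (S n) * 0 ^ S n = 0) by (intro; simpl; ring).
  unfold power_sum. rewrite CSeries_shift.
  - rewrite (CSeries_ext _ (fun _ => 0)) by exact E.
    replace (CSeries (fun _ => 0)) with (RtoC 0); [simpl; ring|].
    unfold CSeries. simpl. now rewrite Series_zero.
  - apply summable_shift. apply (summable_le _ (fun _ => (0 * 0)%R)).
    + intro n. rewrite E, Cmod_0. lra.
    + exists (0 * 0)%R. apply (is_series_scal (V := R_NormedModule) 0%R (fun _ => 0%R)).
      unfold is_series. apply filterlim_ext with (fun _ => 0%R); [|apply is_lim_seq_const].
      intro n. induction n as [|n IH]; [now rewrite sum_O|].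
      rewrite sum_Sn, <- IH. change (plus ?x ?y) with (x + y)%R. ring.
Qed.

(** * Harmonic mappings [h + conj g] with power series [h] and [g] *)

(** [Re f] is the real part of [h + g] and [Im f] that of [- i (h - g)]. *)
Lemma harmonic_of_power_sums (f : C -> C) (p q : nat -> C) :
  bounded_coef p -> bounded_coef q ->
  (forall z, unit_disc z -> f z = power_sum p z + Cconj (power_sum q z)) ->
  harmonic f.
Proof.
  intros Hp Hq Ef. split.
  - apply real_part_harmonic with (fun n => p n + q n).
    + now apply bounded_converges, bounded_plus.
    + intros z Hz. rewrite Ef, power_sum_plus by auto using bounded_converges.
      rewrite !re_plus, re_conj. reflexivity.
  - apply real_part_harmonic with (fun n => - Ci * p n + Ci * q n).
    + apply bounded_converges, bounded_plus; now apply bounded_scal.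
    + intros z Hz. rewrite Ef, power_sum_plus, !power_sum_scal by auto using bounded_converges, bounded_scal.
      simpl. unfold Re, Im. ring.
Qed.

Lemma wirtinger_derivatives (f h g h1 g1 : C -> C) :
  (forall z, unit_disc z -> f z = h z + Cconj (g z)) ->
  (forall z, unit_disc z -> is_C_derive h z (h1 z)) ->
  (forall z, unit_disc z -> is_C_derive g z (g1 z)) ->
  forall z, unit_disc z -> d_z f z = h1 z /\ d_zbar f z = Cconj (g1 z).
Proof.
  intros Ef Dh Dg z Hz.
  destruct (real_part_partials (fun w => Re (f w)) (fun w => h w + g w) (fun w => h1 w + g1 w)) with (z := z)
    as [A B]; auto.
  { intros w Hw. rewrite Ef by exact Hw. now rewrite !re_plus, re_conj. }
  { intros w Hw. apply is_C_derive_plus; auto. }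
  destruct (real_part_partials (fun w => Im (f w)) (fun w => - Ci * h w + Ci * g w)
    (fun w => - Ci * h1 w + Ci * g1 w)) with (z := z) as [A' B']; auto.
  { intros w Hw. rewrite Ef by exact Hw. simpl. unfold Re, Im. ring. }
  { intros w Hw. apply is_C_derive_plus; apply is_C_derive_scal; auto. }
  apply is_derive_unique in A, B, A', B'.
  change (pd_x (fun w => Re (f w)) z = Re (h1 z + g1 z)) in A.
  change (pd_y (fun w => Re (f w)) z = Re (Ci * (h1 z + g1 z))) in B.
  change (pd_x (fun w => Im (f w)) z = Re (- Ci * h1 z + Ci * g1 z)) in A'.
  change (pd_y (fun w => Im (f w)) z = Re (Ci * (- Ci * h1 z + Ci * g1 z))) in B'.
  unfold d_z, d_zbar, d_x, d_y. rewrite A, B, A', B'.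
  split; apply C_ext; simpl; unfold Re, Im; field.
Qed.

(** * Limits at boundary points *)

Lemma tends_to_const z0 k : tends_to (fun _ => k) z0 k.
Proof.
  intros eps He. exists 1%R. split; [lra|]. intros z _ _.
  replace (k - k) with (RtoC 0) by ring. now rewrite Cmod_0.
Qed.

Lemma tends_to_plus P Q z0 k l : tends_to P z0 k -> tends_to Q z0 l ->
  tends_to (fun z => P z + Q z) z0 (k + l).
Proof.
  intros HP HQ eps He. destruct (HP (eps / 2)%R) as [d1 [D1 H1]]; [lra|].
  destruct (HQ (eps / 2)%R) as [d2 [D2 H2]]; [lra|].
  exists (Rmin d1 d2). split; [now apply Rmin_glb_lt|]. intros z Hz Hd.
  assert (M1 := Rmin_l d1 d2). assert (M2 := Rmin_r d1 d2).
  replace (P z + Q z - (k + l)) with ((P z - k) + (Q z - l)) by ring.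
  eapply Rle_lt_trans; [apply Cmod_triangle|].
  specialize (H1 z Hz ltac:(lra)). specialize (H2 z Hz ltac:(lra)). lra.
Qed.

Lemma tends_to_mult P Q z0 k l : tends_to P z0 k -> tends_to Q z0 l ->
  tends_to (fun z => P z * Q z) z0 (k * l).
Proof.
  intros HP HQ eps He.
  assert (K := Cmod_ge_0 k). assert (L := Cmod_ge_0 l).
  destruct (HP (eps / 2 / (Cmod l + 1))%R) as [d1 [D1 H1]]; [apply Rdiv_lt_0_compat; lra|].
  destruct (HQ (Rmin 1 (eps / 2 / (Cmod k + 1)))%R) as [d2 [D2 H2]].
  { apply Rmin_glb_lt; [lra|apply Rdiv_lt_0_compat; lra]. }
  exists (Rmin d1 d2). split; [now apply Rmin_glb_lt|]. intros z Hz Hd.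
  assert (M1 := Rmin_l d1 d2). assert (M2 := Rmin_r d1 d2).
  specialize (H1 z Hz ltac:(lra)). specialize (H2 z Hz ltac:(lra)).
  assert (N1 := Rmin_l 1 (eps / 2 / (Cmod k + 1))). assert (N2 := Rmin_r 1 (eps / 2 / (Cmod k + 1))).
  replace (P z * Q z - k * l) with ((P z - k) * Q z + k * (Q z - l)) by ring.
  eapply Rle_lt_trans; [apply Cmod_triangle|]. rewrite !Cmod_mult.
  assert (B := Cmod_triangle_rev (Q z) l).
  assert (C1 := Cmod_ge_0 (P z - k)). assert (C2 := Cmod_ge_0 (Q z - l)). assert (C3 := Cmod_ge_0 (Q z)).
  assert (E1 : ((Cmod l + 1) * (eps / 2 / (Cmod l + 1)) = eps / 2)%R) by (field; lra).
  assert (E2 : ((Cmod k + 1) * (eps / 2 / (Cmod k + 1)) = eps / 2)%R) by (field; lra).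
  assert (F1 : (Cmod (P z - k) * Cmod (Q z) < eps / 2)%R).
  { apply Rle_lt_trans with (Cmod (P z - k) * (Cmod l + 1))%R; [apply Rmult_le_compat_l; lra|]. nra. }
  assert (F2 : (Cmod k * Cmod (Q z - l) <= eps / 2)%R) by nra.
  lra.
Qed.

Lemma tends_to_pow z0 n : tends_to (fun z => z ^ n) z0 (z0 ^ n).
Proof.
  induction n as [|n IH]; [exact (tends_to_const z0 1)|].
  apply (tends_to_mult (fun z => z) (fun z => z ^ n)); [|exact IH].
  intros eps He. exists eps. split; [exact He|]. auto.
Qed.

(** * The coefficients of the shear *)

(** [(2, k) / (1, k) = k + 1], and [(m+1, k) / (m+2, k)] telescopes. *)
Lemma hyp_coef_2_kernel (m k : nat) :
  hyp_coef 2 (INR (m + 1)) (INR (m + 2)) k = (INR (S k) * INR (m + 1) / INR (m + 1 + k))%R.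
Proof.
  assert (Pm := pos_INR m).
  assert (N1 : forall k, pochhammer 1 k <> 0) by (intro; apply pochhammer_neq_0; simpl; lra).
  assert (N2 : forall k, pochhammer (INR (m + 2)) k <> 0).
  { intro. apply pochhammer_neq_0. rewrite re_RtoC. apply lt_0_INR. lia. }
  induction k as [|k IH].
  - unfold hyp_coef. simpl pochhammer. rewrite Nat.add_0_r.
    assert (Q : (0 < INR (m + 1))%R) by (apply lt_0_INR; lia).
    replace (INR 1 * INR (m + 1) / INR (m + 1))%R with 1%R by (simpl; field; lra). field.
  - assert (E : hyp_coef 2 (INR (m + 1)) (INR (m + 2)) (S k) = hyp_coef 2 (INR (m + 1)) (INR (m + 2)) k *
       (((2 + INR k) * (INR (m + 1) + INR k)) / ((INR (m + 2) + INR k) * (1 + INR k)))%R).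
    { unfold hyp_coef.
      change (pochhammer 2 (S k)) with (pochhammer 2 k * (2 + INR k)).
      change (pochhammer (INR (m + 1)) (S k)) with (pochhammer (INR (m + 1)) k * (INR (m + 1) + INR k)).
      change (pochhammer (INR (m + 2)) (S k)) with (pochhammer (INR (m + 2)) k * (INR (m + 2) + INR k)).
      change (pochhammer 1 (S k)) with (pochhammer 1 k * (1 + INR k)).
      assert (Pk := pos_INR k). assert (P2 := pos_INR (m + 2)).
      assert (P2' : (0 < INR (m + 2))%R) by (apply lt_0_INR; lia).
      assert (M1 := N1 k). assert (M2 := N2 k).
      rewrite RtoC_div by nra. rewrite !RtoC_mult, !RtoC_plus. field.
      repeat split; auto; rewrite <- RtoC_plus; apply RtoC_neq_0; lra. }
    rewrite E, IH, <- RtoC_mult. f_equal.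
    replace (m + 1 + S k)%nat with (S (S (m + k))) by lia.
    replace (m + 1 + k)%nat with (S (m + k)) by lia.
    replace (m + 1)%nat with (S m) by lia. replace (m + 2)%nat with (S (S m)) by lia.
    rewrite !S_INR, plus_INR. assert (Pk := pos_INR k). field. lra.
Qed.

(** The increment is a positive multiple of [(2p - 1) n + (3p - sigma)], whose sign
    does not depend on [n] when [2p - 1] and [3p - sigma] have the same sign. *)
Lemma odd_coef_monotone (sigma p : R) : (0 < sigma)%R -> (0 < p)%R ->
  let t := fun n => (INR (2 * n + 1) * real_hyp_coef sigma p n)%R in
  ((p <= 1 / 2 /\ p <= sigma / 3)%R -> forall n, (t (S n) <= t n)%R) /\
  ((1 / 2 <= p /\ sigma / 3 <= p)%R -> forall n, (t n <= t (S n))%R).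
Proof.
  intros Hs Hp t.
  assert (E : forall n, (t (S n) - t n = real_hyp_coef sigma p n / ((sigma + INR n) * (1 + INR n)) *
       ((2 * p - 1) * INR n + (3 * p - sigma)))%R).
  { intro n. unfold t.
    change (real_hyp_coef sigma p (S n)) with (real_hyp_coef sigma p n
      * ((INR n ^ 2 + sigma * INR n + p) / ((sigma + INR n) * (1 + INR n))))%R.
    rewrite !plus_INR, !mult_INR, (S_INR n). simpl (INR 2). simpl (INR 1). assert (Pn := pos_INR n).
    field. lra. }
  assert (Q : forall n, (0 < real_hyp_coef sigma p n / ((sigma + INR n) * (1 + INR n)))%R).
  { intro n. assert (Pn := pos_INR n). apply Rdiv_lt_0_compat; [now apply real_hyp_coef_pos|nra]. }
  split; intros H n; specialize (E n); specialize (Q n); assert (Pn := pos_INR n).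
  - assert (B : ((2 * p - 1) * INR n + (3 * p - sigma) <= 0)%R) by nra. nra.
  - assert (B : (0 <= (2 * p - 1) * INR n + (3 * p - sigma))%R) by nra. nra.
Qed.

Lemma odd_coef_limit (sigma p c : R) : (0 < sigma)%R -> (0 < p)%R ->
  is_lim_seq (fun n => INR (S n) * real_hyp_coef sigma p (S n))%R c ->
  is_lim_seq (fun n => INR (2 * n + 1) * real_hyp_coef sigma p n)%R (2 * c)%R.
Proof.
  intros Hs Hp Hc. apply is_lim_seq_incr_1.
  apply is_lim_seq_ext with
    (fun n => 2 * (INR (S n) * real_hyp_coef sigma p (S n)) + (INR (S n) * real_hyp_coef sigma p (S n)) * (1 / INR (S n)))%R.
  { intro n. rewrite plus_INR, mult_INR. simpl (INR 2). simpl (INR 1).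
    assert (P : (0 < INR (S n))%R) by (apply lt_0_INR; lia). field. lra. }
  replace (2 * c)%R with (2 * c + c * 0)%R by ring.
  apply is_lim_seq_plus'; apply is_lim_seq_mult'; try exact Hc.
  - apply is_lim_seq_const.
  - apply (is_lim_seq_incr_1 (fun n => 1 / INR n)%R). apply is_lim_seq_div_INR.
Qed.

(** With [rho = |z|], [|alpha z^m T| <= rho (1 - r)], while [Re T >= 1 - r rho^2];
    the difference is at least [(1 - rho) (1 + r rho) > 0], also when [r = 1]. *)
Lemma sheared_disc (alpha T z : C) (r : R) (m : nat) :
  unit_disc z -> (1 <= m)%nat -> (0 <= r)%R ->
  (Cmod alpha * (1 + r) <= 1 - r)%R -> (Cmod (T - 1) <= r * Cmod (z ^ 2))%R ->
  (Cmod (alpha * z ^ m * T) < Re T)%R.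
Proof.
  unfold unit_disc. intros Hz Hm Hr Ha HT.
  rewrite Cmod_pow in HT. set (rho := Cmod z) in *. assert (R0 : (0 <= rho)%R) by apply Cmod_ge_0.
  assert (A0 := Cmod_ge_0 alpha).
  assert (B := re_le_Cmod (T - 1)). rewrite Re_minus, re_RtoC in B.
  assert (B' := Rle_abs (- (Re T - 1))). rewrite Rabs_Ropp in B'.
  assert (D := Cmod_triangle_rev T 1). rewrite Cmod_1 in D.
  rewrite !Cmod_mult, Cmod_pow. fold rho.
  assert (Pm : (0 <= rho ^ m <= rho)%R).
  { split; [now apply pow_le|]. destruct m as [|m]; [lia|]. simpl.
    assert (W : (rho ^ m <= 1)%R) by (rewrite <- (pow1 m); apply pow_incr; lra).
    assert (W' : (0 <= rho ^ m)%R) by now apply pow_le. nra. }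
  assert (Q1 : (rho ^ 2 <= 1)%R) by (simpl; nra).
  assert (Q : (r * rho ^ 2 <= r)%R) by nra.
  assert (T0 := Cmod_ge_0 T).
  assert (X : (Cmod alpha * rho ^ m * Cmod T <= rho * (1 - r))%R).
  { replace (Cmod alpha * rho ^ m * Cmod T)%R with (rho ^ m * (Cmod alpha * Cmod T))%R by ring.
    apply Rle_trans with (rho ^ m * (1 - r))%R.
    - apply Rmult_le_compat_l; [lra|]. nra.
    - apply Rmult_le_compat_r; nra. }
  assert (Y : (0 < (1 - rho) * (1 + r * rho))%R) by (apply Rmult_lt_0_compat; nra).
  simpl in *. nra.
Qed.

(** The only point of the closed unit disc with real part at most -1 is -1. *)
Lemma boundary_value_cases (L : R) (alpha w : C) : (0 < L)%R -> (Cmod alpha <= 1)%R -> Cmod w = 1%R ->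
  (0 < Re (L * (1 + alpha * w)))%R \/ L * (1 + alpha * w) = 0.
Proof.
  intros HL Ha Hw. set (b := alpha * w).
  assert (Hb : (Cmod b <= 1)%R) by (unfold b; rewrite Cmod_mult, Hw; lra).
  assert (A := Cmod2_alt b). assert (B := Cmod_ge_0 b).
  rewrite re_scal_l, re_plus, re_RtoC.
  destruct (Rlt_le_dec (-1) (Re b)) as [H|H]; [left; nra|right].
  assert (E1 : Re b = (-1)%R) by nra. assert (E2 : Im b = 0%R) by nra.
  replace b with (- (1)); [ring|]. apply C_ext; [rewrite E1|rewrite E2]; simpl; ring.
Qed.

(** The derivatives are [h' = psi (z^2)] and [g' = alpha z^m psi (z^2)], where
    [psi] has the monotone coefficients [t].  Hence [(1 - z^2) h'] stays in the
    disc of radius [|L - 1| |z|^2] about 1, which gives the inequality defining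
    the class, and [(1 - z^2) (h' + g')] tends to [L (1 + alpha z0^m)] at
    [z0 = 1] and [z0 = -1], which gives the convexity. *)
Lemma shear_of_monotone_coef (f : C -> C) (p q : nat -> C) (t : nat -> R) (L : R)
    (alpha : C) (m : nat) :
  t 0%nat = 1%R -> monotone t -> is_lim_seq t L -> (0 < L)%R ->
  (1 <= m)%nat -> (Cmod alpha * (1 + Rabs (L - 1)) <= 1 - Rabs (L - 1))%R ->
  bounded_coef p -> bounded_coef q -> p 0%nat = 0 -> q 0%nat = 0 ->
  (forall n, derive_coef p n = coef_sq (fun k => t k) n) ->
  (forall n, derive_coef q n = alpha * shift_coef m (coef_sq (fun k => t k)) n) ->
  (forall z, unit_disc z -> f z = power_sum p z + Cconj (power_sum q z)) ->
  class_F2 f /\ convex_vertical f /\ has_dilatation f (fun z => alpha * z ^ m).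
Proof.
  intros t0 tmono tL HL Hm Halpha Bp Bq p0 q0 Ep Eq Ef.
  assert (Hr := Rabs_pos (L - 1)).
  assert (Halpha1 : (Cmod alpha <= 1)%R) by (assert (Al := Cmod_ge_0 alpha); nra).
  set (tc := fun k => RtoC (t k)) in *.
  assert (Btc : bounded_coef tc).
  { destruct (monotone_bounded t L t0 tmono tL) as [M HM]. exists M. intro n.
    unfold tc. rewrite Cmod_R. apply HM. }
  set (psi := fun z => power_sum tc (z ^ 2)).
  assert (Dp : forall z, unit_disc z -> is_C_derive (power_sum p) z (psi z)).
  { intros z Hz. unfold psi.
    rewrite <- power_sum_coef_sq by (auto using bounded_converges, bounded_coef_sq).
    rewrite <- (power_sum_ext _ _ z Ep).
    apply power_sum_derive; [now apply bounded_converges|exact Hz]. }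
  assert (Dq : forall z, unit_disc z -> is_C_derive (power_sum q) z (alpha * z ^ m * psi z)).
  { intros z Hz. unfold psi.
    rewrite <- power_sum_coef_sq, <- Cmult_assoc by (auto using bounded_converges, bounded_coef_sq).
    rewrite <- (proj2 (power_sum_shift m _ z (bounded_converges _ (bounded_coef_sq _ Btc)) Hz)).
    rewrite <- power_sum_scal by (auto using bounded_converges, bounded_shift, bounded_coef_sq).
    rewrite <- (power_sum_ext _ _ z Eq).
    apply power_sum_derive; [now apply bounded_converges|exact Hz]. }
  assert (Hz2 : forall z, unit_disc z -> unit_disc (z ^ 2)).
  { intros z Hz. unfold unit_disc in *. rewrite Cmod_pow. assert (Q := Cmod_ge_0 z). simpl. nra. }
  assert (Key : forall z, unit_disc z ->
    (Cmod ((1 - z ^ 2) * (alpha * z ^ m * psi z)) < Re ((1 - z ^ 2) * psi z))%R).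
  { intros z Hz.
    replace ((1 - z ^ 2) * (alpha * z ^ m * psi z)) with (alpha * z ^ m * ((1 - z ^ 2) * psi z)) by ring.
    apply sheared_disc with (Rabs (L - 1)); auto.
    apply (monotone_power_sum_near_1 t L t0 tmono tL). auto. }
  assert (psi_ne : forall z, unit_disc z -> psi z <> 0).
  { intros z Hz E. assert (K := Key z Hz). rewrite E in K.
    replace ((1 - z ^ 2) * 0) with (RtoC 0) in K by ring.
    assert (Q := Cmod_ge_0 ((1 - z ^ 2) * (alpha * z ^ m * 0))). rewrite re_RtoC in K. lra. }
  assert (Hharm : harmonic f) by exact (harmonic_of_power_sums f p q Bp Bq Ef).
  assert (Hparts : canonical_parts f (power_sum p) (power_sum q)).
  { split; [|exact Ef]. exists p, q. repeat split; auto.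
    - assert (E := Ep 0%nat). unfold derive_coef, coef_sq, tc in E. simpl in E.
      rewrite t0, Cmult_1_l in E. exact E.
    - apply power_sum_is_pseries; [now apply bounded_converges|assumption].
    - apply power_sum_is_pseries; [now apply bounded_converges|assumption]. }
  assert (HD : unit_disc 0) by (unfold unit_disc; rewrite Cmod_0; lra).
  assert (Wd := wirtinger_derivatives f _ _ _ _ Ef Dp Dq).
  split; [split|split].
  - split; [exact Hharm|]. split; [|split].
    + rewrite Ef, !power_sum_0, p0, q0 by exact HD. apply C_ext; simpl; ring.
    + rewrite (proj1 (Wd 0 HD)). unfold psi. replace (0 ^ 2) with (RtoC 0) by ring.
      rewrite power_sum_0. unfold tc. now rewrite t0.
    + eexists. eexists. exact Hparts.
  - intros z Hz. destruct (Wd z Hz) as [-> ->]. rewrite Cmod_mult, Cmod_conj, <- Cmod_mult.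
    apply Rlt_gt, Key, Hz.
  - assert (Lim : forall z0 : C, (z0 = 1 \/ z0 = - (1)) ->
      tends_to (fun z => (1 - z ^ 2) * (psi z + alpha * z ^ m * psi z)) z0 (L * (1 + alpha * z0 ^ m))).
    { intros z0 Hz0. assert (E0 : z0 ^ 2 = 1) by (destruct Hz0 as [->| ->]; ring).
      assert (TS : tends_to (fun z => (1 - z ^ 2) * psi z) z0 L).
      { intros eps He. destruct (monotone_power_sum_limit t L t0 tmono tL eps He) as [d [Hd HH]].
        destruct (tends_to_pow z0 2 d Hd) as [d' [Hd' H']].
        exists d'. split; [exact Hd'|]. intros z Hz Hzd. apply (HH (z ^ 2)); [auto|].
        rewrite <- E0. now apply H'. }
      assert (TP := tends_to_mult _ _ _ _ _ TS
        (tends_to_plus _ _ _ _ _ (tends_to_const z0 1)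
          (tends_to_mult _ _ _ _ _ (tends_to_const z0 alpha) (tends_to_pow z0 m)))).
      intros eps He. destruct (TP eps He) as [d [Hd HH]]. exists d. split; [exact Hd|].
      intros z Hz Hzd. specialize (HH z Hz Hzd).
      replace ((1 - z ^ 2) * (psi z + alpha * z ^ m * psi z))
        with ((1 - z ^ 2) * psi z * (1 + alpha * z ^ m)) by ring.
      exact HH. }
    apply (convex_vertical_of_boundary_limits f (power_sum p) (power_sum q) psi
      (fun z => alpha * z ^ m * psi z)
      (L * (1 + alpha * 1 ^ m)) (L * (1 + alpha * (- (1)) ^ m))); auto.
    + apply boundary_value_cases; auto. now rewrite Cpow_1_l, Cmod_1.
    + apply boundary_value_cases; auto. rewrite Cmod_pow, Cmod_opp, Cmod_1. apply pow1.
  - exists (power_sum p), (power_sum q). split; [exact Hparts|].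
    intros z Hz. exists (psi z), (alpha * z ^ m * psi z).
    split; [auto|]. split; [auto|]. split; [auto|]. field. auto.
Qed.

Theorem theorem2 :
  forall (a b : C) (m : nat) (alpha : C),
    (exists x y : R, (0 < x)%R /\ (0 < y)%R /\ a = RtoC x /\ b = RtoC y) \/
    (a <> 0 /\ (0 < Re a)%R /\ b = Cconj a) ->
    (1 <= m)%nat ->
    ((Re (a * b) <= Rmin (1 / 2) (Re (a + b) / 3) /\
      Cmod alpha * (Re (Beta a b) - 1) <= 1) \/
     (Re (a * b) >= Rmax (1 / 2) (Re (a + b) / 3) /\
      Cmod alpha <= Re (Beta a b) - 1))%R ->
    let f : C -> C := fun z =>
      z * hypF a b (a + b) (z ^ 2) +
      Cconj (alpha * z ^ (m + 1) / INR (m + 1) *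
             power_sum (hadamard (coef_sq (hyp_coef a b (a + b)))
                                 (hyp_coef 2 (INR (m + 1)) (INR (m + 2)))) z)
    in
    class_F2 f /\ convex_vertical f /\ has_dilatation f (fun z => alpha * z ^ m).
Proof.
  intros a b m alpha Hab Hm Hcond f.
  assert (Hsp : exists sigma p : R, (0 < p)%R /\ a + b = sigma /\ a * b = p /\ (0 < Re a)%R /\ (0 < Re b)%R).
  { destruct Hab as [[x [y [Hx [Hy [-> ->]]]]]|[_ [Ha ->]]].
    - exists (x + y)%R, (x * y)%R. rewrite RtoC_plus, RtoC_mult, !re_RtoC.
      repeat split; auto. nra.
    - exists (2 * Re a)%R, (Cmod a ^ 2)%R. rewrite Cmod2_conj, re_conj. repeat split; auto.
      + rewrite Cmod2_alt. nra.
      + apply C_ext; simpl; unfold Re, Im; ring. }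
  destruct Hsp as [sigma [p [Hp [Es [Ep [Ha Hb]]]]]].
  assert (Hs : (0 < sigma)%R) by (rewrite <- (re_RtoC sigma), <- Es, re_plus; lra).
  destruct (Beta_limit a b sigma p Ha Hb Es Ep Hp) as [c [Hc [EB Lc]]].
  rewrite EB, Es, Ep, !re_RtoC in Hcond.
  set (A := real_hyp_coef sigma p).
  set (t := fun n => (INR (2 * n + 1) * A n)%R).
  assert (t0 : t 0%nat = 1%R) by (unfold t, A; simpl; ring).
  assert (tL : is_lim_seq t (2 * c)%R) by now apply odd_coef_limit.
  destruct (odd_coef_monotone sigma p Hs Hp) as [Tdec Tinc].
  fold A in Tdec, Tinc. fold t in Tdec, Tinc.
  (* Since Re (Beta a b) = 1 / c, both hypotheses on alpha are the same bound in
     terms of the limit 2 c. *)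
  assert (Hboth : monotone t /\ (Cmod alpha * (1 + Rabs (2 * c - 1)) <= 1 - Rabs (2 * c - 1))%R).
  { assert (Al := Cmod_ge_0 alpha).
    assert (Ic : (c * / c = 1)%R) by (field; lra).
    destruct Hcond as [[H1 H2]|[H1 H2]].
    - assert (M1 := Rmin_l (1 / 2) (sigma / 3)). assert (M2 := Rmin_r (1 / 2) (sigma / 3)).
      assert (D := Tdec ltac:(lra)). split; [now right|].
      assert (B := is_lim_seq_decr_compare t _ tL D 0%nat). rewrite t0 in B.
      rewrite Rabs_left1 by lra.
      assert (F : (c * (Cmod alpha * (/ c - 1)) <= c * 1)%R) by (apply Rmult_le_compat_l; lra).
      nra.
    - assert (M1 := Rmax_l (1 / 2) (sigma / 3)). assert (M2 := Rmax_r (1 / 2) (sigma / 3)).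
      assert (D := Tinc ltac:(lra)). split; [now left|].
      assert (B := is_lim_seq_incr_compare t _ tL D 0%nat). rewrite t0 in B.
      rewrite Rabs_pos_eq by lra.
      assert (F : (c * Cmod alpha <= c * (/ c - 1))%R) by (apply Rmult_le_compat_l; lra).
      nra. }
  destruct Hboth as [tmono Halpha].
  assert (EA : forall n, hyp_coef a b (a + b) n = A n) by (intro; now apply hyp_coef_real).
  assert (BA : bounded_coef (hyp_coef a b (a + b))).
  { destruct (monotone_bounded t _ t0 tmono tL) as [M HM]. exists M. intro n. rewrite EA.
    eapply Rle_trans; [|apply (HM n)]. unfold t. rewrite Cmod_R, Rabs_mult.
    assert (P := pos_INR n). assert (Q := Rabs_pos (A n)).
    rewrite (Rabs_pos_eq (INR _)) by apply pos_INR.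
    rewrite plus_INR, mult_INR. simpl (INR 2). simpl (INR 1). nra. }
  set (H := hadamard (coef_sq (hyp_coef a b (a + b))) (hyp_coef 2 (INR (m + 1)) (INR (m + 2)))).
  assert (BH : bounded_coef H).
  { destruct (bounded_coef_sq _ BA) as [M HM]. exists (M * INR (m + 1))%R. intro n.
    unfold H, hadamard. rewrite Cmod_mult, hyp_coef_2_kernel, Cmod_R.
    assert (P := pos_INR n). assert (Q := pos_INR m).
    apply Rmult_le_compat; [apply Cmod_ge_0|apply Rabs_pos|apply HM|].
    rewrite S_INR, !plus_INR. simpl (INR 1).
    rewrite Rabs_pos_eq by (apply Rdiv_le_0_compat; nra).
    apply Rmult_le_reg_r with (INR m + 1 + INR n)%R; [lra|]. unfold Rdiv.
    rewrite Rmult_assoc, Rinv_l by lra. nra. }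
  assert (NM : RtoC (INR (m + 1)) <> 0) by (apply RtoC_neq_0, not_0_INR; lia).
  apply (shear_of_monotone_coef f (shift_coef 1 (coef_sq (hyp_coef a b (a + b))))
    (fun n => alpha / INR (m + 1) * shift_coef (m + 1) H n) t (2 * c)); auto.
  - lra.
  - now apply bounded_shift, bounded_coef_sq.
  - now apply bounded_scal, bounded_shift.
  - unfold shift_coef. replace (m + 1)%nat with (S m) by lia. simpl. ring.
  - intro n. unfold derive_coef, shift_coef. change (Nat.ltb (S n) 1) with false. cbv iota.
    replace (S n - 1)%nat with n by lia.
    unfold coef_sq, t. destruct (Nat.even n) eqn:Ev; [|ring].
    rewrite EA, RtoC_mult. f_equal. f_equal. f_equal.
    apply Nat.even_spec in Ev. destruct Ev as [k ->]. rewrite Nat.div2_double. lia.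
  - (* The kernel coefficient (k+1) (m+1) / (m+1+k) cancels the exponent m+1+k
       produced by differentiation and leaves k+1. *)
    intro n. unfold derive_coef, shift_coef.
    replace (m + 1)%nat with (S m) by lia. change (Nat.ltb (S n) (S m)) with (Nat.ltb n m).
    destruct (Nat.ltb_spec n m) as [Hn|Hn]; [ring|].
    replace (S n - S m)%nat with (n - m)%nat by lia.
    unfold H, hadamard. rewrite hyp_coef_2_kernel. unfold coef_sq.
    destruct (Nat.even (n - m)) eqn:Ev; [|ring].
    rewrite EA. unfold t. apply Nat.even_spec in Ev. destruct Ev as [k Ek].
    rewrite Ek, Nat.div2_double.
    replace (m + 1 + 2 * k)%nat with (S n) by lia.
    replace (m + 1)%nat with (S m) by lia. replace (2 * k + 1)%nat with (S (2 * k)) by lia.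
    assert (P1 : INR (S n) <> 0%R) by (apply not_0_INR; lia).
    assert (P2 : RtoC (INR (S n)) <> 0) by now apply RtoC_neq_0.
    replace (m + 1)%nat with (S m) in NM by lia.
    rewrite RtoC_div, !RtoC_mult by exact P1. field. auto.
  - intros z Hz. unfold f.
    rewrite power_sum_scal by (auto using bounded_converges, bounded_shift).
    rewrite !(fun k c Hc => proj2 (power_sum_shift k c z Hc Hz)) by (auto using bounded_converges, bounded_coef_sq).
    rewrite power_sum_coef_sq by (auto using bounded_converges, bounded_coef_sq).
    unfold hypF. rewrite Cpow_1_r. f_equal. f_equal. fold H. field. exact NM.
Qed.
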